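(* Let $f:\mathbb{R}^p\to\mathbb{R}$, its maximizer $x^*$, and a symmetric positive semidefinite matrix $G^2\le -\nabla^2 f(x^* )$ be such that $u\mapsto \ell(x^*+u)=f(x^*+u)+\frac12\|Gu\|^2$ is concave on $\mathbb{R}^p$. With the notation of the context (for fixed $\nu\in(0,1)$, $\mathtt{x}>0$), suppose that $-\ell(\cdot)=n\,h(\cdot)$ for some $n>0$ and a strongly convex function $h$ satisfying $$\sup_{u\in\mathcal{U}}\sup_{t\in[0,1]}\frac{|\langle\nabla^3h(x^*+tu),u^{\otimes3}\rangle|}{\langle\nabla^2h(x^* ),u^{\otimes2}\rangle^{3/2}}\le \mathsf{c}_3,$$ and that $\mathsf{c}_3\,\mathtt{r}_G\,n^{-1/2}\le 3/4$. Then, for $X\sim P_f$ and $\gamma_G\sim N(0,\mathsf{D}_G^{-2})$, $$\sup_{A\in\mathcal{B}(\mathbb{R}^p)}\bigl|P_f(X-x^*\in A)-\mathbb{P}(\gamma_G\in A)\bigr|\le 2\mathsf{c}_3\sqrt{\frac{(\mathtt{p}_G+1)^3}{n}}+4e^{-\mathtt{x}}.$$ If in addition $$\sup_{u\in\mathcal{U}}\sup_{t\in[0,1]}\frac{|\langle\nabla^4h(x^*+tu),u^{\otimes4}\rangle|}{\langle\nabla^2h(x^* ),u^{\otimes2}\rangle^{2}}\le \mathsf{c}_4,$$ then $$\sup_{A\in\mathcal{B}_s(\mathbb{R}^p)}\bigl|P_f(X-x^*\in A)-\mathbb{P}(\gamma_G\in A)\bigr|\le \frac{\mathsf{c}_3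^2(\mathtt{p}_G+2)^3+2\mathsf{c}_4(\mathtt{p}_G+1)^2}{2n}+4e^{-\mathtt{x}}.$$
   Context: Setting: $f:\mathbb{R}^p\to\mathbb{R}$ is three times (four times, for the second bound) continuously differentiable, $\int e^{f(x)}dx<\infty$, $x^*$ is a point of global maximum of $f$, and $-\nabla^2 f(x^* )$ is strictly positive definite. $P_f$ is the probability measure with density proportional to $e^{f(x)}$. Notation: $\mathsf{D}_G^2=-\nabla^2 f(x^* )$, $\mathsf{D}^2=-\nabla^2 f(x^* )-G^2=-\nabla^2\ell(x^* )$; $\mathsf{D},\mathsf{D}_G,G$ are symmetric positive semidefinite square roots. Effective dimension $\mathtt{p}_G=\operatorname{tr}(\mathsf{D}^2\mathsf{D}_G^{-2})$. For fixed $\nu\in(0,1)$ (e.g. $\nu=2/3$) and $\mathtt{x}>0$: $\mathtt{r}_G=2\sqrt{\mathtt{p}_G}+\sqrt{2\mathtt{x}}$ and $\mathcal{U}=\{u\in\mathbb{R}^p:\|\mathsf{D}u\|\le\nu^{-1}\mathtt{r}_G\}$. In the suprema of ratios $u\neq0$. $\mathcal{B}(\mathbb{R}^p)$ is the Borel $\sigma$-field and $\mathcal{B}_s(\mathbb{R}^p)$ the class of centrally symmetric Borel sets ($A=-A$). *)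

(* Defs.v *)
From HB Require Import structures.
From mathcomp Require Import all_boot all_order all_algebra.
From mathcomp Require Import all_classical all_reals all_analysis.
Set Implicit Arguments.
Unset Strict Implicit.
Unset Printing Implicit Defensive.
Import Order.TTheory GRing.Theory Num.Theory numFieldNormedType.Exports.
Local Open Scope classical_set_scope.
Local Open Scope ring_scope.

(* R^n is the type of row vectors, with the Borel sigma-algebra of its topology. *)
Definition borelRV (R : realType) (n : nat) :=
  g_sigma_algebraType (@open 'rV[R]_n).
HB.instance Definition _ R n := Measurable.on (borelRV R n).

Section borelRV_measurability.
Context {R : realType}.

Lemma measurable_coordRV n (i : 'I_n) :
  measurable_fun [set: borelRV R n]
    (fun v : borelRV R n => (v : 'rV[R]_n) ord0 i : measurableTypeR R).
Proof.
apply: (measurability _ (measurable_realfun.RGenOpens.measurableE R)).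
move=> _ [_ [a [b ->]] <-]; rewrite setTI; apply: sub_sigma_algebra.
have /continuousP : continuous (fun M : 'rV[R]_n => M ord0 i).
  exact: coord_continuous.
by apply; exact: interval_open.
Qed.

Lemma open_ratboxRV n (A : set 'rV[R]_n) : open A ->
  let box (b : 'rV[rat]_n * rat) :=
    [set w : 'rV[R]_n | forall i, `|ratr (b.1 ord0 i) - w ord0 i| < ratr b.2] in
  A = \bigcup_(b : 'rV[rat]_n * rat) [set w | box b w /\ box b `<=` A].
Proof.
move=> oA box; apply/seteqP; split => [v Av|v [b _ []]]; last by move=> bv; apply.
have /nbhs_ballP[e /= e0 eA] : nbhs v A by exact: open_nbhs_nbhs.
have e2 : 0 < e / 2 by rewrite divr_gt0.
have [q] := rat_in_itvoo e2.
rewrite in_itv/= => /andP[q0 qe].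
have approx i : exists c : rat, `|ratr c - v ord0 i| < ratr q.
  have lt_itv : v ord0 i - ratr q < v ord0 i + ratr q.
    by rewrite ltrD2l gtrN.
  have [c] := rat_in_itvoo lt_itv.
  by rewrite in_itv/= => c_itv; exists c; rewrite distrC ltr_distlC.
have [c cP] := choice approx.
exists (\row_i c i, q) => //; split => [i|w bw] /=; first by rewrite mxE.
apply: eA; split => // i j; rewrite (ord1 i) /ball/=.
have := bw j; rewrite /= mxE => wj.
rewrite -(subrKA (ratr (c j))) (le_lt_trans (ler_normD _ _))//.
rewrite (splitr e) ltrD//; last exact: lt_trans qe.
by rewrite distrC (lt_trans (cP j)).
Qed.

Lemma measurable_fun_borelRV d (T : measurableType d) n (g : T -> borelRV R n) :
  (forall i, measurable_fun [set: T]
    (fun t => (g t : 'rV[R]_n) ord0 i : measurableTypeR R)) ->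
  measurable_fun [set: T] g.
Proof.
move=> mg; apply: (@measurability _ _ T (borelRV R n) setT g (@open 'rV[R]_n)) => // _ [A oA <-].
rewrite setTI (open_ratboxRV oA) preimage_bigcup.
apply: countable_bigcupT_measurable; first exact: countableP.
move=> [c q] /=.
have [cqA|ncqA] := pselect ([set w : 'rV[R]_n |
    forall i, `|ratr (c ord0 i) - w ord0 i| < ratr q] `<=` A); last first.
  by rewrite (_ : _ @^-1` _ = set0)//; apply/seteqP; split => // t [].
rewrite (_ : _ @^-1` _ = \bigcap_i
    [set t | `|ratr (c ord0 i) - (g t : 'rV[R]_n) ord0 i| < ratr q]); last first.
  by apply/seteqP; split => [t [+ _] i _|t gt]; [exact|split => // i; exact: gt].
apply: fin_bigcap_measurable; first exact: finite_finset.
move=> i _.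
rewrite (_ : mkset _ = (fun t => (g t : 'rV[R]_n) ord0 i) @^-1`
    `](ratr (c ord0 i) - ratr q), (ratr (c ord0 i) + ratr q)[); last first.
  by apply/seteqP; split => t /=; rewrite in_itv/= -ltr_distlC.
by rewrite -[X in measurable X]setTI; exact: mg.
Qed.

Definition vconsRV n (tv : measurableTypeR R * borelRV R n) : borelRV R n.+1 :=
  row_mx (tv.1%:M : 'M[R]_1) (tv.2 : 'rV[R]_n).

Lemma measurable_vconsRV n : measurable_fun setT (@vconsRV n).
Proof.
apply: measurable_fun_borelRV => i.
case: (unliftP ord0 i) => [j ->|->].
  rewrite (_ : (fun _ => _) = (fun v : borelRV R n => (v : 'rV[R]_n) ord0 j) \o snd).
    by apply: measurableT_comp => //; exact: measurable_coordRV.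
  apply/funext => -[t v] /=.
  have -> : lift ord0 j = rshift 1 j by exact/val_inj.
  exact: (row_mxEr (t%:M : 'M[R]_1) (v : 'rV[R]_n)).
rewrite (_ : (fun _ => _) = fst)//.
apply/funext => -[t v] /=.
have -> : ord0 = lshift n (ord0 : 'I_1) by exact/val_inj.
by rewrite [LHS](row_mxEl (t%:M : 'M[R]_1) (v : 'rV[R]_n)) mxE eqxx.
Qed.

Lemma sigma_finite_vconsRV n (m : {sigma_finite_measure set (borelRV R n) -> \bar R}) :
  sigma_finite setT (pushforward (@lebesgue_measure R \x m)%E (@vconsRV n)).
Proof.
have /sigma_finiteP[F [FT ndF Foo]] := sigma_finiteT (@lebesgue_measure R).
have /sigma_finiteP[G [GT ndG Goo]] := sigma_finiteT m.
pose unc (v : borelRV R n.+1) : measurableTypeR R * borelRV R n :=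
  ((v : 'rV[R]_(1 + n)) ord0 (lshift n ord0), rsubmx (v : 'rV[R]_(1 + n))).
have munc : measurable_fun setT unc.
  apply/measurable_fun_pairP; split; first exact: measurable_coordRV.
  apply: measurable_fun_borelRV => i /=.
  under eq_fun do rewrite mxE.
  exact: measurable_coordRV.
have uncK tv : unc (vconsRV tv) = tv.
  by case: tv => t v; rewrite /unc /vconsRV /= row_mxKr row_mxEl mxE eqxx.
exists (fun k => unc @^-1` (F k `*` G k)).
  rewrite -preimage_bigcup -[LHS](preimage_setT unc) -setXTT FT GT; congr (_ @^-1` _).
  apply/seteqP; split => [[t v] [[i _ Fi] [j _ Gj]]|[t v] [k _ [Fk Gk]]].
    exists (maxn i j) => //; split.
      by move: (t) Fi; exact/subsetPset/ndF/leq_maxl.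
    by move: (v) Gj; exact/subsetPset/ndG/leq_maxr.
  by split; exists k.
move=> k; have [mF Fk] := Foo k; have [mG Gk] := Goo k; split.
  by rewrite -[X in measurable X]setTI; apply: munc => //; exact: measurableX.
rewrite /pushforward -comp_preimage (_ : unc \o _ = id) ?preimage_id//; last first.
  by apply/funext => tv /=; exact: uncK.
by rewrite product_measure1E// lte_mul_pinfty// ge0_fin_numE.
Qed.
End borelRV_measurability.

Section lebesgue_consRV.
Context {R : realType} {n : nat}.
Variable m : {sigma_finite_measure set (borelRV R n) -> \bar R}.

Definition lebesgue_consRV : set (borelRV R n.+1) -> \bar R :=
  pushforward (@lebesgue_measure R \x m)%E (@vconsRV R n).

Let mcons := @measurable_vconsRV R n.

Let lebesgue_consRV0 : lebesgue_consRV set0 = 0%E.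
Proof. exact: measure0. Qed.

Let lebesgue_consRV_ge0 A : (0 <= lebesgue_consRV A)%E.
Proof. exact: measure_ge0. Qed.

Let lebesgue_consRV_sigma_additive : semi_sigma_additive lebesgue_consRV.
Proof. exact: measure_semi_sigma_additive. Qed.

HB.instance Definition _ := isMeasure.Build _ _ _ lebesgue_consRV
  lebesgue_consRV0 lebesgue_consRV_ge0 lebesgue_consRV_sigma_additive.

HB.instance Definition _ := Measure_isSigmaFinite.Build _ _ _ lebesgue_consRV
  (sigma_finite_vconsRV m).

End lebesgue_consRV.

(* The n-fold product of the Lebesgue measure of R, transported to row vectors;
   lebesgueRV_box gives its value on boxes. *)
Fixpoint lebesgueRV (R : realType) (n : nat) :
    {sigma_finite_measure set (borelRV R n) -> \bar R} :=
  if n is n'.+1 then lebesgue_consRV (lebesgueRV R n')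
  else @dirac _ (borelRV R 0) 0 R.

Lemma lebesgueRV_box (R : realType) (n : nat)
    (A : 'I_n -> set (measurableTypeR R)) :
  (forall i, measurable (A i)) ->
  lebesgueRV R n [set v | forall i, A i ((v : 'rV[R]_n) ord0 i)] =
  (\prod_(i < n) lebesgue_measure (A i))%E.
Proof.
elim: n A => [|n IHn] A mA.
  by rewrite big_ord0 /= diracE mem_set// => -[].
pose B := [set v : borelRV R n | forall i, A (lift ord0 i) ((v : 'rV[R]_n) ord0 i)].
have mB : measurable B.
  rewrite (_ : B = \bigcap_i [set v | A (lift ord0 i) ((v : 'rV[R]_n) ord0 i)]).
    apply: fin_bigcap_measurable; first exact: finite_finset.
    move=> i _; rewrite -[X in measurable X]setTI.
    exact: (measurable_coordRV i _ (mA _)).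
  by apply/seteqP; split => [v Bv i _|v Bv i]; [exact: Bv|exact: (Bv i I)].
rewrite big_ord_recl -(IHn _ (fun i => mA (lift ord0 i))) -/B.
rewrite -product_measure1E//= /lebesgue_consRV /pushforward; congr (_ _ _ _).
have consE (t : R) (v : 'rV[R]_n) : (forall i, A i (vconsRV (t, v) ord0 i)) <->
    A ord0 t /\ forall i, A (lift ord0 i) (v ord0 i).
  have E0 : vconsRV (t, v) ord0 ord0 = t.
    have -> : ord0 = lshift n (ord0 : 'I_1) by exact/val_inj.
    by rewrite [LHS](row_mxEl (t%:M : 'M[R]_1) (v : 'rV[R]_n)) mxE eqxx.
  have ES i : vconsRV (t, v) ord0 (lift ord0 i) = v ord0 i.
    have -> : lift ord0 i = rshift 1 i by exact/val_inj.
    exact: (row_mxEr (t%:M : 'M[R]_1) (v : 'rV[R]_n)).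
  split => [Atv|[At Av] i].
    split => [|i]; first by rewrite -E0.
    by rewrite -ES.
  by case: (unliftP ord0 i) => [j ->|->]; rewrite ?E0 ?ES.
by apply/seteqP; split => -[t v] /consE.
Qed.

Section vectors.
Context {R : realType} {p : nat}.
Implicit Types (u v : 'rV[R]_p) (A : 'M[R]_p).

Definition qform A u : R := (u *m A *m u^T) ord0 ord0.

(* The library norm on 'rV[R]_p is the sup norm, hence this definition. *)
Definition enorm u : R := Num.sqrt (\sum_(i < p) u ord0 i ^+ 2).

Definition posdef A := A^T = A /\ forall u, u != 0 -> 0 < qform A u.

Definition possemidef A := A^T = A /\ forall u, 0 <= qform A u.

Definition psd_sqrt B A := possemidef B /\ B *m B = A.

End vectors.

Section derivatives.
Context {R : realType} {p : nat}.
Implicit Types (g : 'rV[R]_p -> R) (x u : 'rV[R]_p).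

Definition pderiv (i : 'I_p) g : 'rV[R]_p -> R := 'D_(delta_mx ord0 i) g.

(* [:: i1; ..; ik] |-> d_i1 .. d_ik g *)
Definition pderivs (s : seq 'I_p) g : 'rV[R]_p -> R := foldr pderiv g s.

Fixpoint classC (k : nat) g : Prop :=
  continuous g /\
  if k is k'.+1 then
    forall i : 'I_p, (forall x, derivable g x (delta_mx ord0 i)) /\
      classC k' (pderiv i g)
  else True.

Definition hessian g x : 'M[R]_p := \matrix_(i, j) pderivs [:: i; j] g x.

(* <nabla^k g(x), u^{(x) k}>, the full contraction of the k-th derivative tensor
   with k copies of u *)
Definition nabla_form (k : nat) g x u : R :=
  \sum_(s : k.-tuple 'I_p) pderivs s g x * \prod_(i <- s) u ord0 i.

Definition sup_nabla_ratio (k : nat) g x (U : set 'rV[R]_p) : \bar R :=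
  ereal_sup [set ereal_sup [set
      (`|nabla_form k g (x + t *: u) u| / nabla_form 2 g x u `^ (k%:R / 2))%:E
    | t in `[0, 1]] | u in U `\ 0].

Definition strongly_convex g : Prop :=
  exists2 m : R, 0 < m &
    convex_function setT (fun x : 'rV[R]_p => g x - m / 2 * enorm x ^+ 2).

End derivatives.

Section laws.
Context {R : realType} {p : nat}.

Definition gibbs_norm (f : 'rV[R]_p -> R) : \bar R :=
  (\int[lebesgueRV R p]_x (expR (f x))%:E)%E.

(* The law P_f; meaningful when [gibbs_norm f] is finite. *)
Definition gibbs (f : 'rV[R]_p -> R) (A : set (borelRV R p)) : \bar R :=
  (\int[lebesgueRV R p]_(x in A) (expR (f x) / fine (gibbs_norm f))%:E)%E.

Definition gauss_density (S : 'M[R]_p) (x : 'rV[R]_p) : R :=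
  expR (- qform (invmx S) x / 2) / Num.sqrt ((2 * pi) ^+ p * \det S).

(* The law N(0, S), for positive definite S. *)
Definition gauss (S : 'M[R]_p) (A : set (borelRV R p)) : \bar R :=
  (\int[lebesgueRV R p]_(x in A) (gauss_density S x)%:E)%E.

(* sup over A in the class C of |P_f (X - x0 in A) - N(0, S)(A)| *)
Definition sup_dist (C : set (set (borelRV R p))) (f : 'rV[R]_p -> R)
    (x0 : 'rV[R]_p) (S : 'M[R]_p) : \bar R :=
  ereal_sup
    [set `|gibbs f [set x : 'rV[R]_p | A (x - x0)%R] - gauss S A|%E | A in C].

Definition borel_sets : set (set (borelRV R p)) := measurable.

Definition symmetric_borel_sets : set (set (borelRV R p)) :=
  [set A : set (borelRV R p) |
    measurable A /\ [set - x | x in (A : set 'rV[R]_p)] = A].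

End laws.

Section effective_dimension.
Context {R : realType} {p : nat}.

(* In both, D2 is D^2 and DG2 is D_G^2. *)
Definition eff_dim (D2 DG2 : 'M[R]_p) : R := \tr (D2 *m invmx DG2).

Definition local_radius (D2 DG2 : 'M[R]_p) (x : R) : R :=
  2 * Num.sqrt (eff_dim D2 DG2) + Num.sqrt (2 * x).

End effective_dimension.

(* Main.v *)
(* Write w for the density of N(0, D_G^-2), rho(u) = ||D u||, and
   delta(u) = f(xs + u) - f(xs) + ||D_G u||^2 / 2 where xs maximizes f; X - xs
   has density proportional to w e^delta. With tau = c3 / sqrt n, Taylor's formula gives
   |delta| <= tau rho^3 / 6 on {rho <= r_G}, and the even part of delta is at most
   (c4 / n) rho^4 / 24 there; outside, concavity of ell along the ray through u
   bounds the growth of delta by that of its tangent at rho = r_G. Each error term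
   is dominated by w times a combination of tilts exp(lambda rho^2 / 2), whose mean
   under w is at most exp(lambda / (1 - lambda) p_G / 2): a determinant bound in
   which only the effective dimension enters. The far region is cut into geometric
   shells, each with its own rate lambda. Testing only even densities on symmetric
   sets removes the cubic term. *)

Require Import Defs.
From HB Require Import structures.
From mathcomp Require Import all_boot all_order all_algebra.
From mathcomp Require Import all_classical all_reals all_analysis.
From mathcomp Require Import measurable_realfun normal_distribution ring lra.
Set Implicit Arguments.
Unset Strict Implicit.
Unset Printing Implicit Defensive.
Import Order.TTheory GRing.Theory Num.Theory numFieldNormedType.Exports.
Local Open Scope classical_set_scope.
Local Open Scope ring_scope.

(** The constants are explicit and must hold for every positive effective dimension, with no trace
    of the ambient one; this shapes all estimates. A bound [B >= 1] is trivial. When [B < 1],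
    dividing by the normalizing constant leaves a factor [1 - B] in front of the upper error, and
    this factor compensates the denominators [(1 - eta)^2], [(1 - sz / 2)^3] and [1 - exp (- x / 2)]
    that the estimates create. Polynomials in rho are never integrated: they are dominated by a tilt
    of rate [1 / (p_G + 1)] or [2 / (p_G + 2)], whose mass is at most [exp (1 / 2)] or [exp 1]
    whatever p_G is. These two rates are the origin of the shifts [p_G + 1] and [p_G + 2]. The
    condition [tau r_G <= 3 / 4] keeps |delta| below [rho^2 / 8] in the bulk, a quarter of the
    quadratic exponent. Beyond r_G it makes the optimized exponent decrease linearly in the shell
    radius, and it fixes the shell ratio [3 / 2]. *)

(** * Invariance of Lebesgue measure on row vectors under translation and reflection *)

Section lebesgueRV_invariance.
Context {R : realType}.
Local Open Scope ereal_scope.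

(** Uniqueness of Lebesgue measure: the translate gives each half-open interval its length. *)
Lemma lebesgue_measure_shift (a : R) (A : set R) : measurable A ->
  pushforward lebesgue_measure (fun t : measurableTypeR R => (t + a)%R : measurableTypeR R) A
    = lebesgue_measure A.
Proof.
move=> mA.
have mf : measurable_fun setT (fun t : measurableTypeR R => (t + a)%R : measurableTypeR R).
  exact: measurable_funD.
pose pf := measure_function_pushforward__canonical__measure_function_Measure (@lebesgue_measure R) mf.
apply/esym/(lebesgue_measure_unique (mu := pf)) => //= _ [[u v]] _ <-.
rewrite /pf /= /pushforward /=.
have -> : (fun t => t + a)%R @^-1` [set` `]u, v] ] = [set` `]u - a, v - a] ]%R :> set R.
  by apply/seteqP; split => t /=; rewrite !in_itv/= ltrBlDr lerBrDr.
rewrite !lebesgue_measure_itv/= !lte_fin ltrD2r.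
by case: ifP => // _; rewrite -!EFinB; congr (_%:E); lra.
Qed.

Lemma ge0_integral_lebesgue_shift (a : R) (F : measurableTypeR R -> \bar R) :
  measurable_fun setT F -> (forall t, 0 <= F t) ->
  \int[lebesgue_measure]_t F (t + a)%R = \int[lebesgue_measure]_t F t.
Proof.
move=> mF F0.
have mf : measurable_fun setT (fun t : measurableTypeR R => (t + a)%R : measurableTypeR R).
  exact: measurable_funD.
rewrite -[LHS](ge0_integral_pushforward mf lebesgue_measure (D := setT))//.
by apply: eq_measure_integral => /= A mA _; exact: lebesgue_measure_shift.
Qed.

Lemma ge0_integral_lebesgueN (F : measurableTypeR R -> \bar R) :
  measurable_fun setT F -> (forall t, 0 <= F t) ->
  \int[lebesgue_measure]_t F (- t)%R = \int[lebesgue_measure]_t F t.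
Proof.
move=> mF F0.
have mf : measurable_fun setT (fun t : measurableTypeR R => (- t)%R : measurableTypeR R).
  exact: measurableT_comp.
rewrite -[LHS](ge0_integral_pushforward mf lebesgue_measure (D := setT))//.
by apply: eq_measure_integral => /= A mA _; exact: lebesgue_measureN.
Qed.

Lemma integral_lebesgueRV0 (F : borelRV R 0 -> \bar R) :
  measurable_fun setT F ->
  \int[lebesgueRV R 0]_u F u = F 0%R.
Proof.
by move=> mF; rewrite integral_dirac// diracT mul1e.
Qed.

Lemma integral_lebesgueRVS n (F : borelRV R n.+1 -> \bar R) :
  measurable_fun setT F -> (forall u, 0 <= F u) ->
  \int[lebesgueRV R n.+1]_u F u =
  \int[(@lebesgue_measure R \x lebesgueRV R n)]_tv F (vconsRV tv).
Proof.
move=> mF F0; rewrite /= ge0_integral_pushforward//.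
exact: measurable_vconsRV.
Qed.

Lemma continuous_measurable_borelRV m n (g : 'rV[R]_m -> 'rV[R]_n) :
  continuous g ->
  measurable_fun [set: borelRV R m] (g : borelRV R m -> borelRV R n).
Proof.
move=> cg; apply: (@measurability _ _ (borelRV R m) (borelRV R n) setT g (@open 'rV[R]_n)) => //.
move=> _ [A oA <-]; rewrite setTI; apply: sub_sigma_algebra.
by have /continuousP := cg; apply.
Qed.

Lemma continuous_measurable_fun_borelRV n (g : 'rV[R]_n -> R) :
  continuous g ->
  measurable_fun [set: borelRV R n] (g : borelRV R n -> measurableTypeR R).
Proof.
move=> cg; apply: (measurability _ (measurable_realfun.RGenOpens.measurableE R)).
move=> _ [_ [a [b ->]] <-]; rewrite setTI; apply: sub_sigma_algebra.
by have /continuousP := cg; apply; exact: interval_open.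
Qed.

(** Induction on the dimension: [lebesgueRV] is built by adding a first coordinate, and a
    translation acts separately on that coordinate and on the rest, so Tonelli reduces it to the
    line. *)
Lemma ge0_integral_lebesgueRV_shift n (a : 'rV[R]_n) (F : borelRV R n -> \bar R) :
  measurable_fun setT F -> (forall u, 0 <= F u) ->
  \int[lebesgueRV R n]_u F ((u : 'rV[R]_n) + a)%R = \int[lebesgueRV R n]_u F u.
Proof.
have mS m (b : 'rV[R]_m) : measurable_fun [set: borelRV R m]
    ((fun u : 'rV[R]_m => u + b)%R : borelRV R m -> borelRV R m).
  apply: continuous_measurable_borelRV => u.
  exact: (cvgD cvg_id (cvg_cst _)).
elim: n => [|n IHn] in a F * => mF F0.
  rewrite !integral_lebesgueRV0//; last exact: (measurableT_comp mF (mS _ _)).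
  by congr F; rewrite (thinmx0 a) addr0.
rewrite !integral_lebesgueRVS//; last exact: (measurableT_comp mF (mS _ _)).
pose a0 := a ord0 ord0; pose a' : 'rV[R]_n := rsubmx (a : 'rV[R]_(1 + n)).
have E (t : R) (v : 'rV[R]_n) : ((vconsRV (t, v) : 'rV[R]_n.+1) + a)%R =
    vconsRV (t + a0, v + a')%R :> 'rV[R]_n.+1.
  rewrite -[X in (_ + X)%R = _](hsubmxK (a : 'rV[R]_(1 + n))).
  rewrite [LHS](add_row_mx (t%:M) v (lsubmx (a : 'rV_(1 + n))) a').
  suff -> : (t%:M + lsubmx (a : 'rV[R]_(1 + n)) = (t + a0)%:M :> 'M[R]_1)%R by [].
  apply/matrixP => i j; rewrite !ord1 !mxE/= !mulr1n /a0.
  by congr (_ + a _ _)%R; apply/val_inj.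
have mFv : measurable_fun setT (F \o @vconsRV R n).
  by apply: measurableT_comp => //; exact: measurable_vconsRV.
have mFv1 (t : R) : measurable_fun setT (fun v : borelRV R n => F (vconsRV (t, v))).
  exact: (measurableT_comp mFv (pair1_measurable t)).
rewrite !fubini_tonelli1//=; last first.
  exact: (measurableT_comp (measurableT_comp mF (mS _ a)) (@measurable_vconsRV R n)).
rewrite /fubini_F.
rewrite -[RHS](ge0_integral_lebesgue_shift a0); last 2 first.
- by apply: (measurable_fun_fubini_tonelli_F (m2 := lebesgueRV R n) (F \o @vconsRV R n)) => //=.
- by move=> t; exact: integral_ge0.
apply: eq_integral => t _.
rewrite -(IHn a' (fun v => F (vconsRV (t + a0, v)%R)))//.
by apply: eq_integral => v _; rewrite E.
Qed.

Lemma ge0_integral_lebesgueRVN n (F : borelRV R n -> \bar R) :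
  measurable_fun setT F -> (forall u, 0 <= F u) ->
  \int[lebesgueRV R n]_u F (- (u : 'rV[R]_n))%R = \int[lebesgueRV R n]_u F u.
Proof.
have mN m : measurable_fun [set: borelRV R m]
    ((fun u : 'rV[R]_m => - u)%R : borelRV R m -> borelRV R m).
  by apply: continuous_measurable_borelRV => u; exact: (cvgN cvg_id).
elim: n => [|n IHn] in F * => mF F0.
  rewrite !integral_lebesgueRV0//; last exact: (measurableT_comp mF (mN _)).
  by rewrite oppr0.
rewrite !integral_lebesgueRVS//; last exact: (measurableT_comp mF (mN _)).
have E (t : R) (v : 'rV[R]_n) : (- (vconsRV (t, v) : 'rV[R]_n.+1))%R =
    vconsRV (- t, - v)%R :> 'rV[R]_n.+1.
  rewrite [LHS](opp_row_mx (t%:M) v).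
  suff -> : (- t%:M = (- t)%:M :> 'M[R]_1)%R by [].
  by apply/matrixP => i j; rewrite !ord1 !mxE/= !mulr1n.
have mFv : measurable_fun setT (F \o @vconsRV R n).
  by apply: measurableT_comp => //; exact: measurable_vconsRV.
have mFv1 (t : R) : measurable_fun setT (fun v : borelRV R n => F (vconsRV (t, v))).
  exact: (measurableT_comp mFv (pair1_measurable t)).
rewrite !fubini_tonelli1//=; last first.
  exact: (measurableT_comp (measurableT_comp mF (mN _)) (@measurable_vconsRV R n)).
rewrite /fubini_F.
rewrite -[RHS]ge0_integral_lebesgueN; last 2 first.
- by apply: (measurable_fun_fubini_tonelli_F (m2 := lebesgueRV R n) (F \o @vconsRV R n)) => //=.
- by move=> t; exact: integral_ge0.
apply: eq_integral => t _.
rewrite -(IHn (fun v => F (vconsRV (- t, v)%R)))//.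
by apply: eq_integral => v _; rewrite E.
Qed.

End lebesgueRV_invariance.

(** * Quadratic forms, Schur complements and order reversal of inverses *)

Section quadratic_forms.
Context {R : realType}.

Lemma qformD p (A B : 'M[R]_p) u : qform (A + B) u = qform A u + qform B u.
Proof. by rewrite /qform mulmxDr mulmxDl mxE. Qed.

Lemma qformN p (A : 'M[R]_p) u : qform (- A) u = - qform A u.
Proof. by rewrite /qform mulmxN mulNmx mxE. Qed.

Lemma qformZ p c (A : 'M[R]_p) u : qform (c *: A) u = c * qform A u.
Proof. by rewrite /qform -scalemxAr -scalemxAl mxE. Qed.

Lemma qform_scale p (A : 'M[R]_p) c u : qform A (c *: u) = c ^+ 2 * qform A u.
Proof. by rewrite /qform linearZ/= -!scalemxAl -scalemxAr scalerA mxE expr2. Qed.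

Lemma qform_oppv p (A : 'M[R]_p) u : qform A (- u) = qform A u.
Proof. by rewrite -scaleN1r qform_scale sqrrN expr1n mul1r. Qed.

Lemma qform0 p (A : 'M[R]_p) : qform A 0 = 0.
Proof. by rewrite /qform !mul0mx mxE. Qed.

Lemma qform_sqr p (A : 'M[R]_p) u : A^T = A ->
  qform (A *m A) u = enorm (u *m A) ^+ 2.
Proof.
move=> AT; rewrite sqr_sqrtr ?sumr_ge0// => [|i _]; last exact: sqr_ge0.
have -> : qform (A *m A) u = (u *m A *m (u *m A)^T) ord0 ord0.
  by rewrite /qform trmx_mul AT !mulmxA.
by rewrite mxE; apply: eq_bigr => i _; rewrite [X in _ * X]mxE expr2.
Qed.

Lemma posdef_possemidef p (A : 'M[R]_p) : posdef A -> possemidef A.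
Proof.
move=> [AT A0]; split=> // u; have [->|/A0/ltW//] := eqVneq u 0.
by rewrite qform0.
Qed.

Lemma posdefD p (A B : 'M[R]_p) : posdef A -> possemidef B -> posdef (A + B).
Proof.
move=> [AT A0] [BT B0]; split; first by rewrite linearD/= AT BT.
by move=> u u0; rewrite qformD; apply: ltr_pwDl; [exact: A0|exact: B0].
Qed.

(** Completing the square in the first coordinate leaves the form of the Schur complement. This
    drives the inductions on dimension for determinants and for Gaussian integrals. *)
Lemma qform_block n (a : R) (b : 'rV[R]_n) (C : 'M[R]_n) t (v : 'rV[R]_n) : a != 0 ->
  qform (block_mx a%:M b b^T C) (row_mx t%:M v) =
  a * (t + a^-1 * (v *m b^T) ord0 ord0) ^+ 2
    + qform (C - a^-1 *: (b^T *m b)) v.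
Proof.
move=> a0; rewrite /qform mul_row_block tr_row_mx mul_row_col tr_scalar_mx.

set q := (v *m b^T) ord0 ord0.
have XE : v *m b^T = q%:M by exact: mx11_scalar.
have YE : b *m v^T = q%:M by rewrite -(tr_scalar_mx _ q) -XE trmx_mul trmxK.
have -> : v *m (C - a^-1 *: (b^T *m b)) *m v^T =
    v *m C *m v^T - a^-1 *: (v *m b^T *m (b *m v^T)).
  by rewrite mulmxBr mulmxBl -scalemxAr -scalemxAl !mulmxA.
rewrite !mulmxDl -(mulmxA _ b) XE YE -!scalar_mxM.
move: (v *m C *m v^T) => Z.
rewrite scale_scalar_mx [RHS]addrC !(mxE, eqxx, mulr1n)/=.
by field.
Qed.

Lemma posdef_schur n (a : R) (b : 'rV[R]_n) (C : 'M[R]_n) :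
  posdef (block_mx a%:M b b^T C : 'M[R]_(1 + n)) ->
  0 < a /\ posdef (C - a^-1 *: (b^T *m b)).
Proof.
move=> [AT A0].
have a0 : 0 < a.
  have := A0 (row_mx 1%:M 0).
  have -> : qform (block_mx a%:M b b^T C) (row_mx 1%:M 0) = a.
    rewrite /qform mul_row_block !mul0mx !addr0 tr_row_mx mul_row_col trmx0.
    by rewrite mulmx0 addr0 !mul1mx tr_scalar_mx mulmx1 mxE eqxx mulr1n.
  apply; apply/eqP => /(congr1 (fun M : 'rV[R]_(1 + n) => M ord0 (lshift n ord0))).
  by rewrite row_mxEl !mxE/= => /eqP; rewrite oner_eq0.
split => //; split.
  move: AT; rewrite tr_block_mx => /eq_block_mx[_ _ _ CT].
  by rewrite linearB/= CT linearZ/= trmx_mul trmxK.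
move=> v v0.
(* This first coordinate makes the completed square vanish. *)
have := A0 (row_mx (- (a^-1 * (v *m b^T) ord0 ord0))%:M v).
rewrite qform_block ?gt_eqF// addNr expr0n mulr0 add0r; apply.
apply/eqP => /eqP; rewrite -[0]row_mx0 => /eqP/eq_row_mx[_] /eqP.
by rewrite (negbTE v0).
Qed.

Lemma det_schur n (a : R) (b : 'rV[R]_n) (C : 'M[R]_n) : a != 0 ->
  \det (block_mx a%:M b b^T C) = a * \det (C - a^-1 *: (b^T *m b)).
Proof.
move=> a0.
have -> : block_mx a%:M b b^T C = block_mx 1%:M 0 (a^-1 *: b^T) 1%:M *m
    block_mx a%:M b 0 (C - a^-1 *: (b^T *m b)).
  rewrite mulmx_block !mul1mx !mul0mx !addr0.
  rewrite mul_mx_scalar scalerA divff// scale1r -scalemxAl.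
  by rewrite addrC subrK.
by rewrite det_mulmx det_lblock det_ublock !det_scalar1 det1 !mul1r.
Qed.

Lemma mx_block_sym n (A : 'M[R]_(1 + n)) : A^T = A ->
  A = block_mx (A ord0 ord0)%:M (ursubmx A) (ursubmx A)^T (drsubmx A).
Proof.
move=> AT; rewrite -[LHS]submxK; congr block_mx.
  rewrite [LHS]mx11_scalar !mxE; congr (A _ _)%:M; exact/val_inj.
by rewrite trmx_ursub AT.
Qed.

Lemma qform_tr n (A : 'M[R]_n) (u v : 'rV[R]_n) : A^T = A ->
  (u *m A *m v^T) ord0 ord0 = (v *m A *m u^T) ord0 ord0.
Proof.
move=> AT.
have -> : u *m A *m v^T = (v *m A *m u^T)^T by rewrite !trmx_mul trmxK AT mulmxA.
by rewrite mxE.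
Qed.

Lemma qform_sub n (A : 'M[R]_n) (u v : 'rV[R]_n) k : A^T = A ->
  qform A (u - k *: v) =
  qform A u - 2 * k * (v *m A *m u^T) ord0 ord0 + k ^+ 2 * qform A v.
Proof.
move=> AT; have := qform_tr u v AT; rewrite /qform.
have -> : (u - k *: v)^T = u^T - k *: v^T by rewrite linearB/= [(k *: v)^T]linearZ.
rewrite !(mulmxBl, mulmxBr).
rewrite -!scalemxAr -!scalemxAl.
move: (u *m A *m u^T) (v *m A *m v^T) (u *m A *m v^T) (v *m A *m u^T) => a b c d.
by rewrite !mxE => ->; ring.
Qed.

Lemma invmx_sym n (A : 'M[R]_n) : A^T = A -> (invmx A)^T = invmx A.
Proof. by move=> AT; rewrite trmx_inv AT. Qed.

(* Completing the square: for [w = v A^-1], positivity of [c B] at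
   [w - c^-1 v B^-1] bounds [v A^-1 v^T] by [c^-1 v B^-1 v^T]. *)
Lemma qform_invmx_le n (A B : 'M[R]_n) c v : 0 < c ->
  A^T = A -> A \in unitmx -> B \in unitmx -> possemidef B ->
  (forall u, c * qform B u <= qform A u) ->
  qform (invmx A) v <= c^-1 * qform (invmx B) v.
Proof.
move=> c0 AT uA uB [BT B0] AB.
set w := v *m invmx A; set z := v *m invmx B.
have wA : qform A w = qform (invmx A) v.
  by rewrite /qform /w -[v *m _ *m A]mulmxA mulVmx// mulmx1 trmx_mul invmx_sym// mulmxA.
have zB : qform B z = qform (invmx B) v.
  by rewrite /qform /z -[v *m _ *m B]mulmxA mulVmx// mulmx1 trmx_mul invmx_sym// mulmxA.
have zBw : (z *m B *m w^T) ord0 ord0 = qform (invmx A) v.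
  by rewrite /qform /z /w -[v *m _ *m B]mulmxA mulVmx// mulmx1 trmx_mul invmx_sym// mulmxA.
have := B0 (w - c^-1 *: z).
rewrite qform_sub// zB zBw.
have := AB w; rewrite wA => h1 h2.
have : c * 0 <= c * (qform B w - 2 * c^-1 * qform (invmx A) v + c^-1 ^+ 2 * qform (invmx B) v).
  by rewrite ler_pM2l.
have -> : c * (qform B w - 2 / c * qform (invmx A) v + c^-1 ^+ 2 * qform (invmx B) v)
  = c * qform B w - 2 * qform (invmx A) v + c^-1 * qform (invmx B) v.
  by field; rewrite gt_eqF.
by rewrite mulr0; move: h1; lra.
Qed.

End quadratic_forms.

(** * Determinants under rank-one updates, and the effective dimension *)

Section determinants.
Context {R : realType}.

Lemma posdef_det_gt0 n (A : 'M[R]_n) : posdef A -> 0 < \det A.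
Proof.
elim: n => [|n IHn] in A *; first by rewrite det_mx00.
move=> pA; have AE := @mx_block_sym R n A pA.1.
move: pA; rewrite AE => /posdef_schur[a0 pS].
by rewrite det_schur ?gt_eqF// mulr_gt0// IHn.
Qed.

Lemma posdef_unitmx n (A : 'M[R]_n) : posdef A -> A \in unitmx.
Proof. by move=> /posdef_det_gt0 d0; rewrite unitmxE unitfE gt_eqF. Qed.

(** The matrix determinant lemma: one bordered matrix has two block-triangular factorizations,
    according to which diagonal block is used for the elimination. *)
Lemma det_rank1 n (A : 'M[R]_n) (u v : 'rV[R]_n) : A \in unitmx ->
  \det (A + u^T *m v) = \det A * (1 + (v *m invmx A *m u^T) ord0 ord0).
Proof.
move=> uA.
transitivity (\det (block_mx 1%:M (- v) u^T A : 'M[R]_(1 + n))).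
  have -> : block_mx 1%:M (- v) u^T A =
      block_mx 1%:M 0 u^T 1%:M *m block_mx 1%:M (- v) 0 (A + u^T *m v).
    by rewrite mulmx_block !mul1mx !mul0mx mulmx1 !addr0 mulmxN addrC addrK.
  by rewrite det_mulmx det_lblock det_ublock !det1 !mul1r.
have -> : block_mx 1%:M (- v) u^T A =
    block_mx 1%:M (- (v *m invmx A)) 0 1%:M *m
    block_mx (1%:M + v *m invmx A *m u^T) 0 u^T A.
  rewrite mulmx_block !mul1mx !mul0mx !add0r mulNmx addrK mulNmx.
  by rewrite -mulmxA mulVmx// mulmx1.
rewrite det_mulmx det_lblock det_ublock !det1 !mul1r mulrC; congr (_ * _).
by rewrite [X in \det X]mx11_scalar det_scalar1 !mxE eqxx mulr1n.
Qed.

Lemma possemidef_rank1 n lam (v : 'rV[R]_n) : 0 <= lam ->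
  possemidef (lam *: (v^T *m v)).
Proof.
move=> l0; split; first by rewrite linearZ/= trmx_mul trmxK.
move=> u; rewrite qformZ mulr_ge0// /qform mulmxA -mulmxA mxE big_ord1.
have -> : (v *m u^T) ord0 ord0 = (u *m v^T) ord0 ord0.
  have -> : v *m u^T = (u *m v^T)^T by rewrite trmx_mul trmxK.
  by rewrite mxE.
by rewrite -expr2 sqr_ge0.
Qed.

(** The lower bound [c *: B] survives every update because the added term is semidefinite. So each
    factor of [det_rank1] is controlled by the same inverse [invmx B], and [1 + y <= expR y] turns
    the product into the exponential of a sum. *)
Lemma det_add_rank1s n (A B : 'M[R]_n) c lam (s : seq 'rV[R]_n) :
  0 < c -> 0 <= lam -> posdef A -> posdef B ->
  (forall u, c * qform B u <= qform A u) ->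
  \det (A + \sum_(v <- s) lam *: (v^T *m v)) <=
  \det A * expR (lam / c * \sum_(v <- s) qform (invmx B) v).
Proof.
move=> c0 l0 + pB; elim: s => [|v s IHs] in A *.
  by move=> _ _; rewrite !big_nil addr0 mulr0 expR0 mulr1.
move=> pA AB; rewrite !big_cons addrA.
have pA' : posdef (A + lam *: (v^T *m v)).
  by apply: posdefD => //; exact: possemidef_rank1.
have /(IHs _ pA') : forall u, c * qform B u <= qform (A + lam *: (v^T *m v)) u.
  move=> u; rewrite qformD (le_trans (AB u))// lerDl.
  by have [_] := possemidef_rank1 v l0; exact.
move=> /le_trans; apply.
rewrite mulrDr expRD mulrA ler_pM2r ?expR_gt0//.
have -> : lam *: (v^T *m v) = (lam *: v)^T *m v.
  by rewrite linearZ/= -scalemxAl.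
rewrite det_rank1 ?posdef_unitmx// ler_pM2l ?posdef_det_gt0//.
rewrite (le_trans (expR_ge1Dx _))// ler_expR.
rewrite linearZ/= -scalemxAr mxE -mulrA ler_wpM2l//.
have [BT _] := pB; have [AT _] := pA.
apply: qform_invmx_le => //; [exact: posdef_unitmx..|exact: posdef_possemidef].
Qed.

Lemma posdef_invmx n (Q : 'M[R]_n) : posdef Q -> posdef (invmx Q).
Proof.
move=> pQ; have Qu := posdef_unitmx pQ; split; first exact: invmx_sym pQ.1.
move=> u u0.
have -> : qform (invmx Q) u = qform Q (u *m invmx Q).
  by rewrite /qform -[u *m _ *m Q]mulmxA mulVmx// mulmx1 trmx_mul invmx_sym ?pQ.1// mulmxA.
apply: pQ.2; apply: contra_neq u0 => uQ.
by rewrite -[u]mulmx1 -(mulVmx Qu) mulmxA uQ mul0mx.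
Qed.

(** Cyclicity of the trace puts the effective dimension in the form of the sum in [det_add_rank1s],
    taken over the rows of [D]. *)
Lemma eff_dim_sum n (Q D : 'M[R]_n) : D^T = D ->
  eff_dim (D *m D) Q = \sum_(i < n) qform (invmx Q) (row i D).
Proof.
move=> DT; have Dij i j : D i j = D j i by rewrite -[in LHS]DT mxE.
rewrite /eff_dim -mulmxA mxtrace_mulC; apply: eq_bigr => i _.
rewrite /qform -row_mul !mxE; apply: eq_bigr => j _.
by rewrite [row _ _ _ _]mxE [_^T _ _]mxE [row _ _ _ _]mxE (Dij i j).
Qed.

Lemma eff_dim_gt0 n (Q D : 'M[R]_n) : posdef Q -> D^T = D -> D != 0 ->
  0 < eff_dim (D *m D) Q.
Proof.
move=> pQ DT; apply: contraTT; rewrite -leNgt eff_dim_sum// => le0.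
have q0 i : 0 <= qform (invmx Q) (row i D).
  exact: (posdef_possemidef (posdef_invmx pQ)).2.
have /eqP : \sum_(i < n) qform (invmx Q) (row i D) = 0.
  by apply/eqP; rewrite eq_le le0 sumr_ge0.
rewrite psumr_eq0// => /allP q00.
rewrite negbK; apply/eqP/row_matrixP => i; rewrite row0; apply/eqP.
apply: contraT => ri; have := (posdef_invmx pQ).2 _ ri.
by rewrite (eqP (q00 i _)) ?mem_index_enum ?ltxx.
Qed.

(* [D^2] is a sum of [n] rank-one terms [v^T v] over the rows of [D]; adding them
   back one at a time multiplies the determinant by [1 + lam v A^-1 v^T]. *)
Lemma det_moment n (DG2 D : 'M[R]_n) lam : 0 <= lam < 1 ->
  posdef DG2 -> D^T = D -> (forall u, qform (D *m D) u <= qform DG2 u) ->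
  posdef (DG2 - lam *: (D *m D)) /\
  \det DG2 <= \det (DG2 - lam *: (D *m D)) *
    expR (lam / (1 - lam) * eff_dim (D *m D) DG2).
Proof.
move=> /andP[l0 l1] pG DT DG.
have l10 : 0 < 1 - lam by rewrite subr_gt0.
have AB u : (1 - lam) * qform DG2 u <= qform (DG2 - lam *: (D *m D)) u.
  rewrite qformD qformN qformZ mulrBl mul1r lerD2l lerN2.
  by rewrite ler_wpM2l.
have pA : posdef (DG2 - lam *: (D *m D)).
  split; first by rewrite linearB/= linearZ/= trmx_mul DT pG.1.
  by move=> u u0; rewrite (lt_le_trans _ (AB u))// mulr_gt0//; exact: pG.2.
split => //.
have := det_add_rank1s [seq row i D | i <- index_enum 'I_n] l10 l0 pA pG AB.
rewrite !big_map.
have -> : \sum_(i < n) lam *: ((row i D)^T *m row i D) = lam *: (D *m D).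
  rewrite -scaler_sumr; congr (_ *: _); apply/matrixP => i j.
  rewrite summxE mxE; apply: eq_bigr => k _.
  by rewrite mxE big_ord1 !mxE -[in LHS]DT mxE DT.
by rewrite subrK -eff_dim_sum.
Qed.

End determinants.

(** * Gaussian integrals of positive definite forms *)

Section gaussian_integral.
Context {R : realType}.
Local Open Scope ereal_scope.

(** Read off from the total mass of the normal density with mean [- c] and variance [a^-1]. *)
Lemma integral_gauss1 (a c : R) : (0 < a)%R ->
  \int[lebesgue_measure]_t (expR (- (a * (t + c) ^+ 2) / 2))%:E =
  (Num.sqrt (2 * pi / a))%:E.
Proof.
move=> a0; set s := Num.sqrt a^-1.
have s0 : s != 0%R by rewrite gt_eqF// sqrtr_gt0 invr_gt0.
have s2 : (s ^+ 2 = a^-1)%R by rewrite sqr_sqrtr// invr_ge0 ltW.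
have := integral_normal_pdf (- c) s; rewrite normal_pdfE// => /esym.
have -> : \int[lebesgue_measure]_t (normal_peak s * normal_fun (- c) s t)%:E =
    (normal_peak s)%:E *
    \int[lebesgue_measure]_t (expR (- (a * (t + c) ^+ 2) / 2))%:E.
  under eq_integral do rewrite EFinM.
  rewrite ge0_integralZl//; last 3 first.
  - by apply/measurable_EFinP; exact: measurable_normal_fun.
  - by move=> t _; rewrite lee_fin normal_fun_ge0.
  - by rewrite lee_fin normal_peak_ge0.
  congr (_ * _); apply: eq_integral => t _; congr (expR _)%:E.
  by rewrite s2 opprK; field; rewrite gt_eqF.
have p0 := normal_peak_gt0 s0.
move=> /(congr1 (fun x => (normal_peak s)^-1%:E * x)).
rewrite mule1 muleA -EFinM mulVf ?gt_eqF// mul1e => <-.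
rewrite /normal_peak invrK s2; congr (Num.sqrt _)%:E.
by field; rewrite gt_eqF.
Qed.

Lemma continuous_qform n (A : 'M[R]_n) : continuous (fun u : 'rV[R]_n => qform A u).
Proof.
have -> : (fun u : 'rV[R]_n => qform A u) =
   (fun u => \sum_(j < n) (\sum_(i < n) u ord0 i * A i j) * u ord0 j)%R.
  apply/funext => u; rewrite /qform mxE; apply: eq_bigr => j _.
  by rewrite mxE [X in (_ * X)%R]mxE.
have cA j : continuous (fun u : 'rV[R]_n => \sum_(i < n) u ord0 i * A i j)%R.
  apply: continuous_big => [|i _]; first exact: add_continuous.
  move=> u; apply: continuousM; last exact: cst_continuous.
  exact: coord_continuous.
apply: continuous_big => [|j _]; first exact: add_continuous.
by move=> u; apply: continuousM; [exact: cA|exact: coord_continuous].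
Qed.

Lemma measurable_qform n (A : 'M[R]_n) :
  measurable_fun [set: borelRV R n] (fun u : borelRV R n => qform A u).
Proof. exact: continuous_measurable_fun_borelRV (@continuous_qform _ A). Qed.

Lemma measurable_exp_qform n (A : 'M[R]_n) : measurable_fun [set: borelRV R n]
  (fun u : borelRV R n => (expR (- qform A u / 2))%:E).
Proof.
apply/measurable_EFinP; apply: measurableT_comp => //.
by apply: measurable_funM => //; apply: measurableT_comp => //; exact: measurable_qform.
Qed.

(** The first coordinate is integrated first: by [qform_block] it sees a one-dimensional Gaussian
    whose centre depends on the other coordinates but whose integral does not. The Schur complement
    carries the induction. *)
Lemma integral_gauss_qform n (A : 'M[R]_n) : posdef A ->
  \int[lebesgueRV R n]_u (expR (- qform A u / 2))%:E =
  (Num.sqrt ((2 * pi) ^+ n / \det A))%:E.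
Proof.
elim: n => [|n IHn] in A * => pA.
  rewrite integral_lebesgueRV0; last exact: measurable_exp_qform.
  by rewrite det_mx00 qform0 oppr0 mul0r expR0 expr0 divr1 sqrtr1.
have AE := @mx_block_sym R n A pA.1.
move: (ursubmx _) (drsubmx _) (A ord0 ord0) AE => b C a AE.
have := pA; rewrite AE => /posdef_schur[a0 pS].
rewrite integral_lebesgueRVS; last 2 first.
- exact: measurable_exp_qform.
- by move=> u; rewrite lee_fin expR_ge0.
have mF : measurable_fun setT (fun tv : measurableTypeR R * borelRV R n =>
    (expR (- qform (block_mx a%:M b b^T C) (vconsRV tv) / 2))%:E).
  exact: (measurableT_comp
    (measurable_exp_qform (block_mx a%:M b b^T C : 'M[R]_n.+1))
    (@measurable_vconsRV R n)).
rewrite fubini_tonelli2//.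
rewrite /fubini_G.
pose S := (C - a^-1 *: (b^T *m b))%R.
transitivity (\int[lebesgueRV R n]_v
    ((Num.sqrt (2 * pi / a))%:E * (expR (- qform S v / 2))%:E)).
  apply: eq_integral => v _.
  rewrite -(integral_gauss1 (a^-1 * (v *m b^T) ord0 ord0) a0).
  rewrite -ge0_integralZr//; last first.
    apply/measurable_EFinP; apply: measurableT_comp => //.
    apply: measurable_funM => //; apply: measurableT_comp => //.
    apply: measurable_funM => //; apply: measurable_funX.
    exact: measurable_funD.
  apply: eq_integral => t _.
  by rewrite /vconsRV/= qform_block ?gt_eqF// opprD mulrDl expRD EFinM.
rewrite ge0_integralZl//; last exact: measurable_exp_qform.
rewrite IHn// -EFinM -sqrtrM ?divr_ge0 ?mulr_ge0 ?pi_ge0 ?(ltW a0)//.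
congr (Num.sqrt _)%:E; rewrite det_schur ?gt_eqF// exprS.
by field; rewrite !gt_eqF ?posdef_det_gt0.
Qed.

End gaussian_integral.

(** * Directional derivatives *)

Section directional.
Context {R : realType} {V : normedModType R}.
Implicit Types (g : V -> R) (x y u v w : V).

Lemma is_deriveP g x v d :
  is_derive x v g d <->
  (fun h : R => h^-1 * (g (h *: v + x) - g x)) @ 0^' --> d.
Proof.
split=> [[ex <-]|cg].
  exact: ex.
by split; [apply/cvg_ex; exists d|apply: cvg_lim].
Qed.

Lemma is_derive_line g y u s d : is_derive (y + s *: u) u g d ->
  is_derive s 1 (fun s : R => g (y + s *: u)) d.
Proof.
move=> /is_deriveP gd; split.
  apply/cvg_ex; exists d; move: gd; apply: cvg_trans; apply: near_eq_cvg.
  apply: nearW => h /=; congr (_ * (g _ - _)).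
  by rewrite /shift/= -[h *: 1]/(h * 1) mulr1 scalerDl addrCA addrA.
apply/cvg_lim => //; move: gd; apply: cvg_trans; apply: near_eq_cvg.
apply: nearW => h /=; congr (_ * (g _ - _)).
by rewrite /shift/= -[h *: 1]/(h * 1) mulr1 scalerDl addrCA addrA.
Qed.

Lemma is_derive_scale_dir g x v c d : is_derive x v g d ->
  is_derive x (c *: v) g (c * d).
Proof.
have [->|c0] := eqVneq c 0.
  by rewrite scale0r mul0r => _; exact: is_derive0.
move=> /is_deriveP gd; apply/is_deriveP.
have -> : (fun h : R => h^-1 * (g (h *: (c *: v) + x) - g x)) =
   (fun h => c * (fun k => k^-1 * (g (k *: v + x) - g x)) (h * c)).
  apply/funext => h /=; rewrite scalerA mulrA; congr (_ * _).
  by rewrite invfM mulrCA divff// mulr1.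
apply: cvgM; first exact: cvg_cst.
apply: (@cvg_comp _ _ _ ( *%R^~ c) (fun k => k^-1 * (g (k *: v + x) - g x)) _ 0^') => //.
move=> A; rewrite /dnbhs/= => -[e /= e0 eA].
exists (e / `|c|); first by rewrite /= divr_gt0// normr_gt0.
move=> h /=; rewrite sub0r normrN => hc h0; apply: eA.
  by rewrite /= sub0r normrN normrM -ltr_pdivlMr// normr_gt0.
by rewrite mulf_neq0.
Qed.

Lemma is_derive_continuous_line g y u s d : is_derive (y + s *: u) u g d ->
  {for s, continuous (fun s : R => g (y + s *: u))}.
Proof.
move=> /is_derive_line [ds _].
exact/differentiable_continuous/derivable1_diffP.
Qed.

Lemma MVT_dir g (dg : V -> R) y u : (forall x, is_derive x u g (dg x)) ->
  exists2 s, 0 <= s <= 1 & g (y + u) - g y = dg (y + s *: u).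
Proof.
move=> gd.
have [| |s] := @MVT_segment R (fun s => g (y + s *: u)) (fun s => dg (y + s *: u)) 0 1 ler01.
- by move=> s _; exact: is_derive_line.
- by apply: continuous_subspaceT => s; apply: is_derive_continuous_line (gd _).
rewrite in_itv/= => s01; rewrite scale1r scale0r addr0 subr0 mulr1 => E.
by exists s.
Qed.

(* Directional derivatives are additive in the direction as soon as one of
   them is continuous: the increment in that direction is handled by the mean
   value theorem. *)
Lemma is_derive_add_dir g (gv gw : V -> R) v w :
  (forall x, is_derive x v g (gv x)) -> (forall x, is_derive x w g (gw x)) ->
  continuous gw -> forall x, is_derive x (v + w) g (gv x + gw x).
Proof.
move=> dv dw cw x; apply/is_deriveP.
have /is_deriveP dvx := dv x.
have -> : (fun h : R => h^-1 * (g (h *: (v + w) + x) - g x)) =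
  (fun h => h^-1 * (g (h *: v + x) - g x) +
            h^-1 * (g (h *: v + x + h *: w) - g (h *: v + x))).
  apply/funext => h; rewrite -mulrDr; congr (_ * _).
  by rewrite [RHS]addrC subrKA scalerDr addrAC.
apply: cvgD => //.
apply/cvgrPdist_lt => e e0.
have /cvgrPdist_lt/(_ _ e0) := cw x.
move=> /nbhs_ballP[d /= d0 dP].
have nvw : 0 < `|v| + `|w| + 1 by rewrite ltr_wpDl// addr_ge0.
near=> h.
have h0 : h != 0 by near: h; exact: nbhs_dnbhs_neq.
have [s /andP[s0 s1] ->] := @MVT_dir g (fun x => h * gw x) (h *: v + x) (h *: w)
  (fun x => is_derive_scale_dir h (dw x)).
rewrite mulKf//; apply: dP.
rewrite -ball_normE/= distrC.
have -> : h *: v + x + s *: (h *: w) - x = h *: (v + s *: w).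
  by rewrite scalerDr !scalerA (mulrC s) [LHS]addrAC addrK.
rewrite normrZ; apply: (@le_lt_trans _ _ (`|h| * (`|v| + `|w| + 1))).
  rewrite ler_wpM2l// (le_trans (ler_normD _ _))// -addrA lerD2l.
  rewrite normrZ ger0_norm// (@le_trans _ _ `|w|)//; last by rewrite lerDl.
  by rewrite ler_piMl.
rewrite -ltr_pdivlMr//.
near: h; apply/dnbhs0_lt.
by rewrite divr_gt0.
Unshelve. all: by end_near. Qed.

Lemma is_derive_sum_dir (I : Type) (s : seq I) g (dirs : I -> V) (c : I -> R)
    (dg : I -> V -> R) :
  (forall i x, is_derive x (dirs i) g (dg i x)) -> (forall i, continuous (dg i)) ->
  forall x, is_derive x (\sum_(i <- s) c i *: dirs i) g (\sum_(i <- s) c i * dg i x).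
Proof.
move=> gd cd; elim: s => [|i s IHs] x.
  by rewrite !big_nil; exact: is_derive0.
rewrite !big_cons addrC [X in is_derive _ _ _ X]addrC.
apply: (is_derive_add_dir (gv := fun x => \sum_(j <- s) c j * dg j x)
  (gw := fun x => c i * dg i x)) => //.
  by move=> y; exact: is_derive_scale_dir.
by move=> y; apply: continuousM; [exact: cst_continuous|exact: cd].
Qed.

End directional.

(** * Smoothness classes and contracted derivative tensors *)

Section smooth.
Context {R : realType} {p : nat}.
Implicit Types (g : 'rV[R]_p -> R) (x u : 'rV[R]_p).

Lemma classC_continuous k g : classC k g -> continuous g.
Proof. by case: k => [|k] []. Qed.

Lemma classCS k g : classC k.+1 g -> classC k g.
Proof.
elim: k g => [|k IHk] g [cg dg]; split=> // i.
by have [dgi /IHk] := dg i.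
Qed.

Lemma classC_pderivs s k g : classC (size s + k) g -> classC k (pderivs s g).
Proof.
elim: s k => [//|i s IHs] k; by rewrite [size _]/= addSnnS => /IHs[_ /(_ i)[]].
Qed.

Lemma classC_ext k g1 g2 : g1 =1 g2 -> classC k g1 -> classC k g2.
Proof. by move=> /funext ->. Qed.

Lemma classC_cst k (c : R) : classC k (fun _ : 'rV[R]_p => c).
Proof.
elim: k c => [|k IHk] c; split=> //; try exact: cst_continuous.
move=> i; split=> [x|]; first exact: derivable_cst.
by apply: (classC_ext _ (IHk 0)) => x; rewrite /pderiv derive_cst.
Qed.

Lemma classC_coord k x j : classC k (fun y : 'rV[R]_p => (y - x) ord0 j).
Proof.
have cc : continuous (fun y : 'rV[R]_p => (y - x) ord0 j).
  have -> : (fun y : 'rV[R]_p => (y - x) ord0 j) = (fun y => y ord0 j - x ord0 j).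
    by apply/funext => y; rewrite !mxE.
  by move=> y; apply: continuousB; [exact: coord_continuous|exact: cst_continuous].
have dc i y : is_derive y (delta_mx ord0 i) (fun y : 'rV[R]_p => (y - x) ord0 j)
    ((delta_mx ord0 i : 'rV[R]_p) ord0 j).
  apply/is_deriveP; apply: cvg_near_cst; near=> h.
  have h0 : h != 0 by near: h; exact: nbhs_dnbhs_neq.
  rewrite !(mxE, addrK)/=.
  by set d := _%:R; field.
case: k => [|k]; split=> // i; split=> [y|]; first by have [] := dc i y.
apply: (classC_ext _ (classC_cst k ((delta_mx ord0 i : 'rV[R]_p) ord0 j))) => y.
by have [_ E] := dc i y; rewrite /pderiv E.
Unshelve. all: by end_near. Qed.

Lemma classC_add k g1 g2 : classC k g1 -> classC k g2 ->
  classC k (fun x => g1 x + g2 x).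
Proof.
elim: k g1 g2 => [|k IHk] g1 g2 [c1 d1] [c2 d2];
  have c12 : continuous (fun x => g1 x + g2 x) by move=> x; apply: continuousD; [exact: c1|exact: c2].
  by split.
split=> // i; have [d1i C1] := d1 i; have [d2i C2] := d2 i; split=> [x|].
  exact: derivableD.
by apply: (classC_ext _ (IHk _ _ C1 C2)) => x; rewrite /pderiv deriveD.
Qed.

Lemma classC_mul k g1 g2 : classC k g1 -> classC k g2 ->
  classC k (fun x => g1 x * g2 x).
Proof.
elim: k g1 g2 => [|k IHk] g1 g2 C1' C2'; have [c1 d1] := C1'; have [c2 d2] := C2';
  have c12 : continuous (fun x => g1 x * g2 x) by move=> x; apply: continuousM; [exact: c1|exact: c2].
  by split.
split=> // i; have [d1i C1] := d1 i; have [d2i C2] := d2 i; split=> [x|].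
  exact: derivableM.
have := classC_add (IHk _ _ (classCS C1') C2) (IHk _ _ (classCS C2') C1).
by apply: classC_ext => x; rewrite /pderiv deriveM.
Qed.

Lemma classC_sum k (I : Type) (s : seq I) (g : I -> 'rV[R]_p -> R) :
  (forall i, classC k (g i)) -> classC k (fun x => \sum_(i <- s) g i x).
Proof.
move=> gC; elim: s => [|i s IHs].
  by apply: (classC_ext _ (classC_cst k 0)) => x; rewrite big_nil.
by apply: (classC_ext _ (classC_add (gC i) IHs)) => x; rewrite big_cons.
Qed.

(** The penalty separating [ell] from [f] is smooth of every order, so [h] inherits the smoothness
    of [f]. *)
Lemma classC_sqr_enorm k x (A : 'M[R]_p) :
  classC k (fun y => enorm ((y - x) *m A) ^+ 2).
Proof.
have -> : (fun y => enorm ((y - x) *m A) ^+ 2) =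
    (fun y => \sum_(j < p) (\sum_(i < p) (y - x) ord0 i * A i j) *
                           (\sum_(i < p) (y - x) ord0 i * A i j)).
  apply/funext => y; rewrite sqr_sqrtr ?sumr_ge0// => [|j _]; last exact: sqr_ge0.
  by apply: eq_bigr => j _; rewrite mxE expr2.
apply: classC_sum => j; apply: classC_mul; apply: classC_sum => i;
  by apply: classC_mul; [exact: classC_coord|exact: classC_cst].
Qed.

Lemma classC1_is_derive g x u : classC 1 g ->
  is_derive x u g (\sum_(i < p) u ord0 i * pderiv i g x).
Proof.
move=> [_ dg]; rewrite {1}(row_sum_delta u).
apply: (@is_derive_sum_dir _ _ _ _ g _ _ (fun i => pderiv i g)) => i.
  by move=> y; have [/(_ y) dgi _] := dg i; split.
by have [_ []] := dg i.
Qed.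

Lemma is_derive_lincomb (I : Type) (s : seq I) (F : I -> 'rV[R]_p -> R)
    (d c : I -> R) x u : (forall i, is_derive x u (F i) (d i)) ->
  is_derive x u (fun y => \sum_(i <- s) F i y * c i) (\sum_(i <- s) d i * c i).
Proof.
move=> dF; elim: s => [|i s IHs].
  rewrite big_nil.
  have -> : (fun y : 'rV[R]_p => \sum_(i <- [::]) F i y * c i) = cst 0.
    by apply/funext => y; rewrite big_nil.
  exact: is_derive_cst.
rewrite big_cons.
have -> : (fun y => \sum_(j <- i :: s) F j y * c j) =
    (c i \*: F i) + (fun y => \sum_(j <- s) F j y * c j).
  by apply/funext => y; rewrite big_cons mulrC.
by apply: is_deriveD; rewrite mulrC; exact: is_deriveZ.
Qed.

Lemma nabla_form0 g x u : nabla_form 0 g x u = g x.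
Proof.
rewrite /nabla_form (bigD1 [tuple])//= big_nil mulr1 big1 ?addr0// => s.
by rewrite (tuple0 s) => /eqP.
Qed.

(** The head of the index tuple is the outermost derivative. Splitting it off exhibits each
    contraction as the derivative of the previous one in direction [u], so that the contractions are
    the successive derivatives along a line. *)
Lemma nabla_formS k g x u : nabla_form k.+1 g x u =
  \sum_(s : k.-tuple 'I_p)
    (\sum_(i < p) u ord0 i * pderiv i (pderivs s g) x) * \prod_(i <- s) u ord0 i.
Proof.
rewrite /nabla_form.
rewrite (reindex (fun a : 'I_p * k.-tuple 'I_p => [tuple of a.1 :: a.2]))/=; last first.
  exists (fun s => (thead s, [tuple of behead s])) => [[i s] _|s _].
    by congr pair; apply/val_inj.
  by rewrite [RHS]tuple_eta.
under [RHS]eq_bigr do rewrite mulr_suml.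
rewrite [RHS]exchange_big pair_big/=; apply: eq_bigr => -[i s] _ /=.
by rewrite big_cons; ring.
Qed.

Lemma nabla_form_is_derive k g x u : classC k.+1 g ->
  is_derive x u (fun y => nabla_form k g y u) (nabla_form k.+1 g x u).
Proof.
move=> gC; rewrite nabla_formS; apply: is_derive_lincomb => s.
apply: classC1_is_derive; apply: classC_pderivs.
by rewrite size_tuple addn1.
Qed.

Lemma nabla_form_line k g x u (s : R) : classC k.+1 g ->
  is_derive s 1 (fun s : R => nabla_form k g (x + s *: u) u)
    (nabla_form k.+1 g (x + s *: u) u).
Proof.
move=> gC.
exact: (@is_derive_line _ _ (fun y => nabla_form k g y u) _ _ _ _
  (nabla_form_is_derive _ _ gC)).
Qed.

Lemma nabla_form2 g x u : nabla_form 2 g x u = qform (hessian g x) u.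
Proof.
rewrite nabla_formS /qform mxE.
rewrite (reindex (fun i : 'I_p => [tuple i])); last first.
  exists (fun s => thead s) => [i _|s _]; first by [].
  by case/tupleP: s => i s; apply/val_inj => /=; rewrite (tuple0 s).
apply: eq_bigr => j _ /=; rewrite big_seq1 mxE; congr (_ * _); last by rewrite mxE.
by apply: eq_bigr => i _; rewrite mxE.
Qed.

End smooth.

(** * Convexity and tangents *)

Section convexity.
Context {R : realType}.

Lemma convex_functionP (V : lmodType R) (F : V -> R) :
  convex_function setT (F : convex_lmodType V -> R^o) ->
  forall (x y : V) t, 0 <= t <= 1 ->
    F (x + t *: (y - x)) <= F x + t * (F y - F x).
Proof.
move=> cF x y t t01.
have t01' : Itv.spec (@Itv.num_sem R) (Itv.Real `[0%Z, 1%Z]%R) t.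
  by rewrite /= /Itv.num_sem/= in_itv/= (ger0_real (proj1 (andP t01))).
pose t' : {i01 R} := Itv.mk t01'.
have := cF t' y x (in_setT _) (in_setT _).
have -> : conv t' (y : convex_lmodType V) (x : convex_lmodType V) = x + t *: (y - x) :> V.
  rewrite /conv/= /unstable.onem scalerBl scale1r scalerBr addrCA; congr (_ + _).
move=> /le_trans; apply.
by rewrite convRE/= /unstable.onem; lra.
Qed.

(** If [F y] lay below the tangent, the difference quotients near 0 would exceed the chord slope
    [F y - F x], against the chord inequality at a small positive step. *)
Lemma convex_tangent (V : normedModType R) (F : V -> R) x y d :
  (forall t, 0 <= t <= 1 -> F (x + t *: (y - x)) <= F x + t * (F y - F x)) ->
  is_derive x (y - x) F d -> F x + d <= F y.
Proof.
move=> cF /is_deriveP dF; rewrite leNgt; apply/negP => Fxy.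
have : \forall h \near 0^', F y - F x < h^-1 * (F (h *: (y - x) + x) - F x).
  by apply: (cvgr_gt _ dF); rewrite ltrBlDl.
move=> [e /= e0] /(_ (Num.min (e / 2) 1)) /=.
set h := Num.min _ _.
have h0 : 0 < h by rewrite lt_min ltr01 divr_gt0.
have he : h < e by rewrite gt_min; apply/orP; left; rewrite ltr_pdivrMr// ltr_pMr// ltr1n.
have h1 : h <= 1 by rewrite ge_min lexx orbT.
rewrite sub0r normrN gtr0_norm// => /(_ he (lt0r_neq0 h0)).
rewrite mulrC ltr_pdivlMr// ltNge => /negP; apply.
rewrite lerBlDl addrC mulrC addrC (addrC _ x); apply: le_trans (cF _ _) _; last by [].
by rewrite (ltW h0).
Qed.

End convexity.

(** * Taylor bounds on the unit interval *)

Section taylor.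
Context {R : realType}.

Lemma is_derive_quartic (a b c d e s : R) :
  is_derive s 1 (fun s => a + b * s + c * s ^+ 2 + d * s ^+ 3 + e * s ^+ 4)
    (b + 2 * c * s + 3 * d * s ^+ 2 + 4 * e * s ^+ 3).
Proof.
pose P : {poly R} := a%:P + b *: 'X + c *: 'X^2 + d *: 'X^3 + e *: 'X^4.
have -> : (fun s => a + b * s + c * s ^+ 2 + d * s ^+ 3 + e * s ^+ 4) = horner P.
  by apply/funext => z; rewrite /P !hornerE.
apply: is_derive_eq.
by rewrite /P !(derivD, derivZ, derivC, derivX, derivXn) !hornerE/=; ring.
Qed.

Lemma ler_is_derive (F F1 G G1 : R -> R) :
  (forall s : R, is_derive s 1 F (F1 s)) -> (forall s : R, is_derive s 1 G (G1 s)) ->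
  (forall s : R, 0 <= s <= 1 -> F1 s <= G1 s) -> F 0 <= G 0 ->
  forall s : R, 0 <= s <= 1 -> F s <= G s.
Proof.
move=> dF dG FG1 FG0 s /andP[s0 s1].
have dGF (z : R) : is_derive z 1 (G - F) (G1 z - F1 z) by exact: is_deriveB.
have [|c cs E] := MVT_segment s0 (fun z _ => dGF z).
  apply: continuous_subspaceT => z.
  by apply/differentiable_continuous/derivable1_diffP; have [] := dGF z.
rewrite -subr_ge0; have : 0 <= (G - F) s - (G - F) 0.
  rewrite E subr0 mulr_ge0// subr_ge0 FG1//.
  by move: cs; rewrite in_itv/= => /andP[-> /le_trans->].
by rewrite !fctE; lra.
Qed.

(** Takes the place of integration: a cubic bound on the derivative gives a quartic bound on the
    function. Iterating it produces the Taylor bounds below and the expansions of the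
    exponential. *)
Lemma ler_quartic (F F1 : R -> R) (b c d e : R) :
  (forall s : R, is_derive s 1 F (F1 s)) ->
  (forall s : R, 0 <= s <= 1 ->
    F1 s <= b + 2 * c * s + 3 * d * s ^+ 2 + 4 * e * s ^+ 3) ->
  forall s : R, 0 <= s <= 1 ->
    F s <= F 0 + b * s + c * s ^+ 2 + d * s ^+ 3 + e * s ^+ 4.
Proof.
move=> dF F1le s s01.
apply: (ler_is_derive dF (is_derive_quartic (F 0) b c d e)) s01 => //.
by rewrite /=; lra.
Qed.

(** The second inequality bounds the slope at the far end of the segment; the tangent argument
    outside the bulk needs it together with the first. *)
Lemma taylor3_le (g g1 g2 g3 : R -> R) K :
  (forall s : R, is_derive s 1 g (g1 s)) -> (forall s : R, is_derive s 1 g1 (g2 s)) ->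
  (forall s : R, is_derive s 1 g2 (g3 s)) ->
  (forall s : R, 0 <= s <= 1 -> g3 s <= K) ->
  g 1 <= g 0 + g1 0 + g2 0 / 2 + K / 6 /\ g1 1 <= g1 0 + g2 0 + K / 2.
Proof.
move=> d0 d1 d2 b3.
have h1 : 0 <= (1 : R) <= 1 by rewrite ler01 lexx.
have b2 (s : R) : 0 <= s <= 1 -> g2 s <= g2 0 + K * s.
  move=> s01; apply: le_trans (ler_quartic (b := K) (c := 0) (d := 0) (e := 0) d2 _ s01) _ => [z hz|].
    by have := b3 z hz; lra.
  by lra.
have b1 (s : R) : 0 <= s <= 1 -> g1 s <= g1 0 + g2 0 * s + K / 2 * s ^+ 2.
  move=> s01; apply: le_trans (ler_quartic (b := g2 0) (c := K / 2) (d := 0) (e := 0) d1 _ s01) _ => [z hz|].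
    by have := b2 z hz; lra.
  by lra.
split; last by have := b1 1 h1; lra.
apply: le_trans (ler_quartic (b := g1 0) (c := g2 0 / 2) (d := K / 6) (e := 0) d0 _ h1) _ => [z hz|].
  by have := b1 z hz; lra.
by lra.
Qed.

Lemma taylor4_le (g g1 g2 g3 g4 : R -> R) K :
  (forall s : R, is_derive s 1 g (g1 s)) -> (forall s : R, is_derive s 1 g1 (g2 s)) ->
  (forall s : R, is_derive s 1 g2 (g3 s)) -> (forall s : R, is_derive s 1 g3 (g4 s)) ->
  (forall s : R, 0 <= s <= 1 -> g4 s <= K) ->
  g 1 <= g 0 + g1 0 + g2 0 / 2 + g3 0 / 6 + K / 24.
Proof.
move=> d0 d1 d2 d3 b4.
have h1 : 0 <= (1 : R) <= 1 by rewrite ler01 lexx.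
have b3 (s : R) : 0 <= s <= 1 -> g3 s <= g3 0 + K * s.
  move=> s01; apply: le_trans (ler_quartic (b := K) (c := 0) (d := 0) (e := 0) d3 _ s01) _ => [z hz|].
    by have := b4 z hz; lra.
  by lra.
have b2 (s : R) : 0 <= s <= 1 -> g2 s <= g2 0 + g3 0 * s + K / 2 * s ^+ 2.
  move=> s01; apply: le_trans (ler_quartic (b := g3 0) (c := K / 2) (d := 0) (e := 0) d2 _ s01) _ => [z hz|].
    by have := b3 z hz; lra.
  by lra.
have b1 (s : R) : 0 <= s <= 1 ->
    g1 s <= g1 0 + g2 0 * s + g3 0 / 2 * s ^+ 2 + K / 6 * s ^+ 3.
  move=> s01.
  apply: le_trans (ler_quartic (b := g2 0) (c := g3 0 / 2) (d := K / 6) (e := 0) d1 _ s01) _ => [z hz|].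
    by have := b2 z hz; lra.
  by lra.
apply: le_trans (ler_quartic (b := g1 0) (c := g2 0 / 2) (d := g3 0 / 6) (e := K / 24) d0 _ h1) _ => [z hz|].
  by have := b1 z hz; lra.
by lra.
Qed.

Lemma is_deriveN_fun (g g1 : R -> R) : (forall s : R, is_derive s 1 g (g1 s)) ->
  forall s : R, is_derive s 1 (- g) ((- g1) s).
Proof. by move=> dg s; exact: is_deriveN. Qed.

Lemma taylor3 (g g1 g2 g3 : R -> R) K :
  (forall s : R, is_derive s 1 g (g1 s)) -> (forall s : R, is_derive s 1 g1 (g2 s)) ->
  (forall s : R, is_derive s 1 g2 (g3 s)) ->
  (forall s : R, 0 <= s <= 1 -> `|g3 s| <= K) ->
  `|g 1 - g 0 - g1 0 - g2 0 / 2| <= K / 6.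
Proof.
move=> d0 d1 d2 b3.
have [u _] := taylor3_le d0 d1 d2 (fun s h => le_trans (ler_norm _) (b3 s h)).
have [|l _] := @taylor3_le _ _ _ (- g3) K (is_deriveN_fun d0) (is_deriveN_fun d1) (is_deriveN_fun d2).
  by move=> s /b3; apply: le_trans; rewrite -normrN ler_norm.
by rewrite ler_norml; move: u l; rewrite !fctE; lra.
Qed.

Lemma taylor4 (g g1 g2 g3 g4 : R -> R) K :
  (forall s : R, is_derive s 1 g (g1 s)) -> (forall s : R, is_derive s 1 g1 (g2 s)) ->
  (forall s : R, is_derive s 1 g2 (g3 s)) -> (forall s : R, is_derive s 1 g3 (g4 s)) ->
  (forall s : R, 0 <= s <= 1 -> `|g4 s| <= K) ->
  `|g 1 - g 0 - g1 0 - g2 0 / 2 - g3 0 / 6| <= K / 24.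
Proof.
move=> d0 d1 d2 d3 b4.
have u := taylor4_le d0 d1 d2 d3 (fun s h => le_trans (ler_norm _) (b4 s h)).
have := @taylor4_le _ _ _ _ (- g4) K (is_deriveN_fun d0) (is_deriveN_fun d1)
  (is_deriveN_fun d2) (is_deriveN_fun d3).
have b4' s : 0 <= s <= 1 -> (- g4) s <= K.
  by move=> /b4; apply: le_trans; rewrite -normrN ler_norm.
move=> /(_ b4') l.
by rewrite ler_norml; move: u l; rewrite !fctE; lra.
Qed.

(** If [d < 0], then [g1] is negative just to the right of 0, and the mean value theorem makes [g]
    drop below its minimum. *)
Lemma second_derivative_ge0 (g g1 : R -> R) (d : R) :
  (forall s : R, is_derive s 1 g (g1 s)) -> g1 0 = 0 -> is_derive (0 : R) 1 g1 d ->
  (forall s, g 0 <= g s) -> 0 <= d.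
Proof.
move=> dg g10 /is_deriveP dg1 gmin; rewrite leNgt; apply/negP => d0.
have : \forall h \near 0^', h^-1 * (g1 (h *: 1 + 0) - g1 0) < 0.
  exact: (cvgr_lt _ dg1).
move=> [e /= e0] eP.
have e20 : 0 < e / 2 by rewrite divr_gt0.
have [|c] := MVT e20 (fun z _ => dg z).
  apply: continuous_subspaceT => z.
  by apply/differentiable_continuous/derivable1_diffP; have [] := dg z.
rewrite in_itv/= => /andP[c0 ce] E.
have := eP c; rewrite /= sub0r normrN gtr0_norm// => /(_ _ (lt0r_neq0 c0)).
rewrite g10 subr0 addr0 -[c *: 1]/(c * 1) mulr1.
have -> : c < e by rewrite (lt_trans ce)// ltr_pdivrMr// ltr_pMr// ltr1n.
move=> /(_ isT); rewrite pmulr_rlt0 ?invr_gt0// => gc.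
have := gmin (e / 2); rewrite leNgt -subr_lt0 E => /negP; apply.
by rewrite subr0 pmulr_llt0.
Qed.

End taylor.

(** * Pointwise bounds on the remainder delta *)

Section pointwise.
Context {R : realType} {p : nat}.
Implicit Types (f h : 'rV[R]_p -> R) (x u : 'rV[R]_p).

Definition laplace_rem f xs (Q : 'M[R]_p) u : R := f (xs + u) - f xs + qform Q u / 2.

Lemma gradient_max f xs u : classC 1 f -> (forall y, f y <= f xs) ->
  nabla_form 1 f xs u = 0.
Proof.
move=> fC fmax.
have d0 := nabla_form_line xs u 0 fC.
have d0' : is_derive (0 : R) 1 (fun s : R => nabla_form 0 f (xs + s *: u) u) 0.
  apply: (@derive1_at_max _ _ (-1) 1).
  - by lra.
  - by move=> s _; have [] := nabla_form_line xs u s fC.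
  - by rewrite in_itv/= ltrN10 ltr01.
  - by move=> s _; rewrite !nabla_form0 scale0r addr0.
have [_ e1] := d0; have [_ e2] := d0'.
by move: e1; rewrite e2 scale0r addr0 => <-.
Qed.

Lemma sqr_enorm u : enorm u ^+ 2 = \sum_(i < p) u ord0 i ^+ 2.
Proof. by rewrite sqr_sqrtr ?sumr_ge0// => i _; exact: sqr_ge0. Qed.

Lemma enorm_scale c u : enorm (c *: u) = `|c| * enorm u.
Proof.
rewrite /enorm; under eq_bigr do rewrite mxE exprMn.
by rewrite -mulr_sumr sqrtrM ?sqr_ge0// sqrtr_sqr.
Qed.

Lemma enorm0 : enorm (0 : 'rV[R]_p) = 0.
Proof. by rewrite -(scale0r (0 : 'rV[R]_p)) enorm_scale normr0 mul0r. Qed.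

Lemma enorm_opp u : enorm (- u) = enorm u.
Proof. by rewrite -scaleN1r enorm_scale normrN1 mul1r. Qed.

Lemma sqr_enorm_gt0 u : u != 0 -> 0 < enorm u ^+ 2.
Proof.
move=> u0; rewrite sqr_enorm lt_neqAle sumr_ge0 ?andbT => [|i _]; last exact: sqr_ge0.
apply: contra u0 => /eqP/esym/eqP; rewrite psumr_eq0 => [/allP u0|i _]; last exact: sqr_ge0.
apply/eqP/rowP => i; rewrite mxE; apply/eqP.
by have := u0 i (mem_index_enum i); rewrite /= sqrf_eq0.
Qed.

(** The tangent at [s = 0] to the convex function [h - m / 2 |.|^2] along the line gives
    [h (xs + s u) >= h xs + m / 2 |u|^2 s^2]. The difference of the two sides is then minimal at 0,
    so the contracted Hessian is at least [m |u|^2]. *)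
Lemma strongly_convex_hessian_gt0 h xs u : classC 2 h -> strongly_convex h ->
  nabla_form 1 h xs u = 0 -> u != 0 -> 0 < nabla_form 2 h xs u.
Proof.
move=> hC [m m0 hm] g0 u0.
pose q := enorm u ^+ 2; have q0 : 0 < q by exact: sqr_enorm_gt0.
pose b := \sum_(i < p) xs ord0 i * u ord0 i.
have E (s : R) : enorm (xs + s *: u) ^+ 2 = enorm xs ^+ 2 + 2 * s * b + s ^+ 2 * q.
  rewrite /q !sqr_enorm /b !mulr_sumr -!big_split/=; apply: eq_bigr => i _.
  by rewrite !mxE; ring.
pose g (s : R) := h (xs + s *: u) - m / 2 * enorm (xs + s *: u) ^+ 2.
have gE : g = (fun s : R => nabla_form 0 h (xs + s *: u) u) -
   (fun s => m / 2 * enorm xs ^+ 2 + (m * b) * s + (m / 2 * q) * s ^+ 2 + 0 * s ^+ 3 + 0 * s ^+ 4).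
  by apply/funext => s; rewrite /g E !fctE nabla_form0; field.
have dg : is_derive (0 : R) 1 g (- (m * b)).
  rewrite gE; apply: (is_derive_eq (is_deriveB
    (nabla_form_line xs u 0 (classCS hC)) (is_derive_quartic _ _ _ _ _ _))).
  by rewrite scale0r addr0 g0; field.
have cg (s t : R) : 0 <= t <= 1 -> g (0 + t *: (s - 0)) <= g 0 + t * (g s - g 0).
  move=> t01; have := convex_functionP hm (xs + 0 *: u) (xs + s *: u) t01.
  rewrite /g scale0r !addr0 !subr0 add0r; congr (_ <= _).
  by rewrite addrAC subrr add0r scalerA.
have hs s : h xs + m / 2 * q * s ^+ 2 <= h (xs + s *: u).
  have := @convex_tangent _ R^o g 0 s (s * - (m * b)) (fun t => cg s t).
  rewrite subr0 -[X in is_derive _ X](mulr1 s) => /(_ (is_derive_scale_dir s dg)).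
  rewrite /g scale0r addr0 E; lra.
pose G (s : R) := nabla_form 0 h (xs + s *: u) u -
  (0 + 0 * s + (m / 2 * q) * s ^+ 2 + 0 * s ^+ 3 + 0 * s ^+ 4).
have : 0 <= nabla_form 2 h xs u - m * q.
  apply: (@second_derivative_ge0 _ G (fun s => nabla_form 1 h (xs + s *: u) u -
      (0 + (m * q) * s + 0 * s ^+ 2 + 0 * s ^+ 3 + 0 * s ^+ 4))).
  - move=> s; apply: (is_derive_eq (is_deriveB
      (nabla_form_line xs u s (classCS hC)) (is_derive_quartic _ _ _ _ _ _))).
    by field.
  - by rewrite scale0r addr0 g0; field.
  - apply: (is_derive_eq (is_deriveB
      (nabla_form_line xs u 0 hC) (is_derive_quartic _ _ _ _ _ _))).
    by rewrite scale0r addr0; field.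
  - move=> s; rewrite /G !nabla_form0 scale0r addr0.
    by have := hs s; lra.
have : 0 < m * q by rewrite mulr_gt0.
by lra.
Qed.

(** Besides the bound, a single nonzero point of [U] gives the sign of [c]; the signs of [c3] and
    [c4] are obtained in this way. *)
Lemma le_sup_nabla_ratio k h xs (U : set 'rV[R]_p) c u t :
  (sup_nabla_ratio k h xs U <= c%:E)%E -> U u -> u != 0 -> 0 <= t <= 1 ->
  0 < nabla_form 2 h xs u ->
  0 <= c /\ `|nabla_form k h (xs + t *: u) u| <= c * nabla_form 2 h xs u `^ (k%:R / 2).
Proof.
move=> hc Uu u0 t01 q0.
have : `|nabla_form k h (xs + t *: u) u| / nabla_form 2 h xs u `^ (k%:R / 2) <= c.
  rewrite -lee_fin; apply: le_trans hc.
  apply: (@le_trans _ _ (ereal_sup [set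
      (`|nabla_form k h (xs + t *: u) u| / nabla_form 2 h xs u `^ (k%:R / 2))%:E
    | t in `[0, 1]])).
    by apply: ereal_sup_ubound; exists t => //=; rewrite in_itv.
  apply: ereal_sup_ubound; exists u => //; split => //.
  by apply/eqP.
move=> le; split; first by apply: le_trans le; rewrite divr_ge0// powR_ge0.
by rewrite -ler_pdivrMr// powR_gt0.
Qed.

Lemma powR_3half (a : R) : 0 <= a -> a `^ (3%:R / 2) = Num.sqrt a ^+ 3.
Proof.
move=> a0; rewrite -powR12_sqrt// -powR_mulrn ?powR_ge0// -powRrM; congr (_ `^ _).
by field.
Qed.

Lemma powR_4half (a : R) : 0 <= a -> a `^ (4%:R / 2) = a ^+ 2.
Proof.
move=> a0; rewrite -powR_mulrn//; congr (_ `^ _).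
by field.
Qed.

Section laplace.
Variables (f h : 'rV[R]_p -> R) (xs : 'rV[R]_p) (G D Q : 'M[R]_p) (n r c3 : R).
Let ell y := f y + enorm ((y - xs) *m G) ^+ 2 / 2.
Let rho u := enorm (u *m D).
Let delta := laplace_rem f xs Q.
Hypothesis QE : Q = - hessian f xs.
Hypothesis GT : G^T = G.
Hypothesis DT : D^T = D.
Hypothesis DE : D *m D = Q - G *m G.
Hypothesis fC : classC 3 f.
Hypothesis fmax : forall y, f y <= f xs.
Hypothesis cvx : convex_function setT (fun u : 'rV[R]_p => - ell (xs + u)).
Hypothesis n0 : 0 < n.
Hypothesis hsc : strongly_convex h.
Hypothesis hE : forall y, - ell y = n * h y.
Variable U : set 'rV[R]_p.
Hypothesis rU : forall u, rho u <= r -> U u.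
Hypothesis hc3 : (sup_nabla_ratio 3 h xs U <= c3%:E)%E.

Lemma rho_ge0 u : 0 <= rho u. Proof. exact: sqrtr_ge0. Qed.

Lemma qformQ u : qform Q u = rho u ^+ 2 + enorm (u *m G) ^+ 2.
Proof.
rewrite /rho -!qform_sqr// DE qformD qformN; ring.
Qed.

Lemma classC_h k : classC k f -> classC k h.
Proof.
move=> fk; have := classC_mul (classC_cst k (- n^-1))
  (classC_add fk (classC_mul (classC_sqr_enorm k xs G) (classC_cst k 2^-1))).
apply: classC_ext => y; rewrite mulNr -mulrN -/(ell y) hE mulKf//.
by rewrite gt_eqF.
Qed.

(** Along the line the penalty is the quadratic [s^2 q / 2], so from order three on the contractions
    of [f] and of [- n h] coincide. This is how the assumptions on [h] reach [f]. The induction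
    differentiates the identity of order [k] along the line. *)
Lemma nabla_form_h (k : nat) (s : R) (u : 'rV[R]_p) : classC k f ->
  nabla_form k h (xs + s *: u) u =
  - n^-1 * (nabla_form k f (xs + s *: u) u +
    match k with
    | 0 => s ^+ 2 * enorm (u *m G) ^+ 2 / 2
    | 1 => s * enorm (u *m G) ^+ 2
    | 2 => enorm (u *m G) ^+ 2
    | _ => 0 end).
Proof.
set q := enorm _ ^+ 2.
pose P (k : nat) (s : R) : R := match k with
    | 0 => s ^+ 2 * q / 2 | 1 => s * q | 2 => q | _ => 0 end.
have dP j (z : R) : is_derive z 1 (P j) (P j.+1 z).
  have E (F : R -> R) (b c w : R) : (fun s => 0 + b * s + c * s ^+ 2 + 0 * s ^+ 3 + 0 * s ^+ 4) =1 F ->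
      b + 2 * c * z + 3 * 0 * z ^+ 2 + 4 * 0 * z ^+ 3 = w -> is_derive z 1 F w.
    by move=> /funext <- <-; exact: is_derive_quartic.
  case: j => [|[|[|j]]] /=; last exact: is_derive_cst.
  - by apply: (E _ 0 (q / 2)) => [s'|]; rewrite /P; field.
  - by apply: (E _ q 0) => [s'|]; rewrite /P; field.
  - exact: is_derive_cst.
elim: k s => [|k IHk] s fk.
  rewrite !nabla_form0.
  have nn : n != 0 by rewrite gt_eqF.
  apply: (mulfI nn); rewrite -hE /ell addrAC subrr add0r -scalemxAl enorm_scale.
  rewrite exprMn real_normK ?num_real// -/q; field; exact: nn.
have dh := nabla_form_line xs u s (classC_h fk).
have df := nabla_form_line xs u s fk.
have dr : is_derive s 1 (fun s => nabla_form k h (xs + s *: u) u)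
    (- n^-1 * (nabla_form k.+1 f (xs + s *: u) u + P k.+1 s)).
  have -> : (fun s => nabla_form k h (xs + s *: u) u) =
      (- n^-1) \*: ((fun s => nabla_form k f (xs + s *: u) u) + P k).
    by apply/funext => z; rewrite IHk//; exact: classCS.
  exact: is_deriveZ.
by have [_ <-] := dh; have [_ ->] := dr.
Qed.

(** The denominators of the ratios are thus powers of [rho u / sqrt n], which is the origin of
    [tau = c3 / sqrt n] and of [c4 / n]. *)
Lemma nabla_form2_h u : nabla_form 2 h xs u = rho u ^+ 2 / n.
Proof.
have := nabla_form_h 0 u (classCS fC); rewrite scale0r addr0 => ->.
rewrite nabla_form2 -[hessian f xs]opprK -QE qformN qformQ; field.
by rewrite gt_eqF.
Qed.

Let C1 : classC 1 f. Proof. exact: classCS (classCS fC). Qed.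

Let grad0 u : nabla_form 1 f xs u = 0. Proof. exact: gradient_max. Qed.

Lemma nabla_form1_h u : nabla_form 1 h xs u = 0.
Proof.
have := nabla_form_h 0 u C1; rewrite scale0r addr0 => ->.
by rewrite /= grad0 mul0r addr0 mulr0.
Qed.

(** Strong convexity forces [D] to be injective. *)
Lemma rho_gt0 u : u != 0 -> 0 < rho u.
Proof.
move=> u0; have := strongly_convex_hessian_gt0 (classC_h (classCS fC)) hsc (nabla_form1_h u) u0.
rewrite nabla_form2_h pmulr_lgt0 ?invr_gt0//.
by rewrite exprn_even_gt0//= => r0; rewrite lt_neqAle eq_sym r0 rho_ge0.
Qed.

Lemma third_derivative_bound u s : rho u <= r -> 0 <= s <= 1 ->
  `|nabla_form 3 f (xs + s *: u) u| <= c3 / Num.sqrt n * rho u ^+ 3.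
Proof.
(* The ratios exclude [u = 0], where the contraction itself vanishes. *)
move=> ur s01; have [->|u0] := eqVneq u 0.
  have -> : nabla_form 3 f (xs + s *: 0) 0 = 0.
    rewrite nabla_formS big1// => t _; rewrite big1 ?mul0r// => i _.
    by rewrite mxE mul0r.
  by rewrite normr0 /rho mul0mx enorm0 expr0n mulr0.
have q0 : 0 < nabla_form 2 h xs u.
  by rewrite nabla_form2_h divr_gt0// exprn_gt0// rho_gt0.
have [c30] := le_sup_nabla_ratio hc3 (rU ur) u0 s01 q0.
rewrite powR_3half ?(ltW q0)// (nabla_form_h _ _ fC)/= addr0 normrM normrN normfV (gtr0_norm n0).
rewrite nabla_form2_h sqrtrM ?sqr_ge0// sqrtr_sqr (ger0_norm (rho_ge0 u)) sqrtrV ?(ltW n0)//.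
rewrite mulrC ler_pdivrMr// => /le_trans; apply.
have sn0 : 0 < Num.sqrt n by rewrite sqrtr_gt0.
rewrite -[in X in _ * X <= _](sqr_sqrtr (ltW n0)).
rewrite le_eqVlt; apply/orP; left; apply/eqP; field.
by rewrite gt_eqF.
Qed.

Lemma fourth_derivative_bound c4 u s : classC 4 f ->
  (sup_nabla_ratio 4 h xs U <= c4%:E)%E -> rho u <= r -> 0 <= s <= 1 ->
  `|nabla_form 4 f (xs + s *: u) u| <= c4 / n * rho u ^+ 4.
Proof.
move=> fC4 hc4 ur s01; have [->|u0] := eqVneq u 0.
  have -> : nabla_form 4 f (xs + s *: 0) 0 = 0.
    rewrite nabla_formS big1// => t _; rewrite big1 ?mul0r// => i _.
    by rewrite mxE mul0r.
  by rewrite normr0 /rho mul0mx enorm0 expr0n mulr0.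
have q0 : 0 < nabla_form 2 h xs u.
  by rewrite nabla_form2_h divr_gt0// exprn_gt0// rho_gt0.
have [c40] := le_sup_nabla_ratio hc4 (rU ur) u0 s01 q0.
rewrite powR_4half ?(ltW q0)// (nabla_form_h _ _ fC4)/= addr0 normrM normrN normfV (gtr0_norm n0).
rewrite nabla_form2_h mulrC ler_pdivrMr// => /le_trans; apply.
rewrite le_eqVlt; apply/orP; left; apply/eqP; field.
by rewrite gt_eqF.
Qed.


Lemma delta_cubic u : rho u <= r -> `|delta u| <= c3 / Num.sqrt n * rho u ^+ 3 / 6.
Proof.
move=> ur.
have := taylor3 (fun s => nabla_form_line xs u s (classCS (classCS fC)))
  (fun s => nabla_form_line xs u s (classCS fC))
  (fun s => nabla_form_line xs u s fC) (fun s => @third_derivative_bound u s ur).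
rewrite scale0r scale1r addr0 !nabla_form0 grad0.
rewrite nabla_form2 -[hessian f xs]opprK -QE qformN /delta /laplace_rem.
by congr (`|_| <= _); field.
Qed.

(* Concavity of [ell] places [ell] below its tangent at [r / rho u *: u], where the
   third-order Taylor bounds on [delta] and its derivative apply. *)
Lemma delta_tail u : r < rho u -> 0 < r ->
  delta u <= (rho u - r) ^+ 2 / 2 + c3 / Num.sqrt n * r ^+ 2 * rho u / 2
             - c3 / Num.sqrt n * r ^+ 3 / 3.
Proof.
move=> ur r0; set tau := c3 / Num.sqrt n.
have rho0 : 0 < rho u by exact: lt_trans ur.
pose s := rho u / r; pose v := s^-1 *: u.
have s0 : 0 < s by rewrite divr_gt0.
have rv : rho v = r.
  rewrite /rho /v -scalemxAl enorm_scale -/(rho u) gtr0_norm ?invr_gt0//.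
  by rewrite /s; field; rewrite !gt_eqF.
have uv : u = s *: v by rewrite /v scalerA divff ?scale1r// gt_eqF.
have b3 z : 0 <= z <= 1 -> nabla_form 3 f (xs + z *: v) v <= tau * r ^+ 3.
  move=> z01; apply: le_trans (ler_norm _) _.
  by rewrite -[in X in _ <= X]rv; apply: third_derivative_bound => //; rewrite rv.
have [] := taylor3_le (fun s => nabla_form_line xs v s (classCS (classCS fC)))
  (fun s => nabla_form_line xs v s (classCS fC))
  (fun s => nabla_form_line xs v s fC) b3.
rewrite scale0r scale1r addr0 !nabla_form0 grad0.
rewrite nabla_form2 -[hessian f xs]opprK -QE qformN qformQ rv => b0 b1.
set q := enorm (v *m G) ^+ 2 in b0 b1.
pose F w := - ell (xs + w).
have Fs z : F (z *: v) = n * nabla_form 0 h (xs + z *: v) v.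
  by rewrite /F hE nabla_form0.
have dF : is_derive v (u - v) F (- ((s - 1) * (nabla_form 1 f (xs + 1 *: v) v + 1 * q))).
  have -> : u - v = (s - 1) *: v by rewrite {1}uv scalerBl scale1r.
  have -> : - ((s - 1) * (nabla_form 1 f (xs + 1 *: v) v + 1 * q)) =
      (s - 1) * (n * nabla_form 1 h (xs + 1 *: v) v).
    rewrite (nabla_form_h _ _ C1) -/q; field; by rewrite gt_eqF.
  apply: is_derive_scale_dir.
  apply/is_deriveP.
  have := nabla_form_is_derive (xs + 1 *: v) v (classC_h (classCS (classCS fC))).
  move=> /is_deriveP dh.
  have -> : (fun t : R => t^-1 * (F (t *: v + v) - F v)) =
      (fun t => n * (t^-1 * (nabla_form 0 h (t *: v + (xs + 1 *: v)) v
                 - nabla_form 0 h (xs + 1 *: v) v))).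
    apply/funext => t; rewrite !nabla_form0 /F !hE scale1r.
    have -> : xs + (t *: v + v) = t *: v + (xs + v) by rewrite addrCA.
    by ring.
  by apply: cvgM => //; exact: cvg_cst.
have := convex_tangent (fun t => @convex_functionP _ _ F cvx v u t) dF.
rewrite {1 2}/F {1}/ell {1}/ell.
have -> : xs + v - xs = v by rewrite addrAC subrr add0r.
have -> : xs + u - xs = u by rewrite addrAC subrr add0r.
have uG : enorm (u *m G) ^+ 2 = s ^+ 2 * q.
  by rewrite uv -scalemxAl enorm_scale exprMn real_normK ?num_real.
rewrite scale1r mul1r uG -/q => tang.
(* The contributions of [q] to the tangent and to the quadratic form cancel; only [rho u = s r] and
   [tau] remain. *)
rewrite /delta /laplace_rem qformQ uG.
have rhoE : rho u = s * r by rewrite /s divfK// gt_eqF.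
rewrite rhoE.
have s1 : 1 < s by rewrite /s ltr_pdivlMr// mul1r.
have b1' : (s - 1) * nabla_form 1 f (xs + v) v <=
   (s - 1) * (0 - (r ^+ 2 + q) + tau * r ^+ 3 / 2).
  by rewrite ler_pM2l ?subr_gt0.
by nra.
Qed.

Lemma delta_even c4 u : classC 4 f -> (sup_nabla_ratio 4 h xs U <= c4%:E)%E ->
  rho u <= r -> `|delta u + delta (- u)| / 2 <= c4 / n * rho u ^+ 4 / 24.
Proof.
move=> fC4 hc4 ur.
have ur' : rho (- u) <= r by rewrite /rho mulNmx enorm_opp.
have E v : rho v <= r -> `|delta v - nabla_form 3 f xs v / 6| <= c4 / n * rho v ^+ 4 / 24.
  move=> vr.
  have := taylor4 (fun s => nabla_form_line xs v s (classCS (classCS fC)))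
    (fun s => nabla_form_line xs v s (classCS fC))
    (fun s => nabla_form_line xs v s fC) (fun s => nabla_form_line xs v s fC4)
    (fun s => @fourth_derivative_bound c4 v s fC4 hc4 vr).
  rewrite scale0r scale1r addr0 !nabla_form0 grad0.
  rewrite nabla_form2 -[hessian f xs]opprK -QE qformN /delta /laplace_rem.
  by congr (`|_| <= _); field.
have := E _ ur; have := E _ ur'.
have -> : rho (- u) = rho u by rewrite /rho mulNmx enorm_opp.
have -> : nabla_form 3 f xs (- u) = - nabla_form 3 f xs u.
  rewrite /nabla_form -sumrN; apply: eq_bigr => t _; rewrite -mulrN; congr (_ * _).
  rewrite -mulN1r (_ : -1 = \prod_(i <- t) (-1 : R)).
    by rewrite -big_split/=; apply: eq_bigr => i _; rewrite mxE mulN1r.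
  rewrite big_const_seq count_predT size_tuple /=; ring.
set X := nabla_form 3 f xs u.
rewrite !ler_norml ler_pdivrMr// ler_norml; lra.
Qed.

End laplace.

End pointwise.

(** * Gaussian mass of the tilts *)

Section gaussian_moments.
Context {R : realType} {p : nat}.
Variables (Q D : 'M[R]_p).
Hypothesis pQ : posdef Q.
Hypothesis DT : D^T = D.
Hypothesis DQ : forall u, qform (D *m D) u <= qform Q u.
Local Notation w := (gauss_density (invmx Q)).
Local Notation mu := (lebesgueRV R p).
Local Notation rho u := (enorm (u *m D)).
Local Notation pG := (eff_dim (D *m D) Q).

Lemma gauss_densityE u :
  w u = expR (- qform Q u / 2) / Num.sqrt ((2 * pi) ^+ p / \det Q).
Proof. by rewrite /gauss_density invmxK det_inv. Qed.

Lemma gauss_norm_gt0 : 0 < Num.sqrt ((2 * pi) ^+ p / \det Q) :> R.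
Proof.
by rewrite sqrtr_gt0 divr_gt0 ?posdef_det_gt0// exprn_gt0// mulr_gt0// pi_gt0.
Qed.

Lemma gauss_density_ge0 u : 0 <= w u.
Proof. by rewrite divr_ge0 ?expR_ge0 ?sqrtr_ge0. Qed.

Lemma gauss_densityN u : w (- u) = w u.
Proof. by rewrite !gauss_densityE qform_oppv. Qed.

Lemma continuous_gauss_density : continuous w.
Proof.
have -> : w = (fun u => expR (- qform Q u / 2) / Num.sqrt ((2 * pi) ^+ p / \det Q)).
  by apply/funext => u; rewrite gauss_densityE.
have cq : continuous (fun u : 'rV[R]_p => - qform Q u / 2).
  by move=> u; exact: (cvgM (cvgN (@continuous_qform _ _ Q u)) (cvg_cst _)).
have ce : continuous (fun u : 'rV[R]_p => expR (- qform Q u / 2)).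
  move=> u; exact: (continuous_comp (cq u) (@continuous_expR R _)).
by move=> u; exact: (cvgM (ce u) (cvg_cst _)).
Qed.

Lemma measurable_gauss_density :
  measurable_fun [set: borelRV R p] (w : borelRV R p -> measurableTypeR R).
Proof. exact: continuous_measurable_fun_borelRV continuous_gauss_density. Qed.

Lemma gauss_tilt lam u : w u * expR (lam * rho u ^+ 2 / 2) =
  expR (- qform (Q - lam *: (D *m D)) u / 2) * (Num.sqrt ((2 * pi) ^+ p / \det Q))^-1.
Proof.
rewrite gauss_densityE mulrAC -expRD; congr (expR _ / _).
by rewrite qformD qformN qformZ qform_sqr//; field.
Qed.

(** The tilted integrand is again Gaussian, with precision [Q - lam D^2]; its integral is the square
    root of a determinant ratio, which [det_moment] bounds. *)
Lemma integral_gauss_tilt lam : 0 <= lam < 1 ->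
  (\int[mu]_u (w u * expR (lam * rho u ^+ 2 / 2))%:E <=
   (expR (lam / (1 - lam) * pG / 2))%:E)%E.
Proof.
move=> l01; have [pA dA] := det_moment l01 pQ DT DQ.
under eq_integral do rewrite gauss_tilt EFinM.
rewrite ge0_integralZr//; last exact: measurable_exp_qform.
rewrite integral_gauss_qform// -EFinM lee_fin ler_pdivrMr ?gauss_norm_gt0//.
have -> : expR (lam / (1 - lam) * pG / 2) = Num.sqrt (expR (lam / (1 - lam) * pG)).
  set y := lam / (1 - lam) * pG.
  have -> : expR y = expR (y / 2) ^+ 2 by rewrite -expRM_natr divfK.
  by rewrite sqrtr_sqr ger0_norm ?expR_ge0.
have c0 : 0 <= (2 * pi) ^+ p :> R by rewrite exprn_ge0// mulr_ge0// pi_ge0.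
rewrite -sqrtrM ?expR_ge0// ler_wsqrtr// ler_pdivrMr ?posdef_det_gt0//.
set E := expR _ in dA *.
have -> : E * ((2 * pi) ^+ p / \det Q) * \det (Q - lam *: (D *m D)) =
    (2 * pi) ^+ p * (\det (Q - lam *: (D *m D)) * E / \det Q) by ring.
by rewrite ler_peMr// ler_pdivlMr ?posdef_det_gt0// mul1r.
Qed.

Lemma integral_gauss_density : (\int[mu]_u (w u)%:E = 1)%E.
Proof.
under eq_integral do rewrite gauss_densityE EFinM.
rewrite ge0_integralZr//; last exact: measurable_exp_qform.
by rewrite integral_gauss_qform// -EFinM divff// gt_eqF ?gauss_norm_gt0.
Qed.

End gaussian_moments.

(** * Integrals dominated by mixtures of tilts *)

Section mixture.
Context {R : realType} {p : nat}.
Variables (Q D : 'M[R]_p).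
Hypothesis pQ : posdef Q.
Hypothesis DT : D^T = D.
Hypothesis DQ : forall u, qform (D *m D) u <= qform Q u.
Local Notation w := (gauss_density (invmx Q)).
Local Notation mu := (lebesgueRV R p).
Local Notation rho u := (enorm (u *m D)).
Local Notation pG := (eff_dim (D *m D) Q).
Local Open Scope ereal_scope.

Let tilt_bound lam : R := expR (lam / (1 - lam) * pG / 2).

Lemma measurable_tilt c lam : measurable_fun [set: borelRV R p]
  (fun u : borelRV R p => (w u * (c * expR (lam * rho u ^+ 2 / 2)))%:E).
Proof.
apply/measurable_EFinP; apply: measurable_funM; first exact: measurable_gauss_density.
apply: measurable_funM => //; apply: measurableT_comp => //.
under eq_fun do rewrite -qform_sqr//.
apply: measurable_funM => //; apply: measurable_funM => //.
exact: measurable_qform.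
Qed.

Lemma measurable_tilts (a : R) (s : seq (R * R)) : measurable_fun [set: borelRV R p]
  (fun u : borelRV R p =>
     (w u * (a + \sum_(c <- s) c.1 * expR (c.2 * rho u ^+ 2 / 2)))%:E).
Proof.
apply/measurable_EFinP; apply: measurable_funM; first exact: measurable_gauss_density.
apply: measurable_funD => //; apply: measurable_sum => d.
apply: measurable_funM => //; apply: measurableT_comp => //.
under eq_fun do rewrite -qform_sqr//.
apply: measurable_funM => //; apply: measurable_funM => //.
exact: measurable_qform.
Qed.

Lemma integral_tilt_le c lam : (0 <= c)%R -> (0 <= lam < 1)%R ->
  \int[mu]_u (w u * (c * expR (lam * rho u ^+ 2 / 2)))%:E <= (c * tilt_bound lam)%:E.
Proof.
move=> c0 l01.
under eq_integral do rewrite mulrCA EFinM.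
have m1 := measurable_tilt 1 lam.
have {}m1 : measurable_fun [set: borelRV R p]
    (fun u : borelRV R p => (w u * expR (lam * rho u ^+ 2 / 2))%:E).
  by move: m1; under eq_fun do rewrite mul1r.
rewrite ge0_integralZl//; last first.
  by move=> u _; rewrite lee_fin mulr_ge0 ?expR_ge0 ?gauss_density_ge0.
by rewrite EFinM lee_wpmul2l ?lee_fin//; exact: integral_gauss_tilt.
Qed.

Lemma integral_tilts_le (a : R) (s : seq (R * R)) : (0 <= a)%R ->
  (forall c, c \in s -> (0 <= c.1)%R /\ (0 <= c.2 < 1)%R) ->
  \int[mu]_u (w u * (a + \sum_(c <- s) c.1 * expR (c.2 * rho u ^+ 2 / 2)))%:E <=
  (a + \sum_(c <- s) c.1 * tilt_bound c.2)%:E.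
Proof.
move=> a0; elim: s => [|c s IHs] sP.
  under eq_integral do rewrite big_nil addr0 EFinM.
  rewrite ge0_integralZr//; last 2 first.
  - by apply/measurable_EFinP; exact: measurable_gauss_density.
  - by move=> u _; rewrite lee_fin gauss_density_ge0.
  by rewrite integral_gauss_density// mul1e big_nil addr0.
have [c10 c20] := sP c (mem_head _ _).
have sP' d : d \in s -> (0 <= d.1)%R /\ (0 <= d.2 < 1)%R.
  by move=> ds; apply: sP; rewrite inE ds orbT.
have S0 u : (0 <= \sum_(c <- s) c.1 * expR (c.2 * rho u ^+ 2 / 2))%R.
  rewrite big_seq sumr_ge0// => d ds; have [d1 _] := sP' d ds.
  by rewrite mulr_ge0// expR_ge0.
under eq_integral do rewrite big_cons addrCA mulrDr EFinD.
rewrite ge0_integralD//; last 4 first.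
- by move=> u _; rewrite lee_fin !mulr_ge0 ?expR_ge0 ?gauss_density_ge0.
- exact: measurable_tilt.
- by move=> u _; rewrite lee_fin mulr_ge0 ?addr_ge0 ?gauss_density_ge0.
- exact: measurable_tilts.
have -> : (a + \sum_(d <- c :: s) d.1 * tilt_bound d.2 = c.1 * tilt_bound c.2 +
    (a + \sum_(d <- s) d.1 * tilt_bound d.2))%R by rewrite big_cons addrCA.
by rewrite EFinD; apply: leeD; [exact: integral_tilt_le|exact: IHs].
Qed.

(** The index [k] depends on the point. Since all terms are nonnegative, the whole series dominates
    whichever term is relevant, so no measurable choice of [k] is made; the integrals of the series
    sum geometrically. *)
Lemma integral_mixture_le (g : borelRV R p -> R) (a : R) (s : seq (R * R))
    (A lam : nat -> R) (K z : R) :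
  measurable_fun setT g -> (forall u, 0 <= g u)%R -> (0 <= a)%R ->
  (forall c, c \in s -> (0 <= c.1)%R /\ (0 <= c.2 < 1)%R) ->
  (forall k, 0 <= A k)%R -> (forall k, 0 <= lam k < 1)%R -> (0 <= z < 1)%R ->
  (forall k, A k * tilt_bound (lam k) <= K * z ^+ k)%R ->
  (forall u, (g u <= w u * (a + \sum_(c <- s) c.1 * expR (c.2 * rho u ^+ 2 / 2)))%R \/
     exists k, (g u <= w u * (A k * expR (lam k * rho u ^+ 2 / 2)))%R) ->
  \int[mu]_u (g u)%:E <= (a + \sum_(c <- s) c.1 * tilt_bound c.2 + K / (1 - z))%:E.
Proof.
move=> mg g0 a0 sP A0 l01 /andP[z0 z1] AK gle.
pose F1 u := (w u * (a + \sum_(c <- s) c.1 * expR (c.2 * rho u ^+ 2 / 2)))%:E.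
pose F2 k u := (w u * (A k * expR (lam k * rho u ^+ 2 / 2)))%:E.
have F10 u : 0 <= F1 u.
  rewrite lee_fin mulr_ge0 ?gauss_density_ge0// addr_ge0//.
  rewrite big_seq sumr_ge0// => d ds; have [d1 _] := sP d ds.
  by rewrite mulr_ge0// expR_ge0.
have F20 k u : 0 <= F2 k u.
  by rewrite lee_fin !mulr_ge0 ?expR_ge0 ?gauss_density_ge0.
have mF1 : measurable_fun setT (F1 : borelRV R p -> \bar R).
  exact: measurable_tilts.
have mF2 k : measurable_fun setT (F2 k : borelRV R p -> \bar R).
  exact: measurable_tilt.
have mS : measurable_fun setT (fun u : borelRV R p => \sum_(k <oo) F2 k u).
  by apply: ge0_emeasurable_sum => // k u _ _.
apply: (@le_trans _ _ (\int[mu]_u (F1 u + \sum_(k <oo) F2 k u))).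
  apply: ge0_le_integral => //.
  - by move=> u _; rewrite lee_fin.
  - exact/measurable_EFinP.
  - exact: emeasurable_funD.
  - move=> u _; have S0 : 0 <= \sum_(k <oo) F2 k u by exact: nneseries_ge0.
    have [h|[k h]] := gle u.
      by apply: (@le_trans _ _ (F1 u)); [rewrite lee_fin|exact: leeDl].
    apply: (@le_trans _ _ (F2 k u)); first by rewrite lee_fin.
    rewrite -[X in X <= _]add0e leeD//.
    apply: le_trans (nneseries_lim_ge k.+1 _) => //.
    by rewrite big_nat_recr//= leeDr// sume_ge0.
rewrite ge0_integralD//; last by move=> u _; exact: nneseries_ge0.
rewrite EFinD leeD//; first exact: integral_tilts_le.
rewrite integral_nneseries//.
apply: (@le_trans _ _ (\sum_(k <oo) (K * z ^+ k)%:E)).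
  apply: lee_nneseries => [k _ _|k _]; first exact: integral_ge0.
  by apply: le_trans (integral_tilt_le (A0 k) (l01 k)) _; rewrite lee_fin.
have K0 k : (0 <= K * z ^+ k)%R.
  by apply: le_trans (AK k); rewrite mulr_ge0// expR_ge0.
apply: lime_le; first by apply: is_cvg_nneseries => k _ _; rewrite lee_fin.
apply: nearW => n; rewrite sumEFin lee_fin -mulr_sumr.
have K00 : (0 <= K)%R by have := K0 0%N; rewrite expr0 mulr1.
rewrite ler_wpM2l// -[X in (_ <= X)%R]mul1r ler_pdivlMr ?subr_gt0//.
rewrite mulrC big_mkord -opprB mulNr -subrX1 opprB.
by rewrite gerBl exprn_ge0.
Qed.

End mixture.

(** * From density comparison to total variation *)

Section total_variation.
Context {R : realType} {p : nat}.
Variables (f : 'rV[R]_p -> R) (xs : 'rV[R]_p) (Q : 'M[R]_p).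
Hypothesis pQ : posdef Q.
Hypothesis cf : continuous f.
Hypothesis ffin : (gibbs_norm f < +oo)%E.
Local Notation w := (gauss_density (invmx Q)).
Local Notation mu := (lebesgueRV R p).

(** Up to the constant factor [kappa], the function [expR (f (xs + u))]; its mass is the normalizing
    constant of the law in Gaussian units. *)
Definition tilted_density u : R := w u * expR (laplace_rem f xs Q u).
Local Notation E1 := tilted_density.
Local Notation nu A := (\int[mu]_(u in A) (E1 u)%:E)%E.

Lemma continuous_laplace_rem : continuous (laplace_rem f xs Q).
Proof.
have cs : continuous (fun u : 'rV[R]_p => xs + u).
  by move=> u; exact: (cvgD (cvg_cst _) cvg_id).
have cfs : continuous (fun u : 'rV[R]_p => f (xs + u)).
  by move=> u; apply: continuous_comp; [exact: cs|exact: cf].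
move=> u.
exact: (cvgD (cvgB (cfs u) (cvg_cst _)) (cvgM (@continuous_qform _ _ Q u) (cvg_cst _))).
Qed.

Lemma measurable_tilted_density :
  measurable_fun [set: borelRV R p] (E1 : borelRV R p -> measurableTypeR R).
Proof.
apply: measurable_funM; first exact: measurable_gauss_density.
apply: measurableT_comp => //.
exact: continuous_measurable_fun_borelRV continuous_laplace_rem.
Qed.

Lemma tilted_density_ge0 u : 0 <= E1 u.
Proof. by rewrite mulr_ge0 ?gauss_density_ge0 ?expR_ge0. Qed.

Let kappa : R := expR (f xs) * Num.sqrt ((2 * pi) ^+ p / \det Q).

Let kappa_gt0 : 0 < kappa.
Proof. by rewrite mulr_gt0 ?expR_gt0 ?gauss_norm_gt0. Qed.

Let expR_f u : expR (f (xs + u)) = kappa * E1 u.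
Proof.
rewrite /kappa /tilted_density gauss_densityE//.
set s := Num.sqrt _; have s0 : s != 0 by rewrite gt_eqF// gauss_norm_gt0.
transitivity (expR (f xs) * expR (- qform Q u / 2) * expR (laplace_rem f xs Q u)).
  by rewrite -!expRD; congr expR; rewrite /laplace_rem; field.
by field.
Qed.

Let integral_shift (A : set (borelRV R p)) (g : borelRV R p -> R) :
  measurable A -> measurable_fun setT g -> (forall u, 0 <= g u) ->
  (\int[mu]_(x in [set x : 'rV[R]_p | A (x - xs)%R]) (g x)%:E =
   \int[mu]_(u in A) (g (xs + (u : 'rV[R]_p))%R)%:E)%E.
Proof.
move=> mA mg g0.
have ms : measurable_fun [set: borelRV R p]
    ((fun u : 'rV[R]_p => xs + u) : borelRV R p -> borelRV R p).
  by apply: continuous_measurable_borelRV => u; exact: (cvgD (cvg_cst _) cvg_id).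
rewrite [LHS]integral_mkcond [RHS]integral_mkcond.
rewrite -[RHS](ge0_integral_lebesgueRV_shift (- xs)).
- apply: eq_integral => x _; rewrite !patchE; congr (if _ then _ else _).
  by rewrite addrC subrK.
- apply/(measurable_restrictT _ _).1 => //.
  apply/measurable_EFinP; apply: measurable_funTS.
  exact: (measurableT_comp mg ms).
- by move=> u; rewrite patchE; case: ifP => // _; rewrite lee_fin.
Qed.

Let measurable_expf : measurable_fun [set: borelRV R p]
  ((fun u => expR (f u)) : borelRV R p -> measurableTypeR R).
Proof.
by apply: measurableT_comp => //; exact: continuous_measurable_fun_borelRV.
Qed.

Lemma gibbs_normE : gibbs_norm f = (kappa%:E * nu setT)%E.
Proof.
rewrite /gibbs_norm.
have := integral_shift measurableT measurable_expf (fun u => expR_ge0 _).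
have -> : [set x : 'rV[R]_p | [set: borelRV R p] (x - xs)] = setT by apply/seteqP.
move=> ->.
under eq_integral do rewrite expR_f EFinM.
rewrite ge0_integralZl//.
- by apply/measurable_EFinP; exact: measurable_tilted_density.
- by move=> u _; rewrite lee_fin tilted_density_ge0.
- by rewrite lee_fin ltW.
Qed.

Lemma tilted_mass_fin : nu setT \is a fin_num.
Proof.
rewrite ge0_fin_numE; last by apply: integral_ge0 => u _; rewrite lee_fin tilted_density_ge0.
move: ffin; rewrite gibbs_normE.
case: (nu setT) => [r|//|//]; first by move=> _; exact: ltry.
by rewrite gt0_muley// lte_fin.
Qed.

Lemma gibbs_shift (A : set (borelRV R p)) : measurable A ->
  gibbs f [set x : 'rV[R]_p | A (x - xs)] = (((fine (nu setT))^-1)%:E * nu A)%E.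
Proof.
move=> mA.
have N0 : 0 <= fine (gibbs_norm f).
  by rewrite fine_ge0// integral_ge0// => u _; rewrite lee_fin expR_ge0.
rewrite /gibbs integral_shift//; last 2 first.
- by apply: measurable_funM => //; exact: measurable_expf.
- by move=> u; rewrite divr_ge0// expR_ge0.
have NE : (fine (gibbs_norm f))^-1 = kappa^-1 * (fine (nu setT))^-1.
  by rewrite gibbs_normE fineM// ?tilted_mass_fin// invfM.
transitivity (\int[mu]_(u in A) (((fine (nu setT))^-1)%:E * (E1 u)%:E))%E.
  apply: eq_integral => u _; rewrite -EFinM; congr EFin.
  by rewrite expR_f NE mulrC mulrACA mulVf ?gt_eqF// mul1r.
rewrite ge0_integralZl//.
- apply/measurable_EFinP; apply: measurable_funTS; exact: measurable_tilted_density.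
- by move=> u _; rewrite lee_fin tilted_density_ge0.
- by rewrite lee_fin invr_ge0 fine_ge0// integral_ge0// => u _; rewrite lee_fin tilted_density_ge0.
Qed.

Let nu_ge0 (A : set (borelRV R p)) : (0 <= nu A)%E.
Proof. by apply: integral_ge0 => u _; rewrite lee_fin tilted_density_ge0. Qed.

Let gauss_ge0 (A : set (borelRV R p)) : (0 <= gauss (invmx Q) A)%E.
Proof. by apply: integral_ge0 => u _; rewrite lee_fin gauss_density_ge0. Qed.

Let nu_setC (A : set (borelRV R p)) : measurable A -> (nu setT = nu A + nu (~` A))%E.
Proof.
move=> mA; rewrite -ge0_integral_setU//; first by rewrite setUCr.
- exact: measurableC.
- apply/measurable_EFinP; apply: measurable_funTS; exact: measurable_tilted_density.
- by move=> u _; rewrite lee_fin tilted_density_ge0.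
- by apply/disj_setPCl.
Qed.

Let gauss_setC (A : set (borelRV R p)) : measurable A -> (1 = gauss (invmx Q) A + gauss (invmx Q) (~` A))%E.
Proof.
move=> mA; rewrite -[LHS](integral_gauss_density pQ) /gauss -ge0_integral_setU//; first by rewrite setUCr.
- exact: measurableC.
- by apply/measurable_EFinP; apply: measurable_funTS; exact: measurable_gauss_density.
- by move=> u _; rewrite lee_fin gauss_density_ge0.
- by apply/disj_setPCl.
Qed.

Let sup_dist_reals (A : set (borelRV R p)) : measurable A -> exists a ac m : R,
  [/\ (nu A = a%:E)%E, (nu (~` A) = ac%:E)%E, (nu setT = (a + ac)%:E)%E,
   (gauss (invmx Q) A = m%:E)%E & (gauss (invmx Q) (~` A) = (1 - m)%:E)%E] /\
  [/\ 0 <= a, 0 <= ac & 0 <= m <= 1].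
Proof.
move=> mA; have := nu_setC mA; have := tilted_mass_fin.
have := nu_ge0 A; have := nu_ge0 (~` A).
case: (nu setT) => [z|//|//]; case: (nu A) => [a|//|//]; case: (nu (~` A)) => [ac|//|//].
rewrite !lee_fin => ac0 a0 _ [->].
have := gauss_setC mA; have := gauss_ge0 A; have := gauss_ge0 (~` A).
case: (gauss _ A) => [m|//|//]; case: (gauss _ (~` A)) => [mc|//|//].
rewrite !lee_fin => mc0 m0 [m1].
exists a, ac, m; split; split => //; last by rewrite m0; lra.
- by congr EFin; lra.
all: by move=> ? ? /=.
Qed.

Let sup_distE (C : set (set (borelRV R p))) (B : R) : C `<=` measurable ->
  (forall A (a ac m : R), C A -> (nu A = a%:E)%E -> (nu (~` A) = ac%:E)%E ->
    (nu setT = (a + ac)%:E)%E -> (gauss (invmx Q) A = m%:E)%E ->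
    (gauss (invmx Q) (~` A) = (1 - m)%:E)%E ->
    0 <= a -> 0 <= ac -> 0 <= m <= 1 -> `|(a + ac)^-1 * a - m| <= B) ->
  (sup_dist C f xs (invmx Q) <= B%:E)%E.
Proof.
move=> Cm H; apply: ge_ereal_sup => _ [A CA <-].
have [a [ac [m [[aE acE zE mE mcE] [a0 ac0 m01]]]]] := sup_dist_reals (Cm _ CA).
rewrite gibbs_shift; last exact: Cm.
rewrite zE aE mE -EFinM -EFinB abse_EFin lee_fin.
exact: (H A).
Qed.

(** Settles the case where the claimed bound is at least 1. *)
Lemma sup_dist_le1 (C : set (set (borelRV R p))) : C `<=` measurable ->
  (sup_dist C f xs (invmx Q) <= 1)%E.
Proof.
move=> Cm; apply: sup_distE => // A a ac m _ _ _ _ _ _ a0 ac0 m01.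
have z0 : 0 <= a + ac by rewrite addr_ge0.
have : 0 <= (a + ac)^-1 * a <= 1.
  rewrite mulr_ge0 ?invr_ge0//=.
  have [->|zn] := eqVneq (a + ac) 0; first by rewrite invr0 mul0r.
  by rewrite mulrC ler_pdivrMr ?lt_neqAle ?z0 ?andbT 1?eq_sym// mul1r lerDl.
by move: m01; rewrite ler_norml; lra.
Qed.

(* With [Z = nu setT], a one-sided comparison [mu <= nu + L] suffices: it gives
   [mu A - nu A / Z <= (U + L) / (1 + U)], and the reverse inequality is the
   same bound for the complement of [A]. *)
Lemma sup_dist_le (C : set (set (borelRV R p))) (B L U : R) :
  C `<=` measurable -> (forall A, C A -> C (~` A)) ->
  (forall A, C A -> (gauss (invmx Q) A <= nu A + L%:E)%E) ->
  (nu setT <= (1 + U)%:E)%E -> 0 <= L -> 0 <= U -> B < 1 ->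
  U * (1 - B) + L <= B ->
  (sup_dist C f xs (invmx Q) <= B%:E)%E.
Proof.
move=> Cm CC CL TU L0 U0 B1 ULB.
have LB : L <= B by rewrite (le_trans _ ULB)// lerDr mulr_ge0// subr_ge0 ltW.
have key (a Z m : R) : 0 <= a -> 0 <= m <= 1 -> m <= a + L -> Z <= 1 + U ->
    0 < Z -> m - Z^-1 * a <= B.
  move=> a0 /andP[m0 m1] maL ZU Z0; rewrite -(ler_pM2l Z0) mulrBr mulVKf ?gt_eqF//.
  (* By [a >= m - L] it suffices that [(Z - 1) m + L <= Z B]. For [Z >= 1] the left side is largest
     at [m = 1]; for [Z < 1] and [m > L] it is at most [Z L]. For [m <= L] the bound [a >= 0] is
     enough. *)
  have [Z1|Z1] := leP 1 Z.
    have h1 : m * (Z - 1) <= Z - 1 by rewrite ler_piMl// subr_ge0.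
    have h2 : (Z - 1) * (1 - B) <= U * (1 - B) by apply: ler_wpM2r; lra.
    by nra.
  have [mL|Lm] := leP m L.
    have : Z * m <= Z * B by rewrite ler_pM2l// (le_trans mL).
    by lra.
  have h1 : (1 - Z) * L <= (1 - Z) * m by rewrite ler_pM2l ?subr_gt0// ltW.
  have h2 : Z * L <= Z * B by rewrite ler_pM2l.
  by nra.
apply: sup_distE => // A a ac m CA aE acE zE mE mcE a0 ac0 m01.
have := CL _ CA; have := CL _ (CC _ CA).
rewrite aE acE mE mcE -!EFinD !lee_fin => h2 h1.
move: TU; rewrite zE lee_fin => h3.
(* With zero mass the inverse is 0 by convention, and the claim reads [m <= L <= B]. *)
have [zE0|zn] := eqVneq (a + ac) 0.
  rewrite zE0 invr0 mul0r sub0r normrN ger0_norm; last by case/andP: m01.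
  by lra.
have z0 : 0 < a + ac by rewrite lt_neqAle eq_sym zn addr_ge0.
have k1 := key a (a + ac) m a0 m01 h1 h3 z0.
have k2 := key ac (a + ac) (1 - m) ac0 ltac:(lra) h2 h3 z0.
have e : (a + ac)^-1 * ac = 1 - (a + ac)^-1 * a by field; rewrite gt_eqF.
by rewrite ler_norml; move: k2; rewrite e; lra.
Qed.

End total_variation.

(** * Elementary and numerical bounds on the exponential *)

Section exponential_estimates.
Context {R : realType}.

Lemma ler_iter_sqr (a b c : R) : 0 <= a -> a <= b -> c <= a ^+ 2 -> c <= b ^+ 2.
Proof. by move=> a0 ab /le_trans; apply; rewrite ler_pXn2r// nnegrE (le_trans a0). Qed.

(** Seven squarings from [1 + y <= expR y] at [1 / 256] and [- 1 / 256], with rational values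
    rounded down on the way; the upper bound is the reciprocal of a lower bound of
    [expR (- (1 / 2))]. *)
Lemma expR_half_bounds : 1647 / 1000 <= expR (1 / 2 : R) <= 1651 / 1000.
Proof.
have dbl (y : R) : expR (2 * y) = expR y ^+ 2 by rewrite mulrC expRM_natr.
have lo (y a c : R) : 0 <= a -> c <= a ^+ 2 -> a <= expR y -> c <= expR (2 * y).
  by move=> a0 ca ay; rewrite dbl; exact: ler_iter_sqr ca.
have b1 (y : R) : 1 + y <= expR y := expR_ge1Dx y.
apply/andP; split.
  have -> : 1 / 2 = 2 * (2 * (2 * (2 * (2 * (2 * (2 * (1 / 256))))))) :> R by field.
  apply: (lo _ (1 + 283 / 1000 + 396 / 1000 / 1000)); [lra..|].
  apply: (lo _ (1 + 132 / 1000 + 870 / 1000 / 1000 + 700 / 1000 / 1000 / 1000)); [lra..|].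
  apply: (lo _ (1 + 64 / 1000 + 364 / 1000 / 1000)); [lra..|].
  apply: (lo _ (1 + 31 / 1000 + 680 / 1000 / 1000 + 200 / 1000 / 1000 / 1000)); [lra..|].
  apply: (lo _ (1 + 15 / 1000 + 716 / 1000 / 1000 + 600 / 1000 / 1000 / 1000)); [lra..|].
  apply: (lo _ (1 + 7 / 1000 + 827 / 1000 / 1000 + 700 / 1000 / 1000 / 1000)); [lra..|].
  apply: (lo _ (257 / 256)); [lra..|].
  by apply: le_trans (b1 _); lra.
have : 6058 / 10000 <= expR (- (1 / 2)) :> R.
  have -> : - (1 / 2) = 2 * (2 * (2 * (2 * (2 * (2 * (2 * (- (1 / 256)))))))) :> R by field.
  apply: (lo _ (778 / 1000 + 384 / 1000 / 1000)); [lra..|].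
  apply: (lo _ (882 / 1000 + 261 / 1000 / 1000)); [lra..|].
  apply: (lo _ (939 / 1000 + 288 / 1000 / 1000)); [lra..|].
  apply: (lo _ (969 / 1000 + 169 / 1000 / 1000)); [lra..|].
  apply: (lo _ (984 / 1000 + 464 / 1000 / 1000)); [lra..|].
  apply: (lo _ (992 / 1000 + 202 / 1000 / 1000)); [lra..|].
  apply: (lo _ (255 / 256)); [lra..|].
  by apply: le_trans (b1 _); lra.
rewrite expRN; set a := expR _ => h.
have a0 : 0 < a by exact: expR_gt0.
have : 6058 / 10000 * a <= 1 by rewrite -ler_pdivlMr// div1r.
by lra.
Qed.

Lemma expR1_bounds : 271 / 100 <= expR (1 : R) <= 2726 / 1000.
Proof.
have /andP[l u] := expR_half_bounds.
have -> : expR 1 = expR (1 / 2) ^+ 2 :> R by rewrite -expRM_natr divfK.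
by apply/andP; split; nra.
Qed.

(** The maximum of [y exp (- m y)] is [1 / (e m)], and [10 / 27] exceeds [1 / e]. The versions for
    squares and cubes apply this at [m / 2] and [m / 3] and take powers. *)
Lemma le_expR_scaled (m y : R) : 0 < m -> 0 <= y -> y <= 10 / (27 * m) * expR (m * y).
Proof.
move=> m0 y0; have /andP[e1 _] := expR1_bounds.
have : m * y * expR 1 <= expR (m * y).
  have -> : expR (m * y) = expR (m * y - 1) * expR 1 by rewrite -expRD subrK.
  rewrite ler_wpM2r ?expR_ge0//.
  by apply: le_trans (expR_ge1Dx _); lra.
have -> : 10 / (27 * m) * expR (m * y) = expR (m * y) / (27 / 10 * m).
  by field; rewrite gt_eqF.
rewrite ler_pdivlMr; last by rewrite mulr_gt0.
move=> /(le_trans _); apply.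
have my : 0 <= m * y by rewrite mulr_ge0// ltW.
by nra.
Qed.

Lemma sqr_le_expR_scaled (m y : R) : 0 < m -> 0 <= y ->
  y ^+ 2 <= (20 / (27 * m)) ^+ 2 * expR (m * y).
Proof.
move=> m0 y0.
have -> : (20 / (27 * m)) ^+ 2 * expR (m * y) = (10 / (27 * (m / 2)) * expR (m / 2 * y)) ^+ 2.
  rewrite [in RHS]exprMn -expRM_natr; congr (_ ^+ 2 * expR _); field; rewrite ?gt_eqF//.
have m20 : 0 < m / 2 by rewrite divr_gt0.
have h := le_expR_scaled m20 y0.
by rewrite ler_pXn2r// nnegrE// (le_trans y0).
Qed.

Lemma cube_le_expR_scaled (m y : R) : 0 < m -> 0 <= y ->
  y ^+ 3 <= (10 / (9 * m)) ^+ 3 * expR (m * y).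
Proof.
move=> m0 y0.
have -> : (10 / (9 * m)) ^+ 3 * expR (m * y) = (10 / (27 * (m / 3)) * expR (m / 3 * y)) ^+ 3.
  rewrite [in RHS]exprMn -expRM_natr; congr (_ ^+ 3 * expR _); field; rewrite ?gt_eqF//.
have m20 : 0 < m / 3 by rewrite divr_gt0.
have h := le_expR_scaled m20 y0.
by rewrite ler_pXn2r// nnegrE// (le_trans y0).
Qed.

Lemma expR_le_affine (v : R) : 0 <= v -> expR v <= 1 + v * expR v.
Proof.
move=> v0; have := expR_ge1Dx (- v); rewrite expRN => h.
have e0 := expR_gt0 v.
have : (1 - v) * expR v <= 1 by rewrite -ler_pdivlMr// div1r.
by lra.
Qed.


Lemma is_derive_expR_line (y s : R) :
  is_derive s 1 (fun s : R => expR (s * y)) (y * expR (s * y)).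
Proof.
have d : is_derive (0 + s *: (y : R^o)) (y *: (1 : R^o)) (expR : R^o -> R)
    (y * expR (0 + s *: (y : R^o))).
  exact: is_derive_scale_dir.
have -> : (fun s : R => expR (s * y)) = (fun s : R => expR (0 + s *: (y : R^o))).
  by apply/funext => z; rewrite add0r.
rewrite -[X in expR X]add0r; apply: is_derive_line.
by move: d; rewrite -[y *: (1 : R^o)]/(y * 1) mulr1.
Qed.

Lemma expR_chord (y s : R) : 0 <= s <= 1 -> expR (s * y) <= 1 - s + s * expR y.
Proof.
move=> /andP[s0 s1]; set e := expR (s * y).
have e0 : 0 < e by exact: expR_gt0.
have tan z : e * (1 + z - s * y) <= expR z.
  have -> : expR z = e * expR (z - s * y) by rewrite /e -expRD addrC subrK.
  by rewrite ler_pM2l// (le_trans _ (expR_ge1Dx _))//; lra.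
have h0 : (1 - s) * (e * (1 + 0 - s * y)) <= (1 - s) * expR 0.
  by rewrite ler_wpM2l ?subr_ge0.
have h1 : s * (e * (1 + y - s * y)) <= s * expR y by rewrite ler_wpM2l.
by move: h0 h1; rewrite expR0; nra.
Qed.

(* The remainder weight [1 - s] integrates the chord bound
   [expR (s y) <= 1 - s + s expR y] to [1 / 3 + expR y / 6]. *)
Lemma expR_le_order2 (y : R) : 0 <= y ->
  expR y <= 1 + y + y ^+ 2 / 3 + y ^+ 2 * expR y / 6.
Proof.
move=> y0; set E := expR y.
have h1 : 0 <= (1 : R) <= 1 by rewrite ler01 lexx.
have b1 (s : R) : 0 <= s <= 1 -> expR (s * y) <= 1 + y * s + y * (E - 1) / 2 * s ^+ 2.
  move=> s01; apply: le_trans (ler_quartic (b := y) (c := y * (E - 1) / 2) (d := 0)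
    (e := 0) (is_derive_expR_line y) _ s01) _ => [z z01|].
    have := ler_wpM2l y0 (expR_chord y z01); rewrite -/E; lra.
  by rewrite mul0r expR0; lra.
have := ler_quartic (b := y) (c := y ^+ 2 / 2) (d := y ^+ 2 * (E - 1) / 6)
    (e := 0) (is_derive_expR_line y) _ h1.
rewrite mul0r mul1r expR0 -/E => H; apply: le_trans (H _) _ => [z z01|].
  have := ler_wpM2l y0 (b1 z z01); lra.
by lra.
Qed.

Lemma expR_le_order2N (y : R) : y <= 0 -> expR y <= 1 + y + y ^+ 2 / 2.
Proof.
move=> y0; have h1 : 0 <= (1 : R) <= 1 by rewrite ler01 lexx.
have := ler_quartic (b := y) (c := y ^+ 2 / 2) (d := 0)
    (e := 0) (is_derive_expR_line y) _ h1.
rewrite mul0r mul1r expR0 => H; apply: le_trans (H _) _ => [z z01|].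
  have := ler_wnM2l y0 (expR_ge1Dx (z * y)); lra.
by lra.
Qed.

(** The linear term keeps its sign, so averaging over [u] and [- u] leaves the even part of delta;
    only the quadratic remainder is paid through [v]. For negative [a] the coefficient [1 / 2] is
    covered by [1 / 3 + expR v / 6]. *)
Lemma expR_le_order2_abs (a v : R) : `|a| <= v ->
  expR a <= 1 + a + v ^+ 2 / 3 + v ^+ 2 * expR v / 6.
Proof.
move=> av; have v0 : 0 <= v by apply: le_trans av.
have v1 : 1 <= expR v by rewrite -[X in X <= _]expR0 ler_expR.
have [a0|a0] := leP 0 a.
  move: av; rewrite ger0_norm// => av.
  have a2 : a ^+ 2 <= v ^+ 2 by rewrite ler_pXn2r// nnegrE.
  have eav : expR a <= expR v by rewrite ler_expR.
  have : a ^+ 2 * expR a <= v ^+ 2 * expR v.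
    by rewrite ler_pM// ?sqr_ge0 ?expR_ge0.
  by have := expR_le_order2 a0; lra.
have a2 : a ^+ 2 <= v ^+ 2 by rewrite -real_normK ?num_real// ler_pXn2r// nnegrE.
have : v ^+ 2 <= v ^+ 2 * expR v by rewrite ler_peMr// sqr_ge0.
by have := expR_le_order2N (ltW a0); lra.
Qed.

End exponential_estimates.

(** * Geometric shells outside the bulk *)

Section shells.
Context {R : realType}.
Variables (q t tau : R).
Hypothesis q0 : 0 < q.
Hypothesis t0 : 0 < t.
Hypothesis tau0 : 0 <= tau.
Let r := 2 * q + t.
Hypothesis kr : tau * r <= 3 / 4.

(* Among the tilts, the rate [1 - q / s] makes [- lam s^2 / 2] plus the logarithm of
   the tilt mass, [lam / (1 - lam) q^2 / 2], as small as possible at radius [s]. *)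
Definition shell_radius k : R := (3 / 2) ^+ k * r.
Definition shell_rate k : R := 1 - q / shell_radius k.
(** The right-hand side of [delta_tail]. *)
Definition tail_exponent rho : R :=
  (rho - r) ^+ 2 / 2 + tau * r ^+ 2 * rho / 2 - tau * r ^+ 3 / 3.
(** Normalized so that the tilt equals [expR (tail_exponent rho)] at the inner radius of its
    shell. *)
Definition shell_coef k : R :=
  expR (tail_exponent (shell_radius k) - shell_rate k * shell_radius k ^+ 2 / 2).
Local Notation s := shell_radius.

Let r0 : 0 < r. Proof. by rewrite addr_gt0// mulr_gt0. Qed.

Let pow_ge k : 1 + k%:R / 2 <= (3 / 2 : R) ^+ k.
Proof.
elim: k => [|k IHk]; first by rewrite expr0 mul0r addr0.
have k0 : 0 <= k%:R :> R by [].
by rewrite exprS -natr1; lra.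
Qed.

Let s_ge k : r <= s k.
Proof.
have k0 : 0 <= k%:R :> R by [].
by rewrite /s ler_peMl ?(ltW r0)//; have := pow_ge k; lra.
Qed.

Let s_gt0 k : 0 < s k. Proof. exact: lt_le_trans (s_ge k). Qed.

Lemma shell_rate_bounds k : 0 <= shell_rate k < 1.
Proof.
rewrite /shell_rate; have : 0 < q / s k by rewrite divr_gt0.
have : q / s k <= 1.
  by rewrite ler_pdivrMr// mul1r (le_trans _ (s_ge k))// /r; move: q0 t0; lra.
by lra.
Qed.

(** At the optimal rate the exponent is affine in the radius, with slope [- b], and at radius [r] it
    equals the first exponent on the right. Since [s k - r >= r k / 2] and [b r >= t^2 / 2], each
    shell gains a factor [expR (- (t ^+ 2 / 4))]. *)
Lemma shell_coef_bound k :
  shell_coef k * expR (shell_rate k / (1 - shell_rate k) * q ^+ 2 / 2) <=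
  expR (- (q + t) ^+ 2 / 2 + tau * r ^+ 3 / 6) * expR (- (t ^+ 2 / 4)) ^+ k.
Proof.
have sn : s k != 0 by rewrite gt_eqF.
have qn : q != 0 by rewrite gt_eqF.
rewrite -expRM_natr -!expRD ler_expR.
have -> : shell_rate k / (1 - shell_rate k) = (s k - q) / q.
  by rewrite /shell_rate; field; rewrite sn qn.
have -> : shell_rate k * s k ^+ 2 = s k ^+ 2 - q * s k.
  by rewrite /shell_rate; field.
have skr : r * (k%:R / 2) <= s k - r.
  have -> : s k - r = ((3 / 2) ^+ k - 1) * r by rewrite /s; ring.
  rewrite mulrC ler_pM2r//; by have := pow_ge k; lra.
pose b := r - q - tau * r ^+ 2 / 2.
(* From [tau r <= 3 / 4]: [b >= 5 r / 8 - q = q / 4 + 5 t / 8]. *)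
have br : t ^+ 2 / 2 <= b * r.
  have h : tau * r * r <= 3 / 4 * r by rewrite ler_pM2r.
  have b0 : q / 4 + 5 / 8 * t <= b by rewrite /b; move: h; rewrite /r; nra.
  apply: (@le_trans _ _ ((q / 4 + 5 / 8 * t) * r)); last by rewrite ler_pM2r.
  rewrite /r; have := mulr_gt0 q0 t0; nra.
have b0 : 0 <= b by rewrite -(pmulr_lge0 _ r0) (le_trans _ br)// divr_ge0// sqr_ge0.
have h1 : b * (r * (k%:R / 2)) <= b * (s k - r) by rewrite ler_wpM2l.
have h2 : t ^+ 2 / 2 * (k%:R / 2) <= b * r * (k%:R / 2).
  by rewrite ler_wpM2r// divr_ge0.
have -> : tail_exponent (s k) - (s k ^+ 2 - q * s k) / 2 + (s k - q) / q * q ^+ 2 / 2 =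
   - (q + t) ^+ 2 / 2 + tau * r ^+ 3 / 6 - b * (s k - r).
  by rewrite /tail_exponent /b /r; field.
by move: h1 h2; lra.
Qed.

Lemma shell_exists rho : r < rho -> exists k, s k < rho <= 3 / 2 * s k.
Proof.
move=> rr.
have ex : exists n, rho <= s n.
  exists (Num.bound (2 * (rho / r))).
  have h0 : 0 <= 2 * (rho / r) by rewrite mulr_ge0// divr_ge0// ltW// (lt_trans r0).
  have := archi_boundP h0; set n := Num.bound _ => h.
  by rewrite /s -ler_pdivrMr//; have := pow_ge n; move: h; lra.
case: (ex_minnP ex) => n hn nmin.
case: n => [|n] in hn nmin *.
  by move: hn; rewrite /s expr0 mul1r leNgt rr.
exists n; rewrite ltNge; apply/andP; split.
  by apply/negP => /nmin; rewrite ltnn.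
by move: hn; rewrite /s exprS mulrA.
Qed.

(** The gap between the exponents is [rho - s k] times a factor decreasing in [rho]. By
    [tau r <= 3 / 4] that factor is at least [5 r / 8 - q (rho / s k + 1) / 2]; as [r = 2 q + t],
    the ratio [3 / 2] is the largest that keeps this nonnegative for every [t]. *)
Lemma tail_exponent_shell rho : r < rho -> exists k,
  expR (tail_exponent rho) <= shell_coef k * expR (shell_rate k * rho ^+ 2 / 2).
Proof.
move=> /shell_exists[k /andP[sr rs]]; exists k.
rewrite /shell_coef -expRD ler_expR.
have sn : s k != 0 by rewrite gt_eqF.
have E : tail_exponent (s k) - shell_rate k * s k ^+ 2 / 2 + shell_rate k * rho ^+ 2 / 2
   - tail_exponent rho = (rho - s k) * (r - tau * r ^+ 2 / 2 - q * (rho / s k + 1) / 2).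
  by rewrite /tail_exponent /shell_rate; field.
have h : rho / s k <= 3 / 2 by rewrite ler_pdivrMr.
have h2 : q * (rho / s k + 1) <= q * (5 / 2) by rewrite ler_pM2l//; lra.
have h3 : tau * r * r <= 3 / 4 * r by rewrite ler_pM2r.
rewrite -subr_ge0 E mulr_ge0 ?subr_ge0 ?(ltW sr)//.
by move: h2 h3 t0; rewrite /r; nra.
Qed.

End shells.

(** * Explicit constants for the two bounds *)

Section numerics.
Context {R : realType}.
Variables (p x tau : R).
Hypothesis p0 : 0 < p.
Hypothesis x0 : 0 < x.
Hypothesis tau0 : 0 <= tau.
Let q := Num.sqrt p.
Let t := Num.sqrt (2 * x).
Let r := 2 * q + t.
Hypothesis kr : tau * r <= 3 / 4.
Let eps := expR (- x).

Definition tilt_mass lam : R := expR (lam / (1 - lam) * p / 2).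
Local Notation tb := tilt_mass.

Lemma tilt_mass_ge0 lam : 0 <= tb lam. Proof. exact: expR_ge0. Qed.

Let q0 : 0 < q. Proof. by rewrite sqrtr_gt0. Qed.
Let q2 : q ^+ 2 = p. Proof. by rewrite sqr_sqrtr// ltW. Qed.
Let t0 : 0 < t. Proof. by rewrite sqrtr_gt0 mulr_gt0. Qed.
Let t2 : t ^+ 2 = 2 * x. Proof. by rewrite sqr_sqrtr// mulr_ge0// ltW. Qed.
Let r0 : 0 < r. Proof. by rewrite addr_gt0// mulr_gt0. Qed.

(** In the bulk, [exp |delta|] is therefore below the tilt of rate [1 / 4], with room left below
    rate 1. *)
Lemma cubic_le_quadratic rho : 0 <= rho <= r -> tau * rho ^+ 3 / 6 <= rho ^+ 2 / 8.
Proof.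
move=> /andP[rho0 rr].
have : tau * rho <= 3 / 4 by rewrite (le_trans _ kr)// ler_wpM2l.
by have := sqr_ge0 rho; nra.
Qed.

(* The optimal rate at radius [r], as in [shell_rate]. *)
Definition rate0 := 1 - q / r.

Lemma rate0_bounds : 0 <= rate0 < 1.
Proof.
have : 0 < q / r by rewrite divr_gt0.
have : q / r <= 1 by rewrite ler_pdivrMr// mul1r /r; move: q0 t0; lra.
by rewrite /rate0; lra.
Qed.

(** Chernoff bound for the Gaussian mass beyond [r]: the optimal rate gives the exponent
    [- (r - q)^2 / 2 = - (q + t)^2 / 2], which is at most [- t^2 / 2 = - x]. *)
Lemma tail_mass_le : expR (- (rate0 * r ^+ 2 / 2)) * tb rate0 <= eps.
Proof.
have qn : q != 0 by rewrite gt_eqF.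
have rn : r != 0 by rewrite gt_eqF.
rewrite /tb -q2 -expRD ler_expR.
have -> : rate0 / (1 - rate0) = (r - q) / q by rewrite /rate0; field; rewrite rn qn.
have -> : rate0 * r ^+ 2 = r ^+ 2 - q * r by rewrite /rate0; field.
have -> : - ((r ^+ 2 - q * r) / 2) + (r - q) / q * q ^+ 2 / 2 = - (q + t) ^+ 2 / 2.
  by rewrite /r; field.
have -> : - x = - t ^+ 2 / 2 by rewrite t2; field.
by have := mulr_gt0 q0 t0; have := sqr_ge0 q; nra.
Qed.

Lemma one_le_tail rho : r <= rho ->
  1 <= expR (- (rate0 * r ^+ 2 / 2)) * expR (rate0 * rho ^+ 2 / 2).
Proof.
move=> rr; rewrite -expRD -[X in X <= _]expR0 ler_expR.
have /andP[l0 _] := rate0_bounds.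
have : rate0 * r ^+ 2 <= rate0 * rho ^+ 2.
  by rewrite ler_wpM2l// ler_pXn2r// nnegrE ltW// (lt_le_trans r0).
by lra.
Qed.

Definition shell_mass : R :=
  expR (- (q + t) ^+ 2 / 2 + tau * r ^+ 3 / 6) / (1 - expR (- (t ^+ 2 / 4))).

Lemma shell_ratio_lt1 : 0 <= expR (- (t ^+ 2 / 4)) < 1.
Proof. by rewrite expR_ge0 expR_lt1 oppr_lt0 divr_gt0// exprn_gt0. Qed.

Lemma shell_mass_ge0 : 0 <= shell_mass.
Proof.
have /andP[_ z1] := shell_ratio_lt1.
by rewrite divr_ge0 ?expR_ge0// subr_ge0 ltW.
Qed.

(** Since [z = expR (- (t ^+ 2 / 4))] satisfies [z^2 = eps], the factor [1 - 4 eps] contained in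
    [1 - B] absorbs the denominator [1 - z] of the geometric series at the cost of [9 / 8]. *)
Lemma shell_mass_le : (1 - 4 * eps) * shell_mass <=
  9 / 8 * expR (- (q + t) ^+ 2 / 2 + tau * r ^+ 3 / 6).
Proof.
rewrite /shell_mass; set K := expR (_ + _); set z := expR _.
have K0 : 0 < K by exact: expR_gt0.
have /andP[z0 z1] := shell_ratio_lt1; rewrite -/z in z0 z1.
have epsE : eps = z ^+ 2.
  by rewrite /eps /z -expRM_natr; congr expR; rewrite t2; field.
rewrite mulrA ler_pdivrMr ?subr_gt0// epsE.
have : 1 - 4 * z ^+ 2 <= 9 / 8 * (1 - z) by have := sqr_ge0 (z - 9 / 64); lra.
by move=> /(ler_wpM2r (ltW K0)); lra.
Qed.

(** [13 / 10] is a rational just below [ln 4]. *)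
Lemma eps_lt_quarter : 4 * eps < 1 -> 13 / 10 <= x.
Proof.
move=> e1; rewrite leNgt; apply/negP => x13.
have /andP[_ e5] := @expR1_bounds R.
have : 1 <= expR 1 * expR (3 / 10) * eps.
  rewrite /eps -!expRD -[X in X <= _]expR0 ler_expR; lra.
have e3 : expR (3 / 10) * (7 / 10) <= 1 :> R.
  have := expR_ge1Dx (- (3 / 10) : R); rewrite expRN => h.
  by rewrite mulrC -ler_pdivlMr ?expR_gt0// div1r; lra.
have e0 : 0 < eps by exact: expR_gt0.
have := expR_gt0 (3 / 10 : R); have := expR_gt0 (1 : R).
set a := expR 1 in e5 *; set b := expR (3 / 10) in e3 * => a0 b0.
have h : a * b <= 2726 / 700.
  by have : a * b <= 2726 / 1000 * b; [rewrite ler_pM2r|move: e3; lra].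
have : a * b * eps <= 2726 / 700 * eps by rewrite ler_pM2r.
by lra.
Qed.

Lemma bulk_rate_bounds : 0 <= (p + 1)^-1 < 1.
Proof. by rewrite invr_ge0 addr_ge0 ?(ltW p0)//= invf_lt1 ?ltrDr// addr_gt0. Qed.

(** The rate solves [lam / (1 - lam) * p = 1], which makes the mass independent of [p]. *)
Lemma bulk_mass : tb (p + 1)^-1 = expR (1 / 2).
Proof.
have p1 : p + 1 != 0 by rewrite gt_eqF// addr_gt0.
have pn : p != 0 by rewrite gt_eqF.
rewrite /tb; have -> : 1 - (p + 1)^-1 = p / (p + 1) by field.
by congr expR; field; rewrite ?p1 ?pn.
Qed.

(** * First-order constants, for all Borel sets *)

Section first_order.
Let Q := Num.sqrt (p + 1).
Let eta := tau * Q ^+ 3.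
Hypothesis eta_lt : 2 * eta < 1.

Let Q0 : 0 < Q. Proof. by rewrite sqrtr_gt0 addr_gt0. Qed.
Let Q2 : Q ^+ 2 = p + 1. Proof. by rewrite sqr_sqrtr// addr_ge0// ltW. Qed.
Let eta0 : 0 <= eta. Proof. by rewrite mulr_ge0// exprn_ge0// ltW. Qed.

Let tau_cube rho : tau * rho ^+ 3 = eta * (rho / Q) ^+ 3.
Proof. by rewrite /eta; field; rewrite gt_eqF. Qed.

Let rho2 rho : rho ^+ 2 = (p + 1) * (rho / Q) ^+ 2.
Proof. by rewrite -Q2; field; rewrite gt_eqF. Qed.

Lemma cubic_le_tilt rho : 0 <= rho ->
  tau * rho ^+ 3 / 6 <= eta / 4 * expR ((p + 1)^-1 * rho ^+ 2 / 2).
Proof.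
move=> rho0; rewrite tau_cube rho2; set z := rho / Q.
have z0 : 0 <= z by rewrite divr_ge0// ltW.
have -> : (p + 1)^-1 * ((p + 1) * z ^+ 2) / 2 = 1 / 2 * z ^+ 2.
  by field; rewrite gt_eqF// addr_gt0.
have h0 : (0 : R) < 1 / 2 by rewrite divr_gt0.
have y0 : 0 <= z ^+ 2 by exact: sqr_ge0.
have h1 := le_expR_scaled h0 y0; have h2 := sqr_le_expR_scaled h0 y0.
(* The odd power is traded for powers of [z^2], which the exponential estimates handle;
   [(20 / 27 + (40 / 27)^2) / 12 < 1 / 4] gives the constant. *)
have z3 : z ^+ 3 <= (z ^+ 2 + (z ^+ 2) ^+ 2) / 2.
  by have := sqr_ge0 (z * (z - 1)); nra.
set E := expR _ in h1 h2 *; have E0 : 0 < E by exact: expR_gt0.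
have : z ^+ 3 / 6 <= 1 / 4 * E by move: h1 h2; lra.
by move=> /(ler_wpM2l eta0); lra.
Qed.

(** In the first term, a share [eta] of the tilt exponent [z^2 / 2] pays for [expR v]; bounding [v]
    by the remaining exponent [(1 - eta) / 2 * z^2] costs [(1 - eta)^-2]. *)
Lemma bulk_upper rho : 0 <= rho <= r ->
  expR (tau * rho ^+ 3 / 6) <= 1 +
    (eta / 4 / (1 - eta) ^+ 2 * expR ((p + 1)^-1 * rho ^+ 2 / 2) +
     9 / 2 * eta * expR (- (99 / 40 * (p + 1))) * expR (4 / 5 * rho ^+ 2 / 2)).
Proof.
move=> rho_r; have /andP[rho0 _] := rho_r.
have v8 := cubic_le_quadratic rho_r.
set v := tau * rho ^+ 3 / 6 in v8 *.
have v0 : 0 <= v by rewrite divr_ge0// mulr_ge0// exprn_ge0.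
apply: (le_trans (expR_le_affine v0)); rewrite lerD2l.
have e1 : 0 < 1 - eta by move: eta_lt; lra.
have vE : v = eta * (rho / Q) ^+ 3 / 6 by rewrite /v tau_cube.
rewrite rho2 in v8 *; set z := rho / Q in v8 vE *.
have z0 : 0 <= z by rewrite divr_ge0// ltW.
have y0 : 0 <= z ^+ 2 by exact: sqr_ge0.
have -> : (p + 1)^-1 * ((p + 1) * z ^+ 2) / 2 = 1 / 2 * z ^+ 2.
  by field; rewrite gt_eqF// addr_gt0.
have A0 : 0 <= eta / 4 / (1 - eta) ^+ 2 * expR (1 / 2 * z ^+ 2).
  by rewrite mulr_ge0 ?expR_ge0// divr_ge0 ?sqr_ge0// divr_ge0.
have B0 : 0 <= 9 / 2 * eta * expR (- (99 / 40 * (p + 1))) *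
    expR (4 / 5 * ((p + 1) * z ^+ 2) / 2).
  by rewrite mulr_ge0 ?expR_ge0// mulr_ge0 ?expR_ge0// mulr_ge0// divr_ge0.
(* For [z <= 3] the exponent [v] is at most [eta z^2 / 2]; beyond, it is at most
   [rho^2 / 8]. *)
have [z3|z3] := leP z 3.
  apply: (@le_trans _ _ (eta / 4 / (1 - eta) ^+ 2 * expR (1 / 2 * z ^+ 2))); last by rewrite lerDl.
  have m0 : 0 < (1 - eta) / 2 by rewrite divr_gt0.
  have h1 := le_expR_scaled m0 y0; have h2 := sqr_le_expR_scaled m0 y0.
  have -> : expR (1 / 2 * z ^+ 2) = expR ((1 - eta) / 2 * z ^+ 2) * expR (eta / 2 * z ^+ 2).
    by rewrite -expRD; congr expR; field.
  rewrite mulrA ler_pM ?expR_ge0//; last first.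
    rewrite ler_expR vE.
    have : z ^+ 3 <= 3 * z ^+ 2 by rewrite exprSr mulrC ler_wpM2r.
    by move=> /(ler_wpM2l eta0); lra.
  rewrite vE; set E := expR _ in h1 h2 *; have E0 : 0 < E by exact: expR_gt0.
  set u := (1 - eta) in e1 h1 h2 *.
  have u1 : u <= 1 by rewrite /u; move: eta0; lra.
  have z3' : z ^+ 3 <= (z ^+ 2 + (z ^+ 2) ^+ 2) / 2.
    by have := sqr_ge0 (z * (z - 1)); nra.
  have un : u != 0 by rewrite gt_eqF.
  set P := E / u ^+ 2.
  have P0 : 0 <= P by rewrite divr_ge0 ?sqr_ge0// ltW.
  have h1' : z ^+ 2 <= 20 / 27 * P.
    apply: (le_trans h1).
    have -> : 10 / (27 * (u / 2)) * E = 20 / 27 * P * u by rewrite /P; field.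
    by rewrite ler_piMr// mulr_ge0.
  have h2' : (z ^+ 2) ^+ 2 <= 11 / 5 * P.
    apply: (le_trans h2).
    have -> : (20 / (27 * (u / 2))) ^+ 2 * E = (40 / 27) ^+ 2 * P by rewrite /P; field.
    by rewrite ler_wpM2r//; lra.
  have : z ^+ 3 / 6 <= 1 / 4 * P by move: z3' h1' h2' P0; lra.
  move=> /(ler_wpM2l eta0).
  have -> : eta / 4 / u ^+ 2 * E = eta * (1 / 4 * P) by rewrite /P; field.
  by lra.
set B := (X in _ <= _ + X); apply: (@le_trans _ _ B); last by rewrite lerDr.
have v18 : v <= eta * (z ^+ 2) ^+ 2 / 18.
  rewrite vE.
  have : 3 * z ^+ 3 <= (z ^+ 2) ^+ 2.
    have -> : (z ^+ 2) ^+ 2 = z * z ^+ 3 by ring.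
    by rewrite ler_wpM2r ?exprn_ge0// ltW.
  by move=> /(ler_wpM2l eta0); lra.
(* Equality holds at [z = 3], the boundary of this region; [81 / 18] is the coefficient [9 / 2]. *)
have y2 : (z ^+ 2) ^+ 2 <= 81 * expR (2 * (z ^+ 2 / 9 - 1)).
  have h : z ^+ 2 / 9 <= expR (z ^+ 2 / 9 - 1).
    by apply: le_trans (expR_ge1Dx _); lra.
  have h0 : 0 <= z ^+ 2 / 9 by rewrite divr_ge0.
  have : (z ^+ 2 / 9) ^+ 2 <= expR (z ^+ 2 / 9 - 1) ^+ 2 by rewrite ler_pXn2r// nnegrE// expR_ge0.
  have -> : expR (z ^+ 2 / 9 - 1) ^+ 2 = expR (2 * (z ^+ 2 / 9 - 1)) by rewrite -expRM_natr mulrC.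
  by lra.
have -> : B = eta * (9 / 2 * (expR (- (99 / 40 * (p + 1))) * expR (4 / 5 * ((p + 1) * z ^+ 2) / 2))).
  by rewrite /B; ring.
apply: (@le_trans _ _ (eta * ((z ^+ 2) ^+ 2 / 18) * expR ((p + 1) * z ^+ 2 / 8))).
  by rewrite ler_pM ?expR_ge0// ?ler_expR// mulrA.
rewrite -mulrA ler_wpM2l//.
apply: (@le_trans _ _ (9 / 2 * expR (2 * (z ^+ 2 / 9 - 1)) * expR ((p + 1) * z ^+ 2 / 8))).
  by rewrite ler_wpM2r ?expR_ge0//; lra.
(* [99 / 40 = 9 (2 / 5 - 1 / 8)] makes both exponents agree at [z^2 = 9]; beyond, the slope
   [11 / 40 (p + 1)] beats [2 / 9]. *)
rewrite -mulrA ler_pM2l// -!expRD ler_expR.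
have z9 : 9 <= z ^+ 2 by nra.
have : 0 <= p * (z ^+ 2 - 9) by rewrite mulr_ge0 ?(ltW p0)// subr_ge0.
by lra.
Qed.

(** Rate [4 / 5] has mass [expR (2 * p)], which the decay [expR (- (99 / 40 * p))] outweighs; a
    numerical value of [expR (- (99 / 40))] is all that remains. *)
Lemma far_mass : 9 / 2 * eta * expR (- (99 / 40 * (p + 1))) * tb (4 / 5) <= 42 / 100 * eta.
Proof.
have -> : tb (4 / 5) = expR (2 * p) by congr expR; field.
rewrite -mulrA -expRD.
have e : expR (- (99 / 40 * (p + 1)) + 2 * p) <= 42 / 450.
  apply: (@le_trans _ _ (expR (- (99 / 40)))); first by rewrite ler_expR; move: p0; lra.
  rewrite expRN.
  have /andP[e1 _] := @expR1_bounds R.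
  have -> : expR (99 / 40 : R) = expR 1 ^+ 2 * expR (19 / 40).
    by rewrite -expRM_natr -expRD; congr expR; field.
  have h : 59 / 40 <= expR (19 / 40 : R) by apply: le_trans (expR_ge1Dx _); lra.
  move: (expR 1) (expR (19 / 40)) e1 h => a b a1 b1.
  have a2 : 734 / 100 <= a ^+ 2 by have := sqr_ge0 (a - 271 / 100); lra.
  have a0 : 0 < a ^+ 2 by lra.
  have ab : a ^+ 2 * (59 / 40) <= a ^+ 2 * b by rewrite ler_pM2l.
  have ab0 : 0 < a ^+ 2 * b by lra.
  by rewrite -div1r ler_pdivrMr//; lra.
have : 9 / 2 * eta * expR (- (99 / 40 * (p + 1)) + 2 * p) <= 9 / 2 * eta * (42 / 450).
  by rewrite ler_wpM2l// mulr_ge0// divr_ge0.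
by lra.
Qed.


Let eps0 : 0 < eps. Proof. exact: expR_gt0. Qed.

(** Shaped for [shell_first_order]: there [1 + q t / 3] is absorbed by [exp (- q t / 3)] and
    [2 x + 2] by [exp (- x / 2)]. *)
Lemma first_order_poly : 13 / 10 <= x ->
  r ^+ 2 <= (2 * x + 2) * Q ^+ 2 * (1 + q * t / 3).
Proof.
move=> x13; rewrite Q2 -q2 -t2 /r.
have t13 : 13 / 5 <= t ^+ 2 by rewrite t2; lra.
set v := q * t; have v0 : 0 < v by rewrite mulr_gt0.
set w := q ^+ 2; have w0 : 0 <= w by exact: sqr_ge0.
have wv : w * (13 / 5) <= v ^+ 2 by rewrite /w /v exprMn ler_wpM2l ?sqr_ge0.
have vt : v * (13 / 5) <= v * t ^+ 2 by rewrite ler_pM2l.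
have -> : (2 * q + t) ^+ 2 = 4 * w + 4 * v + t ^+ 2 by rewrite /w /v; ring.
have -> : (t ^+ 2 + 2) * (w + 1) * (1 + v / 3) =
   (t ^+ 2 + 2) * (1 + v / 3) + (v ^+ 2 + 2 * w) * (1 + v / 3).
  by rewrite /w /v; ring.
(* The only obstacle in [w] is [2 / 3 * w * (3 - v)], whence the split at 3. Below it
   [w <= 5 / 13 * v^2] leaves a cubic in [v], minimal near [53 / 50]. *)
have h1 : 0 <= v * (v - 53 / 50) ^+ 2 by rewrite mulr_ge0 ?sqr_ge0// ltW.
have h2 : 0 <= (v - 53 / 50) ^+ 2 by exact: sqr_ge0.
have [v3|v3] := leP v 3.
  have : w * (13 / 5) * (3 - v) <= v ^+ 2 * (3 - v) by rewrite ler_wpM2r// subr_ge0.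
  by move: h1 h2 vt v0; lra.
have : 0 <= w * (v - 3) by rewrite mulr_ge0// subr_ge0 ltW.
have : v * 3 <= v * v by rewrite ler_pM2l// ltW.
have : 0 <= v * v * v by rewrite !mulr_ge0// ltW.
by move: vt v3; lra.
Qed.

Lemma tail_exponent_le (a : R) : a <= r ^+ 2 / 8 ->
  - (q + t) ^+ 2 / 2 + a <= - (q * t / 2) - 3 / 4 * x.
Proof.
have -> : x = t ^+ 2 / 2 by rewrite t2; field.
by rewrite /r; lra.
Qed.

(** With [expR y <= 1 + y expR y], the constant part is at most [eps], and the rest is [eta] times
    [xi^3 / 6], where [xi] is bounded uniformly in [q] and [t]. *)
Lemma shell_first_order : 13 / 10 <= x ->
  expR (- (q + t) ^+ 2 / 2 + tau * r ^+ 3 / 6) <= eps + 632 / 1000 * eta.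
Proof.
move=> x13; set y := tau * r ^+ 3 / 6.
have y8 : y <= r ^+ 2 / 8 by apply: cubic_le_quadratic; rewrite lexx ltW.
have y0 : 0 <= y by rewrite divr_ge0// mulr_ge0// exprn_ge0// ltW.
rewrite expRD; set e0 := expR (- (q + t) ^+ 2 / 2).
have e00 : 0 < e0 by exact: expR_gt0.
have e0e : e0 <= eps.
  rewrite ler_expR; have -> : x = t ^+ 2 / 2 by rewrite t2; field.
  by have := mulr_gt0 q0 t0; have := sqr_ge0 q; lra.
set e1 := expR (- (q * t / 2) - 3 / 4 * x).
have e01 : e0 * expR y <= e1.
  by rewrite -expRD ler_expR; exact: tail_exponent_le.
have := ler_wpM2l (ltW e00) (expR_le_affine y0).
rewrite mulrDr mulr1 mulrCA => h.
have : y * (e0 * expR y) <= y * e1 by rewrite ler_wpM2l.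
suff : y * e1 <= 632 / 1000 * eta by lra.
pose xi := r / Q * expR (- (q * t / 6) - x / 4).
have xi0 : 0 <= xi by rewrite mulr_ge0 ?expR_ge0// divr_ge0// ltW.
have -> : y * e1 = eta * (xi ^+ 3 / 6).
  rewrite /xi exprMn -expRM_natr /y /eta.
  have -> : (- (q * t / 6) - x / 4) * 3%:R = - (q * t / 2) - 3 / 4 * x by field.
  by rewrite -/e1; field; rewrite gt_eqF.
have xi2 : xi ^+ 2 <= 243 / 100.
  have -> : xi ^+ 2 = r ^+ 2 / Q ^+ 2 * (expR (- (q * t / 3)) * expR (- (x / 2))).
    rewrite /xi exprMn -expRM_natr -expRD; congr (_ * expR _); last by field.
    by rewrite expr_div_n.
  have h1 := first_order_poly x13.
  have h2 : (1 + q * t / 3) * expR (- (q * t / 3)) <= 1.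
    rewrite expRN ler_pdivrMr ?expR_gt0// mul1r.
    by apply: le_trans (expR_ge1Dx _); lra.
  have /andP[e5 _] := @expR_half_bounds R.
  (* The maximum is at [x = 1], with value [4 exp (- 1 / 2)]. *)
  have h3 : (2 * x + 2) * expR (- (x / 2)) <= 243 / 100.
    have : x + 1 <= 2 * expR ((x - 1) / 2) by have := expR_ge1Dx ((x - 1) / 2); lra.
    have -> : expR ((x - 1) / 2) = expR (x / 2) / expR (1 / 2).
      by rewrite -expRB; congr expR; field.
    rewrite expRN; set a := expR (x / 2); set b := expR (1 / 2) in e5 * => h4.
    have a0 : 0 < a by exact: expR_gt0.
    have b0 : 0 < b by lra.
    rewrite ler_pdivrMr//.
    have : (x + 1) * b <= 2 * a by move: h4; rewrite mulrA ler_pdivlMr.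
    have : (x + 1) * (1647 / 1000) <= (x + 1) * b by rewrite ler_pM2l// addr_gt0.
    by lra.
  have h5 : r ^+ 2 / Q ^+ 2 <= (2 * x + 2) * (1 + q * t / 3).
    by rewrite ler_pdivrMr ?exprn_gt0// mulrAC.
  set a := expR (- (q * t / 3)) in h2 *; set b := expR (- (x / 2)) in h3 *.
  have a0 : 0 < a by exact: expR_gt0.
  have b0 : 0 < b by exact: expR_gt0.
  apply: (@le_trans _ _ ((2 * x + 2) * (1 + q * t / 3) * (a * b))).
    by apply: ler_wpM2r => //; rewrite mulr_ge0// ltW.
  have -> : (2 * x + 2) * (1 + q * t / 3) * (a * b) = (2 * x + 2) * b * ((1 + q * t / 3) * a) by ring.
  have x2 : 0 <= 2 * x + 2 by move: x0; lra.
  by apply: le_trans h3; rewrite ler_piMr// mulr_ge0// ltW.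
have xi1 : xi <= 156 / 100.
  rewrite leNgt; apply/negP => hx.
  have : (156 / 100) ^+ 2 < xi ^+ 2 by rewrite ltr_pXn2r// nnegrE.
  by lra.
rewrite mulrC ler_wpM2r//.
have -> : xi ^+ 3 = xi ^+ 2 * xi by ring.
have : xi ^+ 2 * xi <= 243 / 100 * (156 / 100) by rewrite ler_pM// sqr_ge0.
by lra.
Qed.

(** Since [1 - B <= (1 - eta)^2], the denominator of the bulk term cancels. The multiples of [eta]
    (two bulk terms, far term, shells) then add up to less than [2 eta], and those of [eps] to less
    than [4 eps]. *)
Lemma first_order_total (U L B : R) : B = 2 * eta + 4 * eps -> B < 1 ->
  U = eta / 4 / (1 - eta) ^+ 2 * tb (p + 1)^-1 +
      9 / 2 * eta * expR (- (99 / 40 * (p + 1))) * tb (4 / 5) + shell_mass ->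
  L = eta / 4 * tb (p + 1)^-1 + expR (- (rate0 * r ^+ 2 / 2)) * tb rate0 ->
  U * (1 - B) + L <= B.
Proof.
move=> BE B1 UE LE; rewrite UE LE bulk_mass.
have /andP[_ e5] := @expR_half_bounds R.
have x13 : 13 / 10 <= x by apply: eps_lt_quarter; move: B1 eta0; rewrite BE; lra.
have S0 := shell_mass_ge0; have S1 := shell_mass_le; have K1 := shell_first_order x13.
have F1 := far_mass; have T1 := tail_mass_le.
set F := 9 / 2 * eta * _ * _ in F1 *; set T := expR _ * tb rate0 in T1 *.
have F0 : 0 <= F.
  by rewrite !mulr_ge0 ?expR_ge0 ?tilt_mass_ge0 ?divr_ge0 ?(ltW Q0).
set S := shell_mass in S0 S1 *; set K := expR (_ + _) in S1 K1.
set e5' := expR (1 / 2) in e5 *.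
have e50 : 0 < e5' by exact: expR_gt0.
have B0 : 0 < 1 - B by lra.
have m1 : F * (1 - B) <= F by rewrite ler_piMr//; move: BE eta0 eps0; lra.
have m2 : S * (1 - B) <= (1 - 4 * eps) * S.
  by rewrite mulrC ler_wpM2r//; move: BE eta0; lra.
have u0 : 0 < 1 - eta by move: eta_lt; lra.
have m3 : eta / 4 / (1 - eta) ^+ 2 * e5' * (1 - B) <= eta / 4 * e5'.
  have -> : eta / 4 / (1 - eta) ^+ 2 * e5' * (1 - B) =
      eta / 4 * e5' * ((1 - B) / (1 - eta) ^+ 2) by field; rewrite gt_eqF.
  rewrite ler_piMr//; first by rewrite mulr_ge0 ?(ltW e50)// divr_ge0.
  rewrite ler_pdivrMr ?exprn_gt0// mul1r BE.
  by have := sqr_ge0 eta; move: eps0; lra.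
have m4 : eta / 4 * e5' <= eta / 4 * (1651 / 1000) by rewrite ler_wpM2l// divr_ge0.
by rewrite !mulrDl; move: eps0 eta0; lra.
Qed.

End first_order.

(** * Second-order constants, for symmetric sets *)

Section second_order.
Variable tau4 : R.
Hypothesis tau40 : 0 <= tau4.
Let Q := Num.sqrt (p + 2).
Let sz := tau * Q ^+ 3.
Let zeta := sz ^+ 2.
Let chi := tau4 * (p + 1) ^+ 2.
Hypothesis zeta_lt : zeta < 2.

Let Q0 : 0 < Q. Proof. by rewrite sqrtr_gt0 addr_gt0. Qed.
Let Q2 : Q ^+ 2 = p + 2. Proof. by rewrite sqr_sqrtr// addr_ge0// ltW. Qed.
Let sz0 : 0 <= sz. Proof. by rewrite mulr_ge0// exprn_ge0// ltW. Qed.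
Let zeta0 : 0 <= zeta. Proof. exact: sqr_ge0. Qed.
Let chi0 : 0 <= chi. Proof. by rewrite mulr_ge0// sqr_ge0. Qed.
Let eps0 : 0 < eps. Proof. exact: expR_gt0. Qed.
Let p20 : 0 < p + 2. Proof. by rewrite addr_gt0. Qed.
Let sz2 : 0 < 1 - sz / 2.
Proof.
rewrite subr_gt0 ltr_pdivrMr// mul1r ltNge; apply/negP => h.
by have : 2 ^+ 2 <= sz ^+ 2; [rewrite ler_pXn2r// nnegrE|move: zeta_lt; rewrite /zeta; lra].
Qed.

Lemma bulk_rate2_bounds : 0 <= 2 / (p + 2) < 1.
Proof. by rewrite divr_ge0 ?(ltW p20)//= ltr_pdivrMr// mul1r ltrDr. Qed.

(** Here [lam / (1 - lam) * p = 2]: the squared cubic term is of degree three in [rho^2] and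
    receives twice the exponent, which shifts [p] by 2. *)
Lemma bulk_mass2 : tb (2 / (p + 2)) = expR 1.
Proof.
have p1 : p + 2 != 0 by rewrite gt_eqF.
have pn : p != 0 by rewrite gt_eqF.
rewrite /tb; have -> : 1 - 2 / (p + 2) = p / (p + 2) by field.
by congr expR; field; rewrite ?p1 ?pn.
Qed.

Lemma quartic_le_tilt rho : 0 <= rho ->
  tau4 * rho ^+ 4 / 24 <= chi * (11 / 5) / 24 * expR ((p + 1)^-1 * rho ^+ 2 / 2).
Proof.
move=> rho0; have p1 : 0 < p + 1 by rewrite addr_gt0.
set y := rho ^+ 2 / (p + 1).
have y0 : 0 <= y by rewrite divr_ge0 ?sqr_ge0// ltW.
have h0 : (0 : R) < 1 / 2 by rewrite divr_gt0.
have -> : (p + 1)^-1 * rho ^+ 2 / 2 = 1 / 2 * y by rewrite /y; field; rewrite gt_eqF.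
have : y ^+ 2 <= 11 / 5 * expR (1 / 2 * y).
  by have := sqr_le_expR_scaled h0 y0; have := expR_gt0 (1 / 2 * y); lra.
move=> /(ler_wpM2l chi0).
have -> : chi * y ^+ 2 = tau4 * rho ^+ 4 by rewrite /chi /y; field; rewrite gt_eqF.
by lra.
Qed.

Let tau_cube rho : tau * rho ^+ 3 = sz * (rho / Q) ^+ 3.
Proof. by rewrite /sz; field; rewrite gt_eqF. Qed.

Let rho2 rho : rho ^+ 2 = (p + 2) * (rho / Q) ^+ 2.
Proof. by rewrite -Q2; field; rewrite gt_eqF. Qed.

(** With [v^2 = zeta y^3 / 36], the fractions [1 / 108] and [1 / 216] are the coefficients [1 / 3]
    and [1 / 6] of [expR_le_order2_abs] divided by 36, and [11 / 8] exceeds the [(10 / 9)^3] of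
    [cube_le_expR_scaled]. *)
Definition bulk2_coef : R := (tau * Num.sqrt (p + 2) ^+ 3) ^+ 2 * (11 / 8) *
  (1 / 108 + 1 / 216 / (1 - (tau * Num.sqrt (p + 2) ^+ 3) / 2) ^+ 3).
Definition far2_coef : R :=
  27 / 8 * (tau * Num.sqrt (p + 2) ^+ 3) ^+ 2 * expR (- (99 / 40 * (p + 2))).

Let bulk2_coefE : bulk2_coef = zeta * (11 / 8) *
  (1 / 108 + 1 / 216 / (1 - sz / 2) ^+ 3). Proof. by []. Qed.
Let far2_coefE : far2_coef = 27 / 8 * zeta * expR (- (99 / 40 * (p + 2))).
Proof. by []. Qed.

Lemma bulk2_coef_ge0 : 0 <= bulk2_coef.
Proof.
rewrite bulk2_coefE; apply: mulr_ge0; first by apply: mulr_ge0 => //; apply: divr_ge0.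
apply: addr_ge0; first exact: divr_ge0.
by apply: divr_ge0; [exact: (divr_ge0 ler01 (ler0n _ _))|rewrite exprn_ge0// ltW].
Qed.

Lemma far2_coef_ge0 : 0 <= far2_coef.
Proof.
rewrite far2_coefE; apply: mulr_ge0; last exact: expR_ge0.
by apply: mulr_ge0 => //; exact: divr_ge0.
Qed.

Lemma bulk_upper2 rho (v := tau * rho ^+ 3 / 6) : 0 <= rho <= r ->
  v ^+ 2 / 3 + v ^+ 2 * expR v / 6 <=
    bulk2_coef * expR (2 / (p + 2) * rho ^+ 2 / 2) +
    far2_coef * expR (4 / 5 * rho ^+ 2 / 2).
Proof.
move=> rho_r; have /andP[rho0 _] := rho_r.
have v8 := cubic_le_quadratic rho_r; rewrite -/v in v8.
have vE : v = sz * (rho / Q) ^+ 3 / 6 by rewrite /v tau_cube.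
rewrite rho2 in v8 *; set z := rho / Q in v8 vE *.
have z0 : 0 <= z by rewrite divr_ge0// ltW.
set y := z ^+ 2 in v8 *; have y0 : 0 <= y by exact: sqr_ge0.
have v2 : v ^+ 2 = zeta * y ^+ 3 / 36 by rewrite vE /zeta /y; field.
have -> : 2 / (p + 2) * ((p + 2) * y) / 2 = y by field; rewrite gt_eqF.
have c1 : y ^+ 3 <= 11 / 8 * expR y.
  by have := cube_le_expR_scaled ltr01 y0; have := expR_gt0 y; rewrite mul1r; lra.
have sz2u := sz2; set u := 1 - sz / 2 in sz2u *.
have first : v ^+ 2 / 3 <= zeta * (11 / 8) * (1 / 108) * expR y.
  by have := ler_wpM2l zeta0 c1; rewrite v2; lra.
rewrite bulk2_coefE mulrDr mulrDl.
suff second : v ^+ 2 * expR v / 6 <=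
    zeta * (11 / 8) * (1 / 216 / u ^+ 3) * expR y +
    far2_coef * expR (4 / 5 * ((p + 2) * y) / 2) by lra.
have A0 : 0 <= zeta * (11 / 8) * (1 / 216 / u ^+ 3) * expR y.
  apply: mulr_ge0; last exact: expR_ge0.
  apply: mulr_ge0; first by apply: mulr_ge0 => //; exact: divr_ge0.
  by apply: divr_ge0; [exact: (divr_ge0 ler01 (ler0n _ _))|rewrite exprn_ge0// ltW].
have B0 : 0 <= far2_coef * expR (4 / 5 * ((p + 2) * y) / 2).
  by apply: mulr_ge0; [exact: far2_coef_ge0|exact: expR_ge0].
(* Up to 3, [v <= sz / 2 * y] takes a share [sz / 2] of the exponent [y] and leaves [u y] for the
   cube. Beyond, [v <= (p + 2) y / 8] and rate [4 / 5] are used as in [bulk_upper]; [27 / 8] is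
   [9^3 / 216]. *)
have [z3|z3] := leP z 3.
  set A := zeta * _ * _ * _ in A0 *.
  apply: (@le_trans _ _ A); last by rewrite lerDl.
  have c2 : y ^+ 3 <= 11 / 8 / u ^+ 3 * expR (u * y).
    apply: (le_trans (cube_le_expR_scaled sz2u y0)); rewrite ler_pM2r ?expR_gt0//.
    rewrite ler_pdivlMr ?exprn_gt0//.
    have -> : (10 / (9 * u)) ^+ 3 * u ^+ 3 = (10 / 9) ^+ 3 by field; rewrite gt_eqF.
    by lra.
  have ve : expR v <= expR (sz / 2 * y).
    rewrite ler_expR vE.
    have : z ^+ 3 <= 3 * y by rewrite exprSr mulrC ler_wpM2r.
    by move=> /(ler_wpM2l sz0); lra.
  have -> : A = zeta / 216 * (11 / 8 / u ^+ 3 * expR (u * y) * expR (sz / 2 * y)).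
    have -> : 11 / 8 / u ^+ 3 * expR (u * y) * expR (sz / 2 * y) =
        11 / 8 / u ^+ 3 * expR y.
      by rewrite -mulrA -expRD; congr (_ * expR _); rewrite /u; field.
    by rewrite /A; field; rewrite gt_eqF.
  rewrite v2.
  have : y ^+ 3 * expR v <= 11 / 8 / u ^+ 3 * expR (u * y) * expR (sz / 2 * y).
    by rewrite ler_pM ?expR_ge0 ?exprn_ge0.
  have z216 : 0 <= zeta / 216 := divr_ge0 zeta0 (ler0n _ _).
  by move=> /(ler_wpM2l z216); lra.
set B := far2_coef * _ in B0 *.
apply: (@le_trans _ _ B); last by rewrite lerDr.
have y9 : 9 <= y by rewrite /y; nra.
have y3 : y ^+ 3 <= 729 * expR (3 * (y / 9 - 1)).
  have h : y / 9 <= expR (y / 9 - 1) by apply: le_trans (expR_ge1Dx _); lra.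
  have h0 : 0 <= y / 9 by rewrite divr_ge0.
  have : (y / 9) ^+ 3 <= expR (y / 9 - 1) ^+ 3 by rewrite ler_pXn2r// nnegrE// expR_ge0.
  have -> : expR (y / 9 - 1) ^+ 3 = expR (3 * (y / 9 - 1)) by rewrite -expRM_natr mulrC.
  by lra.
have -> : B = zeta / 216 * (729 * (expR (- (99 / 40 * (p + 2))) * expR (4 / 5 * ((p + 2) * y) / 2))).
  by rewrite /B far2_coefE; field.
have -> : v ^+ 2 * expR v / 6 = zeta / 216 * (y ^+ 3 * expR v) by rewrite v2; field.
apply: ler_wpM2l; first exact: (divr_ge0 zeta0 (ler0n _ _)).
apply: (@le_trans _ _ (729 * expR (3 * (y / 9 - 1)) * expR ((p + 2) * y / 8))).
  by rewrite ler_pM ?expR_ge0 ?exprn_ge0// ler_expR.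
rewrite -mulrA; apply: ler_wpM2l; first by rewrite ler0n.
rewrite -!expRD ler_expR.
have : 0 <= p * (y - 9) by rewrite mulr_ge0 ?(ltW p0)// subr_ge0.
by lra.
Qed.

Lemma far_mass2 : far2_coef * tb (4 / 5) <= 33 / 1000 * zeta.
Proof.
have -> : tb (4 / 5) = expR (2 * p) by congr expR; field.
rewrite far2_coefE -(mulrA (27 / 8 * zeta)) -expRD.
have e : expR (- (99 / 40 * (p + 2)) + 2 * p) <= 11 / 1125.
  apply: (@le_trans _ _ (expR (- (99 / 20)))); first by rewrite ler_expR; move: p0; lra.
  rewrite expRN.
  have /andP[e1 _] := @expR1_bounds R.
  have -> : expR (99 / 20 : R) = expR 1 ^+ 4 * expR (19 / 20).
    by rewrite -expRM_natr -expRD; congr expR; field.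
  have h : 39 / 20 <= expR (19 / 20 : R) by apply: le_trans (expR_ge1Dx _); lra.
  move: (expR 1) (expR (19 / 20)) e1 h => a b a1 b1.
  have a2 : 734 / 100 <= a ^+ 2 by have := sqr_ge0 (a - 271 / 100); lra.
  have a4 : 53 <= a ^+ 4.
    have -> : a ^+ 4 = (a ^+ 2) ^+ 2 by ring.
    by have := sqr_ge0 (a ^+ 2 - 734 / 100); lra.
  have a0 : 0 < a ^+ 4 by lra.
  have ab : a ^+ 4 * (39 / 20) <= a ^+ 4 * b by rewrite ler_pM2l.
  have ab0 : 0 < a ^+ 4 * b by lra.
  by rewrite -div1r ler_pdivrMr//; lra.
have : 27 / 8 * zeta * expR (- (99 / 40 * (p + 2)) + 2 * p) <= 27 / 8 * zeta * (11 / 1125).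
  by rewrite ler_wpM2l// mulr_ge0// divr_ge0.
by move: zeta0; lra.
Qed.

(** Counterpart of [first_order_poly]: the obstacle is now [2 / 5 * w * (4 - v)], and [107 / 50] is
    near the minimizer of the remaining cubic in [v]. *)
Lemma second_order_poly : 13 / 10 <= x ->
  r ^+ 2 <= (x + 12 / 5) * Q ^+ 2 * (1 + q * t / 6).
Proof.
move=> x13; have -> : x = t ^+ 2 / 2 by rewrite t2; field.
rewrite Q2 -q2 /r.
have t13 : 13 / 5 <= t ^+ 2 by rewrite t2; lra.
set v := q * t; have v0 : 0 < v by rewrite mulr_gt0.
set w := q ^+ 2; have w0 : 0 <= w by exact: sqr_ge0.
have wv : w * (13 / 5) <= v ^+ 2 by rewrite /w /v exprMn ler_wpM2l ?sqr_ge0.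
have vt : v * (13 / 5) <= v * t ^+ 2 by rewrite ler_pM2l.
have -> : (2 * q + t) ^+ 2 = 4 * w + 4 * v + t ^+ 2 by rewrite /w /v; ring.
have -> : (t ^+ 2 / 2 + 12 / 5) * (w + 2) * (1 + v / 6) =
   (t ^+ 2 + 24 / 5) * (1 + v / 6) + (v ^+ 2 / 2 + 12 / 5 * w) * (1 + v / 6).
  by rewrite /w /v; field.
have h1 : 0 <= v * (v - 107 / 50) ^+ 2 by rewrite mulr_ge0 ?sqr_ge0// ltW.
have h2 : 0 <= (v - 107 / 50) ^+ 2 by exact: sqr_ge0.
have [v4|v4] := leP v 4.
  have : w * (13 / 5) * (4 - v) <= v ^+ 2 * (4 - v) by rewrite ler_wpM2r// subr_ge0.
  by move: h1 h2 vt v0; lra.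
have : 0 <= w * (v - 4) by rewrite mulr_ge0// subr_ge0 ltW.
have : v * 4 <= v * v by rewrite ler_pM2l// ltW.
have : v * v * 4 <= v * v * v by rewrite ler_pM2l ?mulr_gt0// ltW.
by move: vt v4; lra.
Qed.

Lemma shell_second_order : 13 / 10 <= x -> 4 * eps < 1 ->
  9 / 8 * expR (- (q + t) ^+ 2 / 2 + tau * r ^+ 3 / 6) <= 3 * eps + 316 / 1000 * zeta.
Proof.
move=> x13 e4; set y := tau * r ^+ 3 / 6.
have y8 : y <= r ^+ 2 / 8 by apply: cubic_le_quadratic; rewrite lexx ltW.
have y0 : 0 <= y by rewrite divr_ge0// mulr_ge0// exprn_ge0// ltW.
rewrite expRD; set e0 := expR (- (q + t) ^+ 2 / 2).
have e00 : 0 < e0 by exact: expR_gt0.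
have e0e : e0 <= eps.
  rewrite ler_expR; have -> : x = t ^+ 2 / 2 by rewrite t2; field.
  by have := mulr_gt0 q0 t0; have := sqr_ge0 q; lra.
set e1 := expR (- (q * t / 2) - 3 / 4 * x).
have e10 : 0 < e1 by exact: expR_gt0.
have e01 : e0 * expR y <= e1.
  by rewrite -expRD ler_expR; exact: tail_exponent_le.
pose e2 := expR (- (x / 4)).
have e20 : 0 < e2 by exact: expR_gt0.
(* A rational just above [4^(-1/4)]. *)
have e2b : e2 <= 708 / 1000.
  have E : eps = e2 ^+ 4 by rewrite /eps /e2 -expRM_natr; congr expR; field.
  rewrite leNgt; apply/negP => hx.
  have a2 : 501 / 1000 <= e2 ^+ 2 by have := sqr_ge0 (e2 - 708 / 1000); lra.
  have : 251 / 1000 <= (e2 ^+ 2) ^+ 2 by have := sqr_ge0 (e2 ^+ 2 - 501 / 1000); lra.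
  have -> : (e2 ^+ 2) ^+ 2 = e2 ^+ 4 by ring.
  by rewrite -E; lra.
have e0e1 : e0 <= e1 * e2.
  rewrite -expRD ler_expR; have -> : x = t ^+ 2 / 2 by rewrite t2; field.
  by have := mulr_gt0 q0 t0; have := sqr_ge0 q; lra.
have Y0 : 0 <= y ^+ 2 by exact: sqr_ge0.
have h := ler_wpM2l (ltW e00) (expR_le_order2 y0).
have h1 : y ^+ 2 * (e0 * expR y) <= y ^+ 2 * e1 by rewrite ler_wpM2l.
have h2 : y ^+ 2 * e0 <= y ^+ 2 * (e1 * (708 / 1000)).
  by rewrite ler_wpM2l// (le_trans e0e1)// ler_pM2l.
(* A term linear in [y] would be of first order in [tau]. It is split between the constant and
   [y^2]; the constant may grow to 3 because the Gaussian tail uses one of the four [eps]. The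
   vertex of the resulting quadratic is [45 / 14]. *)
have h3 : e0 * (9 / 8 * (1 + y + y ^+ 2 / 3)) <= e0 * (3 + 55 / 100 * y ^+ 2).
  by rewrite ler_pM2l//; have := sqr_ge0 (y - 45 / 14); lra.
suff : y ^+ 2 * e1 <= 547 / 1000 * zeta.
  by move: h h1 h2 h3 e0e zeta0; lra.
pose xi := r ^+ 2 / Q ^+ 2 * (expR (- (q * t / 6)) * e2).
have -> : y ^+ 2 * e1 = zeta * (xi ^+ 3 / 36).
  rewrite /xi !(exprMn 3) /e2 -!expRM_natr.
  have -> : e1 = expR (- (q * t / 6) * 3%:R) * expR (- (x / 4) * 3%:R).
    by rewrite -expRD; congr expR; field.
  by rewrite /y /zeta /sz; field; rewrite gt_eqF.
have xi0 : 0 <= xi.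
  by rewrite /xi mulr_ge0 ?divr_ge0 ?sqr_ge0// mulr_ge0 ?expR_ge0// ltW.
have xi1 : xi <= 27 / 10.
  have hp := second_order_poly x13.
  have k2 : (1 + q * t / 6) * expR (- (q * t / 6)) <= 1.
    rewrite expRN ler_pdivrMr ?expR_gt0// mul1r.
    by apply: le_trans (expR_ge1Dx _); lra.
  have /andP[e5 _] := @expR_half_bounds R.
  (* The maximum is at [x = 8 / 5], with value [4 exp (- 2 / 5)]. *)
  have k3 : (x + 12 / 5) * e2 <= 27 / 10.
    have k1 : x + 12 / 5 <= 4 * expR (x / 4 - 2 / 5).
      by have := expR_ge1Dx (x / 4 - 2 / 5); lra.
    have k4 : expR (x / 4 - 2 / 5) * e2 * expR (1 / 2) = expR (1 / 10).
      by rewrite /e2 -!expRD; congr expR; field.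
    have k5 : expR (1 / 10 : R) * (9 / 10) <= 1.
      have := expR_ge1Dx (- (1 / 10) : R); rewrite expRN => h5.
      by rewrite mulrC -ler_pdivlMr ?expR_gt0// [X in _ <= X]div1r; move: h5; lra.
    set a := expR (x / 4 - 2 / 5) in k1 k4 *.
    have a0 : 0 < a by exact: expR_gt0.
    apply: (@le_trans _ _ (4 * (a * e2))); first by rewrite mulrA ler_pM2r.
    have ae : 0 < a * e2 by rewrite mulr_gt0.
    have : a * e2 * (1647 / 1000) <= a * e2 * expR (1 / 2) by rewrite ler_pM2l.
    by rewrite k4; lra.
  have k5 : r ^+ 2 / Q ^+ 2 <= (x + 12 / 5) * (1 + q * t / 6).
    by rewrite ler_pdivrMr ?exprn_gt0// mulrAC.
  rewrite /xi; set a := expR (- (q * t / 6)) in k2 *.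
  have a0 : 0 < a by exact: expR_gt0.
  apply: (@le_trans _ _ ((x + 12 / 5) * (1 + q * t / 6) * (a * e2))).
    by apply: ler_wpM2r => //; rewrite mulr_ge0// ltW.
  have -> : (x + 12 / 5) * (1 + q * t / 6) * (a * e2) =
    (x + 12 / 5) * e2 * ((1 + q * t / 6) * a) by ring.
  have x2 : 0 <= x + 12 / 5 by move: x0; lra.
  by apply: le_trans k3; rewrite ler_piMr// mulr_ge0// ltW.
rewrite mulrC ler_wpM2r//.
have : xi ^+ 3 <= (27 / 10) ^+ 3 by rewrite ler_pXn2r// nnegrE.
by lra.
Qed.

(** The shells and the tail exhaust the four [eps]; the multiples of [zeta] stay below [1 / 2] and
    those of [chi] below 1. *)
Lemma second_order_total (U L B : R) : B = (zeta + 2 * chi) / 2 + 4 * eps -> B < 1 ->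
  U = chi * (11 / 5) / 24 * tb (p + 1)^-1 + bulk2_coef * tb (2 / (p + 2)) +
      far2_coef * tb (4 / 5) + shell_mass ->
  L = chi * (11 / 5) / 24 * tb (p + 1)^-1 +
      expR (- (rate0 * r ^+ 2 / 2)) * tb rate0 ->
  U * (1 - B) + L <= B.
Proof.
move=> BE B1 UE LE; rewrite UE LE bulk_mass bulk_mass2.
have /andP[_ e5] := @expR_half_bounds R.
have /andP[_ e1] := @expR1_bounds R.
have e4 : 4 * eps < 1 by move: B1 zeta0 chi0; rewrite BE; lra.
have x13 : 13 / 10 <= x by exact: eps_lt_quarter.
have S0 := shell_mass_ge0; have S1 := shell_mass_le.
have K1 := shell_second_order x13 e4.
have F1 := far_mass2; have T1 := tail_mass_le.
have F0 : 0 <= far2_coef * tb (4 / 5).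
  by apply: mulr_ge0; [exact: far2_coef_ge0|exact: tilt_mass_ge0].
set F := far2_coef * _ in F0 F1 *; set T := expR _ * tb rate0 in T1 *.
set S := shell_mass in S0 S1 *; set K := expR (_ + _) in S1 K1.
have e50 := expR_gt0 (1 / 2 : R); have e10 := expR_gt0 (1 : R).
set e5' := expR (1 / 2) in e5 e50 *; set e1' := expR 1 in e1 e10 *.
have B0 : 0 < 1 - B by lra.
have B1' : 1 - B <= 1 by move: BE zeta0 chi0 eps0; lra.
have m1 : F * (1 - B) <= F by rewrite ler_piMr.
have m2 : S * (1 - B) <= (1 - 4 * eps) * S.
  by rewrite mulrC ler_wpM2r//; move: BE zeta0 chi0; lra.
have X0 : 0 <= chi * (11 / 5) / 24 * e5'.
  apply: mulr_ge0; last exact: ltW.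
  by apply: divr_ge0 => //; apply: mulr_ge0 => //; exact: divr_ge0.
have m3 : chi * (11 / 5) / 24 * e5' * (1 - B) <= chi * (11 / 5) / 24 * e5'.
  by rewrite ler_piMr.
have m4 : chi * e5' <= chi * (1651 / 1000) by rewrite ler_wpM2l.
have m5 : bulk2_coef * e1' * (1 - B) <= zeta * (11 / 8) * (1 / 108 + 5 / 216) * (2726 / 1000).
  have -> : bulk2_coef * e1' * (1 - B) = bulk2_coef * (1 - B) * e1' by ring.
  have n0 : 0 <= bulk2_coef * (1 - B) by rewrite mulr_ge0 ?bulk2_coef_ge0// ltW.
  apply: ler_pM => //; first exact: ltW.
  rewrite bulk2_coefE -mulrA; apply: ler_wpM2l; first by apply: mulr_ge0 => //; exact: divr_ge0.
  rewrite mulrDl; apply: lerD; first by rewrite ler_piMr.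
  have sz2u := sz2; set u := 1 - sz / 2 in sz2u *.
  have -> : 1 / 216 / u ^+ 3 * (1 - B) = (1 - B) / u ^+ 3 / 216 by field; rewrite gt_eqF.
  rewrite ler_pM2r ?invr_gt0// ler_pdivrMr ?exprn_gt0//.
  (* What remains is [1 - s^2 / 2 <= 5 (1 - s / 2)^3] for [s = sz]; the gap is smallest at its
     critical point [s = 6 / 5]. *)
  apply: (@le_trans _ _ (1 - sz ^+ 2 / 2)).
    by rewrite BE -/zeta; move: chi0 eps0; lra.
  have : 0 <= (sz - 6 / 5) ^+ 2 * u by rewrite mulr_ge0 ?sqr_ge0// ltW.
  by have := sqr_ge0 (sz - 6 / 5); rewrite /u; lra.
by rewrite !mulrDl; move: eps0 zeta0 chi0 X0; lra.
Qed.

End second_order.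
End numerics.

Lemma ge0_integral_average d (T : measurableType d) (R : realType)
    (m : {measure set T -> \bar R}) (A : set T) (F G : T -> R) :
  measurable A -> measurable_fun setT F -> measurable_fun setT G ->
  (forall u, 0 <= F u) -> (forall u, 0 <= G u) ->
  (\int[m]_(u in A) (F u)%:E = \int[m]_(u in A) (G u)%:E)%E ->
  (\int[m]_(u in A) (F u)%:E = \int[m]_(u in A) ((F u + G u) / 2)%:E)%E.
Proof.
move=> mA mF mG F0 G0 FG.
have mF' : measurable_fun A (EFin \o F) by exact/measurable_EFinP/measurable_funTS.
have mG' : measurable_fun A (EFin \o G) by exact/measurable_EFinP/measurable_funTS.
under [RHS]eq_integral do rewrite EFinM EFinD.
rewrite ge0_integralZr//; last 2 first.
- exact: emeasurable_funD.
- by move=> u _; rewrite adde_ge0// lee_fin.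
rewrite ge0_integralD//; last 2 first.
- by move=> u _; rewrite lee_fin.
- by move=> u _; rewrite lee_fin.
have i0 : (0 <= \int[m]_(u in A) (F u)%:E)%E by apply: integral_ge0 => u _; rewrite lee_fin.
rewrite -FG; move: (integral _ _ _) i0 => [i| |] // _.
- by rewrite -EFinD -EFinM; congr EFin; field.
- by rewrite addye// gt0_mulye// lte_fin invr_gt0.
Qed.

(** * Comparison of the Gibbs law with the Gaussian law *)

Section comparison.
Context {R : realType} {p : nat}.
Variables (f : 'rV[R]_p -> R) (xs : 'rV[R]_p) (Q D : 'M[R]_p) (x tau : R).
Hypothesis pQ : posdef Q.
Hypothesis DT : D^T = D.
Hypothesis DQ : forall u, qform (D *m D) u <= qform Q u.
Hypothesis cf : continuous f.
Hypothesis ffin : (gibbs_norm f < +oo)%E.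
Local Notation w := (gauss_density (invmx Q)).
Local Notation mu := (lebesgueRV R p).
Local Notation rho u := (enorm (u *m D)).
Local Notation delta := (laplace_rem f xs Q).
Local Notation E1 := (tilted_density f xs Q).
Let pG := eff_dim (D *m D) Q.
Let q := Num.sqrt pG.
Let t := Num.sqrt (2 * x).
Let r := 2 * q + t.
Hypothesis pG0 : 0 < pG.
Hypothesis x0 : 0 < x.
Hypothesis tau0 : 0 <= tau.
Hypothesis kr : tau * r <= 3 / 4.
Hypothesis delta_bulk : forall u, rho u <= r -> `|delta u| <= tau * rho u ^+ 3 / 6.
Hypothesis delta_far : forall u, r < rho u -> delta u <= tail_exponent q t tau (rho u).

Let q0 : 0 < q. Proof. by rewrite sqrtr_gt0. Qed.
Let q2 : q ^+ 2 = pG. Proof. by rewrite sqr_sqrtr// ltW. Qed.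
Let t0 : 0 < t. Proof. by rewrite sqrtr_gt0 mulr_gt0. Qed.
Let rho_ge0 u : 0 <= rho u. Proof. exact: sqrtr_ge0. Qed.

Lemma gauss_le_tilts (g : borelRV R p -> R) (A : set (borelRV R p))
    (s : seq (R * R)) :
  measurable A -> measurable_fun setT g -> (forall u, 0 <= g u) ->
  (forall c, c \in s -> 0 <= c.1 /\ 0 <= c.2 < 1) ->
  (forall u, w u <= g u + w u * \sum_(c <- s) c.1 * expR (c.2 * rho u ^+ 2 / 2)) ->
  (gauss (invmx Q) A <= \int[mu]_(u in A) (g u)%:E +
    (\sum_(c <- s) c.1 * tilt_mass pG c.2)%:E)%E.
Proof.
move=> mA mg g0 sP wle.
pose h u := (w u * (0 + \sum_(c <- s) c.1 * expR (c.2 * rho u ^+ 2 / 2)))%:E.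
have mh : measurable_fun setT (h : borelRV R p -> \bar R) by exact: measurable_tilts.
have h0 u : (0 <= h u)%E.
  rewrite lee_fin mulr_ge0 ?gauss_density_ge0// add0r big_seq sumr_ge0// => c /sP[c0 _].
  by rewrite mulr_ge0// expR_ge0.
apply: (@le_trans _ _ (\int[mu]_(u in A) ((g u)%:E + h u))%E).
  apply: ge0_le_integral => //.
  - by move=> u _; rewrite lee_fin gauss_density_ge0.
  - by apply/measurable_EFinP/measurable_funTS; exact: measurable_gauss_density.
  - by apply: measurable_funTS; apply: emeasurable_funD => //; exact/measurable_EFinP.
  - by move=> u _; rewrite /h -EFinD lee_fin add0r.
rewrite ge0_integralD//; last 3 first.
- by move=> u _; rewrite lee_fin.
- exact/measurable_EFinP/measurable_funTS.
- exact: measurable_funTS.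
apply: leeD => //.
have := @integral_tilts_le _ _ Q D pQ DT DQ 0 s (lexx _) sP.
rewrite add0r; apply: le_trans.
by apply: ge0_subset_integral.
Qed.

Lemma tilted_tail (u : 'rV[R]_p) : r < rho u -> exists k,
  E1 u <= w u * (shell_coef q t tau k * expR (shell_rate q t k * rho u ^+ 2 / 2)).
Proof.
move=> ru; have [k hk] := tail_exponent_shell q0 t0 kr ru; exists k.
apply: ler_wpM2l; first exact: gauss_density_ge0.
by apply: le_trans hk; rewrite ler_expR delta_far.
Qed.

Lemma tilted_mass_le (g : borelRV R p -> R) (s : seq (R * R)) :
  measurable_fun setT g -> (forall u, 0 <= g u) ->
  (forall c, c \in s -> 0 <= c.1 /\ 0 <= c.2 < 1) ->
  (forall u, rho u <= r ->
     g u <= w u * (1 + \sum_(c <- s) c.1 * expR (c.2 * rho u ^+ 2 / 2))) ->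
  (forall u, r < rho u -> exists k,
     g u <= w u * (shell_coef q t tau k * expR (shell_rate q t k * rho u ^+ 2 / 2))) ->
  (\int[mu]_u (g u)%:E <=
   (1 + (\sum_(c <- s) c.1 * tilt_mass pG c.2 + shell_mass pG x tau))%:E)%E.
Proof.
move=> mg g0 sP gb gt; rewrite addrA.
apply: (@integral_mixture_le _ _ Q D pQ DT DQ g 1 s (shell_coef q t tau)
  (shell_rate q t) _ (expR (- (t ^+ 2 / 4)))) => //.
- by move=> k; exact: expR_ge0.
- by move=> k; exact: shell_rate_bounds.
- exact: shell_ratio_lt1.
- by move=> k; have := shell_coef_bound q0 t0 kr k; rewrite q2.
- by move=> u; have [ru|ru] := leP (rho u) r; [left; exact: gb|right; exact: gt].
Qed.

(** Common frame of both bounds. The density [g] only has to agree with [E1] on the sets of [C],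
    which admits the even part of [E1] in the symmetric case. The tilts in [lo] dominate the deficit
    of [g] below [w] everywhere, those in [up] its excess in the bulk. *)
Lemma sup_dist_tilts (C : set (set (borelRV R p))) (g : borelRV R p -> R)
    (lo up : seq (R * R)) (B : R) :
  C `<=` measurable -> C setT -> (forall A, C A -> C (~` A)) ->
  measurable_fun setT g -> (forall u, 0 <= g u) ->
  (forall A, C A -> (\int[mu]_(u in A) (E1 u)%:E = \int[mu]_(u in A) (g u)%:E)%E) ->
  (forall c, c \in lo -> 0 <= c.1 /\ 0 <= c.2 < 1) ->
  (forall c, c \in up -> 0 <= c.1 /\ 0 <= c.2 < 1) ->
  (forall u, w u <= g u + w u * \sum_(c <- lo) c.1 * expR (c.2 * rho u ^+ 2 / 2)) ->
  (forall u, rho u <= r ->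
     g u <= w u * (1 + \sum_(c <- up) c.1 * expR (c.2 * rho u ^+ 2 / 2))) ->
  (forall u, r < rho u -> exists k,
     g u <= w u * (shell_coef q t tau k * expR (shell_rate q t k * rho u ^+ 2 / 2))) ->
  B < 1 ->
  (\sum_(c <- up) c.1 * tilt_mass pG c.2 + shell_mass pG x tau) * (1 - B) +
    \sum_(c <- lo) c.1 * tilt_mass pG c.2 <= B ->
  (sup_dist C f xs (invmx Q) <= B%:E)%E.
Proof.
move=> mC CT CC mg g0 E1g lo_ge0 up_ge0 wle gb gt B1 total.
have mass_ge0 (s : seq (R * R)) : (forall c, c \in s -> 0 <= c.1 /\ 0 <= c.2 < 1) ->
    0 <= \sum_(c <- s) c.1 * tilt_mass pG c.2.
  by move=> sP; rewrite big_seq sumr_ge0// => c /sP[c0 _]; rewrite mulr_ge0 ?tilt_mass_ge0.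
apply: (sup_dist_le pQ cf ffin mC CC _ _ _ _ B1 total).
- by move=> A CA; rewrite E1g//; apply: gauss_le_tilts => //; exact: mC.
- by rewrite E1g//; exact: tilted_mass_le.
- exact: mass_ge0.
- by rewrite addr_ge0 ?mass_ge0 ?shell_mass_ge0.
Qed.

Lemma sup_dist_first_order (eta := tau * Num.sqrt (pG + 1) ^+ 3) :
  (sup_dist borel_sets f xs (invmx Q) <= (2 * eta + 4 * expR (- x))%:E)%E.
Proof.
set B := 2 * eta + 4 * expR (- x).
have eps0 := expR_gt0 (- x).
have eta0 : 0 <= eta by rewrite mulr_ge0// exprn_ge0// sqrtr_ge0.
have [B1|B1] := leP 1 B.
  by apply: le_trans (sup_dist_le1 _ _ _ _ _) _ => //; rewrite lee_fin.
have eta_lt : 2 * eta < 1 by move: B1; rewrite /B; lra.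
(* In [lo] the first tilt comes from [1 + delta <= exp delta] in the bulk; the second dominates the
   indicator of [rho > r], where all Gaussian mass is given up. *)
pose lo := [:: (eta / 4, (pG + 1)^-1);
  (expR (- (rate0 pG x * r ^+ 2 / 2)), rate0 pG x)].
pose up := [:: (eta / 4 / (1 - eta) ^+ 2, (pG + 1)^-1);
  (9 / 2 * eta * expR (- (99 / 40 * (pG + 1))), 4 / 5)].
apply: (@sup_dist_tilts borel_sets E1 lo up) => //.
- exact: measurableT.
- by move=> A; exact: measurableC.
- exact: measurable_tilted_density.
- by move=> u; exact: tilted_density_ge0.
- move=> c; rewrite !inE => /orP[/eqP->|/eqP->] /=.
    by split; [rewrite divr_ge0|exact: bulk_rate_bounds].
  by split; [exact: expR_ge0|exact: rate0_bounds].
- move=> c; rewrite !inE => /orP[/eqP->|/eqP->] /=.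
    by split; [rewrite divr_ge0 ?sqr_ge0// divr_ge0|exact: bulk_rate_bounds].
  by split; [rewrite mulr_ge0 ?expR_ge0// mulr_ge0// divr_ge0|lra].
- move=> u; rewrite /tilted_density -mulrDr -[X in X <= _]mulr1.
  apply: ler_wpM2l; first exact: gauss_density_ge0.
  rewrite /lo !big_cons big_nil /= addr0.
  have [ru|ru] := leP (rho u) r.
    have h1 := cubic_le_tilt pG0 tau0 (rho_ge0 u).
    have := delta_bulk ru; rewrite ler_norml => /andP[h2 _].
    have h3 := expR_ge1Dx (delta u).
    have h4 : 0 <= expR (- (rate0 pG x * r ^+ 2 / 2)) * expR (rate0 pG x * rho u ^+ 2 / 2).
      by rewrite mulr_ge0 ?expR_ge0.
    by move: h1 h2 h3 h4; rewrite -/eta; lra.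
  have h1 := one_le_tail pG0 x0 (ltW ru).
  have h2 : 0 <= eta / 4 * expR ((pG + 1)^-1 * rho u ^+ 2 / 2).
    by rewrite mulr_ge0 ?expR_ge0// divr_ge0.
  by have := expR_ge0 (delta u); move: h1 h2; lra.
- move=> u ru; apply: ler_wpM2l; first exact: gauss_density_ge0.
  rewrite /up !big_cons big_nil /= addr0.
  apply: le_trans (bulk_upper pG0 tau0 kr eta_lt _); last by rewrite rho_ge0.
  by rewrite ler_expR; apply: le_trans (ler_norm _) (delta_bulk ru).
- by move=> u; exact: tilted_tail.
- apply: (first_order_total pG0 x0 tau0 kr eta_lt) => //.
    by rewrite /up !big_cons big_nil /= addr0.
  by rewrite /lo !big_cons big_nil /= addr0.
Qed.

Lemma symmetric_borelN (A : set (borelRV R p)) (u : 'rV[R]_p) :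
  symmetric_borel_sets A -> A (- u) = A u.
Proof.
move=> [mA AN]; apply/propext; split => Au.
  by rewrite -AN; exists (- u) => //; rewrite opprK.
by rewrite -AN; exists u.
Qed.

Lemma symmetric_borel_setC (A : set (borelRV R p)) :
  symmetric_borel_sets A -> symmetric_borel_sets (~` A).
Proof.
move=> sA; have AN u := symmetric_borelN u sA; case: sA => mA _.
split; first exact: measurableC.
apply/seteqP; split => [_ [u nAu <-]|u nAu]; first by rewrite /setC/= AN.
by exists (- u); rewrite ?opprK// /setC/= AN.
Qed.

Lemma measurable_tilted_densityN : measurable_fun [set: borelRV R p]
  ((fun u : 'rV[R]_p => E1 (- u)) : borelRV R p -> measurableTypeR R).
Proof.
have mN : measurable_fun [set: borelRV R p]
    ((fun u : 'rV[R]_p => - u) : borelRV R p -> borelRV R p).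
  by apply: continuous_measurable_borelRV => u; exact: (cvgN cvg_id).
have mE : measurable_fun [set: borelRV R p] (E1 : borelRV R p -> measurableTypeR R).
  exact: measurable_tilted_density.
exact: measurableT_comp mE mN.
Qed.

Lemma integral_tilted_symmetric (A : set (borelRV R p)) : symmetric_borel_sets A ->
  (\int[mu]_(u in A) (E1 u)%:E =
   \int[mu]_(u in A) ((E1 u + E1 (- (u : 'rV[R]_p))) / 2)%:E)%E.
Proof.
move=> sA; have [mA _] := sA.
have mE : measurable_fun [set: borelRV R p] (E1 : borelRV R p -> measurableTypeR R).
  exact: measurable_tilted_density.
have mEN := measurable_tilted_densityN.
have EN : (\int[mu]_(u in A) (E1 (- (u : 'rV[R]_p)))%:E = \int[mu]_(u in A) (E1 u)%:E)%E.
  rewrite [LHS]integral_mkcond [RHS]integral_mkcond.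
  rewrite -[RHS]ge0_integral_lebesgueRVN.
  - apply: eq_integral => u _; rewrite !patchE; congr (if _ then _ else _).
    by apply/idP/idP; rewrite !inE symmetric_borelN.
  - apply/(measurable_restrictT _ _).1 => //.
    by apply/measurable_EFinP; exact: measurable_funTS.
  - by move=> u; rewrite patchE; case: ifP => // _; rewrite lee_fin tilted_density_ge0.
apply: (ge0_integral_average mA mE mEN _ _ (esym EN)) => u; exact: tilted_density_ge0.
Qed.

Lemma sup_dist_second_order (tau4 : R) (zeta := (tau * Num.sqrt (pG + 2) ^+ 3) ^+ 2)
    (chi := tau4 * (pG + 1) ^+ 2) :
  0 <= tau4 ->
  (forall u, rho u <= r -> `|delta u + delta (- u)| / 2 <= tau4 * rho u ^+ 4 / 24) ->
  (sup_dist symmetric_borel_sets f xs (invmx Q) <=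
   ((zeta + 2 * chi) / 2 + 4 * expR (- x))%:E)%E.
Proof.
move=> tau40 delta_even.
set B := (zeta + 2 * chi) / 2 + 4 * expR (- x).
have eps0 := expR_gt0 (- x).
have zeta0 : 0 <= zeta by exact: sqr_ge0.
have chi0 : 0 <= chi by rewrite mulr_ge0// sqr_ge0.
have mC : (@symmetric_borel_sets R p) `<=` measurable by move=> A [].
have [B1|B1] := leP 1 B.
  by apply: le_trans (sup_dist_le1 _ _ _ _ mC) _ => //; rewrite lee_fin.
have zeta_lt : zeta < 2 by move: B1; rewrite /B; lra.
have rhoN u : rho (- u) = rho u by rewrite mulNmx enorm_opp.
pose lo := [:: (chi * (11 / 5) / 24, (pG + 1)^-1);
  (expR (- (rate0 pG x * r ^+ 2 / 2)), rate0 pG x)].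
pose up := [:: (chi * (11 / 5) / 24, (pG + 1)^-1);
  (bulk2_coef pG tau, 2 / (pG + 2)); (far2_coef pG tau, 4 / 5)].
pose g (u : borelRV R p) : R := (E1 u + E1 (- (u : 'rV[R]_p))) / 2.
have gE u : g u = w u * ((expR (delta u) + expR (delta (- u))) / 2).
  by rewrite /g /tilted_density gauss_densityN mulrA mulrDr.
have quart0 : 0 <= chi * (11 / 5) / 24.
  by apply: divr_ge0 => //; apply: mulr_ge0 => //; exact: divr_ge0.
apply: (@sup_dist_tilts symmetric_borel_sets g lo up) => //.
- split; first exact: measurableT.
  by apply/seteqP; split => // u _; exists (- u); rewrite ?opprK.
- exact: symmetric_borel_setC.
- apply: measurable_funM => //; apply: measurable_funD.
    exact: measurable_tilted_density.
  exact: measurable_tilted_densityN.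
- by move=> u; rewrite divr_ge0// addr_ge0// tilted_density_ge0.
- exact: integral_tilted_symmetric.
- move=> c; rewrite !inE => /orP[/eqP->|/eqP->] /=.
    by split; [|exact: bulk_rate_bounds].
  by split; [exact: expR_ge0|exact: rate0_bounds].
- move=> c; rewrite !inE => /orP[/eqP->|/orP[/eqP->|/eqP->]] /=.
  + by split; [|exact: bulk_rate_bounds].
  + by split; [exact: bulk2_coef_ge0|exact: bulk_rate2_bounds].
  + by split; [exact: far2_coef_ge0|lra].
- move=> u; rewrite gE -mulrDr -[X in X <= _]mulr1.
  apply: ler_wpM2l; first exact: gauss_density_ge0.
  rewrite /lo !big_cons big_nil /= addr0.
  set a := expR (delta u); set b := expR (delta (- u)).
  have a0 : 0 <= a by exact: expR_ge0.
  have b0 : 0 <= b by exact: expR_ge0.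
  have [ru|ru] := leP (rho u) r.
    have h1 := quartic_le_tilt pG0 tau40 (rho_ge0 u).
    have := le_trans (delta_even u ru) h1.
    have : - (delta u + delta (- u)) <= `|delta u + delta (- u)|.
      by rewrite -normrN ler_norm.
    have h3 := expR_ge1Dx (delta u); have h4 := expR_ge1Dx (delta (- u)).
    have h5 : 0 <= expR (- (rate0 pG x * r ^+ 2 / 2)) * expR (rate0 pG x * rho u ^+ 2 / 2).
      by rewrite mulr_ge0 ?expR_ge0.
    by move: h3 h4 h5; rewrite -/a -/b -/chi; lra.
  have h1 := one_le_tail pG0 x0 (ltW ru).
  have h2 : 0 <= chi * (11 / 5) / 24 * expR ((pG + 1)^-1 * rho u ^+ 2 / 2).
    by apply: mulr_ge0 => //; exact: expR_ge0.
  by move: h1 h2 a0 b0; lra.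
- move=> u ru; rewrite gE; apply: ler_wpM2l; first exact: gauss_density_ge0.
  rewrite /up !big_cons big_nil /= addr0.
  have h1 := quartic_le_tilt pG0 tau40 (rho_ge0 u).
  have h2 := le_trans (delta_even u ru) h1.
  have h3 := ler_norm (delta u + delta (- u)).
  have rN : rho (- u) <= r by rewrite rhoN.
  have h4 := expR_le_order2_abs (delta_bulk ru).
  have := expR_le_order2_abs (delta_bulk rN); rewrite rhoN => h5.
  have h6 : 0 <= rho u <= r by rewrite rho_ge0.
  have h7 := bulk_upper2 pG0 tau0 kr zeta_lt h6.
  by move: h2 h3 h4 h5 h7; rewrite -/chi; lra.
- move=> u ru.
  have [k hk] := tail_exponent_shell q0 t0 kr ru; exists k.
  rewrite gE; apply: ler_wpM2l; first exact: gauss_density_ge0.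
  have rN : r < rho (- u) by rewrite rhoN.
  have h1 : expR (delta u) <= expR (tail_exponent q t tau (rho u)).
    by rewrite ler_expR delta_far.
  have h2 : expR (delta (- u)) <= expR (tail_exponent q t tau (rho u)).
    by rewrite ler_expR -rhoN delta_far.
  by move: h1 h2 hk; lra.
- apply: (second_order_total pG0 x0 tau0 kr tau40 zeta_lt) => //.
    by rewrite /up !big_cons big_nil /= addr0 !addrA.
  by rewrite /lo !big_cons big_nil /= addr0.
Qed.

End comparison.

Theorem theorem2p4 (R : realType) (p : nat) (hp : (0 < p)%N)
    (f : 'rV[R]_p -> R) (xstar : 'rV[R]_p) (G D : 'M[R]_p)
    (nu x n c3 : R) (h : 'rV[R]_p -> R) :
  let DG2 := - hessian f xstar in
  let D2 := DG2 - G *m G in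
  let ell := fun y => f y + enorm ((y - xstar) *m G) ^+ 2 / 2 in
  let pG := eff_dim D2 DG2 in
  let rG := local_radius D2 DG2 x in
  let U := [set u : 'rV[R]_p | enorm (u *m D) <= nu^-1 * rG] in
  classC 3 f ->
  (gibbs_norm f < +oo)%E ->
  (forall y, f y <= f xstar) ->
  posdef DG2 ->
  possemidef G ->
  possemidef D2 ->
  psd_sqrt D D2 ->
  convex_function setT (fun u : 'rV[R]_p => - ell (xstar + u)) ->
  0 < nu < 1 ->
  0 < x ->
  0 < n ->
  strongly_convex h ->
  (forall y, - ell y = n * h y) ->
  (sup_nabla_ratio 3 h xstar U <= c3%:E)%E ->
  c3 * rG * (Num.sqrt n)^-1 <= 3 / 4 ->
  (sup_dist borel_sets f xstar (invmx DG2)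
     <= (2 * c3 * Num.sqrt ((pG + 1) ^+ 3 / n) + 4 * expR (- x))%:E)%E /\
  (forall c4 : R,
    classC 4 f ->
    (sup_nabla_ratio 4 h xstar U <= c4%:E)%E ->
    (sup_dist symmetric_borel_sets f xstar (invmx DG2)
       <= ((c3 ^+ 2 * (pG + 2) ^+ 3 + 2 * c4 * (pG + 1) ^+ 2) / (2 * n)
           + 4 * expR (- x))%:E)%E).
Proof.
move=> DG2 D2 ell pG rG U fC ffin fmax pQ [GT _] _ [[DT _] DE] cvx.
move=> /andP[nu0 nu1] x0 n0 hsc hE hc3 kr.
have QE : DG2 = - hessian f xstar by [].
have rho_pos := rho_gt0 QE GT DT DE fC fmax n0 hsc hE.
have nabla2_gt0 u : u != 0 -> 0 < nabla_form 2 h xstar u.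
  by move=> u0; rewrite (nabla_form2_h QE GT DT DE fC n0 hE) divr_gt0// exprn_gt0// rho_pos.
(* A nonzero vector, available since [0 < p]: it shows [D != 0], hence [pG > 0]. Rescaled into [U],
   it is the test point giving the signs of [c3] and [c4]. *)
pose e : 'rV[R]_p := const_mx 1.
have e0 : e != 0.
  by apply/eqP => /rowP/(_ (Ordinal hp)); rewrite !mxE; apply/eqP; exact: oner_neq0.
have pGE : pG = eff_dim (D *m D) DG2 by rewrite DE.
have pG0 : 0 < pG.
  rewrite pGE; apply: eff_dim_gt0 => //.
  by apply: contraTneq (rho_pos e e0) => ->; rewrite mulmx0 enorm0 ltxx.
have rG0 : 0 < rG.
  by rewrite addr_gt0 ?mulr_gt0// sqrtr_gt0// mulr_gt0.
have rU u : enorm (u *m D) <= rG -> U u.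
  move=> ur; apply: (le_trans ur); rewrite ler_peMl ?(ltW rG0)//.
  by rewrite -[leLHS]invr1 lef_pV2 ?posrE// ltW.
pose v := (rG / enorm (e *m D)) *: e.
have vr0 : 0 < rG / enorm (e *m D) by rewrite divr_gt0// rho_pos.
have v0 : v != 0 by rewrite scaler_eq0 negb_or e0 andbT gt_eqF.
have Uv : U v.
  apply: rU; rewrite -scalemxAl enorm_scale gtr0_norm// divfK//.
  by rewrite gt_eqF// rho_pos.
have t01 : 0 <= (0 : R) <= 1 by rewrite lexx ler01.
have [c30 _] := le_sup_nabla_ratio hc3 Uv v0 t01 (nabla2_gt0 v v0).
set tau := c3 / Num.sqrt n.
have sn0 : 0 < Num.sqrt n by rewrite sqrtr_gt0.
have snE : Num.sqrt n ^+ 2 = n by rewrite sqr_sqrtr// ltW.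
have tau0 : 0 <= tau by rewrite divr_ge0// ltW.
have DQ u : qform (D *m D) u <= qform DG2 u.
  by rewrite qform_sqr// (qformQ GT DT DE) lerDl sqr_ge0.
have rGE : 2 * Num.sqrt (eff_dim (D *m D) DG2) + Num.sqrt (2 * x) = rG.
  by rewrite -pGE.
have kr' : tau * (2 * Num.sqrt (eff_dim (D *m D) DG2) + Num.sqrt (2 * x)) <= 3 / 4.
  by rewrite rGE /tau mulrAC.
have pG0' : 0 < eff_dim (D *m D) DG2 by rewrite -pGE.
have bulk u : enorm (u *m D) <= 2 * Num.sqrt (eff_dim (D *m D) DG2) + Num.sqrt (2 * x) ->
    `|laplace_rem f xstar DG2 u| <= tau * enorm (u *m D) ^+ 3 / 6.
  rewrite rGE; exact: (delta_cubic QE GT DT DE fC fmax n0 hsc hE rU hc3).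
have far u : 2 * Num.sqrt (eff_dim (D *m D) DG2) + Num.sqrt (2 * x) < enorm (u *m D) ->
    laplace_rem f xstar DG2 u <= tail_exponent (Num.sqrt (eff_dim (D *m D) DG2))
      (Num.sqrt (2 * x)) tau (enorm (u *m D)).
  rewrite /tail_exponent rGE => ur.
  exact: (delta_tail QE GT DT DE fC fmax cvx n0 hsc hE rU hc3 ur rG0).
have cf : continuous f by exact: classC_continuous fC.
have pow3 : Num.sqrt ((pG + 1) ^+ 3 / n) = Num.sqrt (pG + 1) ^+ 3 / Num.sqrt n.
  have p10 : 0 <= pG + 1 by rewrite addr_ge0// ltW.
  by rewrite sqrtrM ?exprn_ge0// sqrtrV ?(ltW n0)// !exprS !expr0 !mulr1 !sqrtrM.
split.
  apply: le_trans (sup_dist_first_order pQ DT DQ cf ffin pG0' x0 tau0 kr' bulk far) _.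
  rewrite lee_fin lerD2r -pGE pow3 /tau le_eqVlt; apply/orP; left; apply/eqP.
  by field; rewrite gt_eqF.
move=> c4 f4 hc4.
have [c40 _] := le_sup_nabla_ratio hc4 Uv v0 t01 (nabla2_gt0 v v0).
have tau40 : 0 <= c4 / n by rewrite divr_ge0// ltW.
have even u : enorm (u *m D) <= 2 * Num.sqrt (eff_dim (D *m D) DG2) + Num.sqrt (2 * x) ->
    `|laplace_rem f xstar DG2 u + laplace_rem f xstar DG2 (- u)| / 2 <=
    c4 / n * enorm (u *m D) ^+ 4 / 24.
  rewrite rGE; exact: (delta_even QE GT DT DE fC fmax n0 hsc hE rU f4 hc4).
apply: le_trans (sup_dist_second_order pQ DT DQ cf ffin pG0' x0 tau0 kr' bulk far tau40 even) _.
rewrite lee_fin lerD2r -pGE /tau le_eqVlt; apply/orP; left; apply/eqP.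
have p20 : 0 <= pG + 2 by rewrite addr_ge0// ltW.
have -> : (c3 / Num.sqrt n * Num.sqrt (pG + 2) ^+ 3) ^+ 2 =
    c3 ^+ 2 / Num.sqrt n ^+ 2 * (Num.sqrt (pG + 2) ^+ 2) ^+ 3 by field; rewrite gt_eqF.
by rewrite snE sqr_sqrtr//; field; rewrite gt_eqF.
Qed.
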